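(* For real binary forms of degree $7$, the real rank boundaries are the following hypersurfaces of $\mathbb{P}(\mathbb{C}[x,y]_7)\cong\mathbb{P}^7_{\mathbb{C}}$: \begin{align*} \partial_{\mathrm{alg}}(\mathcal{R}_{7,4}) &= (\Delta_{(3,2,2)})^\vee,\\ \partial_{\mathrm{alg}}(\mathcal{R}_{7,5}) &= (\Delta_{(3,2,2)})^\vee\cup(\Delta_{(4,3)})^\vee\cup(\Delta_{(5,2)})^\vee,\\ \partial_{\mathrm{alg}}(\mathcal{R}_{7,6}) &= (\Delta_{(4,3)})^\vee\cup(\Delta_{(5,2)})^\vee\cup(\Delta_{(7)})^\vee,\\ \partial_{\mathrm{alg}}(\mathcal{R}_{7,7}) &= (\Delta_{(7)})^\vee. \end{align*}
   Context: Let $R=\mathbb{R}[x,y]$ and $R_d$ its space of binary forms of degree $d$. The real rank $\mathrm{rk}(f)$ of $f\in R_d$ is the least $r$ such that $f=\sum_{i=1}^r c_i l_i^d$ with $l_i\in R_1$, $c_i\in\mathbb{R}$. Let $\Omega_{d,r}=\{f\in R_d:\mathrm{rk}(f)=r\}$ and let $\mathcal{R}_{d,r}$ be the interior of $\Omega_{d,r}$ in the Euclidean topology (nonempty exactly when $\frac{d+1}{2}\le r\le d$). The topological boundary $\partial(\mathcal{R}_{d,r})$ is the closure of $\mathcal{R}_{d,r}$ minus the interior of the closure of $\mathcal{R}_{d,r}$; the real rank boundary $\partial_{\mathrm{alg}}(\mathcal{R}_{d,r})$ is the Zariski closure of $\partial(\mathcal{R}_{d,r})$, regarded as a hypersurface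 in the complex projective space $\mathbb{P}(\mathbb{C}[x,y]_d)$ (with coordinates $(a_0,\dots,a_d)$ for $f=\sum_i\binom{d}{i}a_ix^{d-i}y^i$). Let $\mathbb{C}[u,v]=\mathbb{C}[\partial_x,\partial_y]$ act on $\mathbb{C}[x,y]$ by differentiation, giving a perfect pairing $\mathbb{C}[x,y]_d\otimes\mathbb{C}[u,v]_d\to\mathbb{C}$. For a partition $\lambda=(\lambda_1,\dots,\lambda_n)$ of $d$, the coincident root locus $\Delta_\lambda\subset\mathbb{P}(\mathbb{C}[u,v]_d)$ is the set of forms that factor as $\prod_{i=1}^n\ell_i^{\lambda_i}$ with $\ell_i\in\mathbb{C}[u,v]_1$. Its dual variety $(\Delta_\lambda)^\vee\subset\mathbb{P}(\mathbb{C}[x,y]_d)$ is the closure of the set of $f$ (viewed as hyperplanes via the pairing) containing the embedded tangent space $T_g\Delta_\lambda$ at some smooth point $g$ of $\Delta_\lambda$; equivalently, $(\Delta_\lambda)^\vee$ consists of the $f\in\mathbb{C}[x,y]_d$ annihilated by some differential operator $\prod_{i=1}^n\ell_i^{\lambda_i-1}(\partial_x,\partial_y)$ with $\ell_i\in\mathbb{C}[u,v]_1$. *)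

(* Defs.v *)
From Stdlib Require Import Reals.
From mathcomp Require Import all_boot all_algebra.
From mathcomp Require Import Rstruct.
From mathcomp.real_closed Require Import complex.
From mathcomp Require Import mpoly.
Set Implicit Arguments. Unset Strict Implicit. Unset Printing Implicit Defensive.
Import GRing.Theory Num.Theory.
Local Open Scope ring_scope.

Notation RR := Rdefinitions.R.
Notation CC := (complex Rdefinitions.R).

Definition bform (F : comNzRingType) (a : 'I_8 -> F) : {mpoly F[2]} :=
  \sum_(i < 8) (('C(7, i))%:R * a i) *: ('X_0 ^+ (7 - i) * 'X_1 ^+ i).

Definition rank_le (a : 'I_8 -> RR) (r : nat) : Prop :=
  exists (c p q : 'I_r -> RR),
    bform a = \sum_(j < r) c j *: (p j *: 'X_0 + q j *: 'X_1) ^+ 7.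

Definition real_rank_eq (a : 'I_8 -> RR) (r : nat) : Prop :=
  rank_le a r /\ forall s, rank_le a s -> (r <= s)%N.

Definition Omega (r : nat) : ('I_8 -> RR) -> Prop := fun a => real_rank_eq a r.

Definition dist2 (a b : 'I_8 -> RR) : RR := \sum_(i < 8) (a i - b i) ^+ 2.

Definition interior (S : ('I_8 -> RR) -> Prop) : ('I_8 -> RR) -> Prop :=
  fun a => exists e : RR, 0 < e /\ forall b, dist2 a b < e -> S b.

Definition closure (S : ('I_8 -> RR) -> Prop) : ('I_8 -> RR) -> Prop :=
  fun a => forall e : RR, 0 < e -> exists b, S b /\ dist2 a b < e.

Definition topbd (S : ('I_8 -> RR) -> Prop) : ('I_8 -> RR) -> Prop :=
  fun a => closure S a /\ ~ interior (closure S) a.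

Definition Rint (r : nat) := interior (Omega r).

Definition complexify (a : 'I_8 -> RR) : 'I_8 -> CC := fun i => (a i)%:C%C.

(* Zariski closure in C^8 (affine cones represent projective varieties) *)
Definition zariski_closure (S : ('I_8 -> CC) -> Prop) : ('I_8 -> CC) -> Prop :=
  fun z => forall P : {mpoly CC[8]},
      (forall w, S w -> P.@[w] = 0) -> P.@[z] = 0.

Definition real_rank_boundary (r : nat) : ('I_8 -> CC) -> Prop :=
  zariski_closure (fun w => exists a, topbd (Rint r) a /\ w = complexify a).

Definition dop (l : CC * CC) (F : {mpoly CC[2]}) : {mpoly CC[2]} :=
  l.1 *: mderiv 0 F + l.2 *: mderiv 1 F.

Definition apply_ops (ls : seq (CC * CC)) (lam : seq nat) (F : {mpoly CC[2]}) :=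
  foldr (fun lm G => iter lm.2.-1 (dop lm.1) G) F (zip ls lam).

(* dual variety of the coincident root locus Delta_lam (as an affine cone) *)
Definition dual_CRL (lam : seq nat) : ('I_8 -> CC) -> Prop :=
  fun z => exists ls : seq (CC * CC),
      size ls = size lam /\ (forall l, l \in ls -> l != (0, 0)) /\
      apply_ops ls lam (bform z) = 0.

(* Main.v *)
(** Dehomogenising, a septic with coefficients [a] becomes the functional [Lf a] with
    [X^i |-> a_i], and a form killing it is a polynomial [g] such that [Lf a] vanishes on the
    multiples of [g].  By Lagrange interpolation, [a] has real rank at most [r] iff it is killed
    by a product of [r] pairwise independent real linear forms; by compactness, [a] is a limit
    of such points iff it is killed by a product of [r] real linear forms, repetitions allowed.

    Boundary points lie in dual varieties: multiple zeros of the killing form can be split into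
    simple real ones by a sign-change argument unless a form with few distinct zeros kills [a],
    and iterating this leaves only the obstructions [l^2 m n], [l^3 m^2], [l^4 m] and [l^6].
    The corresponding dual varieties are Zariski closed by elimination of one point [l] of the
    projective line.

    Conversely, up to a linear change of variables and a polynomial deformation, a point of such a
    dual variety lies in a linear normal form.  Near a well-chosen real point of the normal
    form, every point is a limit of interior points of two different ranks, hence a boundary
    point, so that a polynomial vanishing on the boundary vanishes on the dual variety.  Lower
    bounds on ranks come from the coefficients of [h(t) h(-t)], whose alternating signs and
    log-concavity hold for every [h] with only real zeros, and, in rank seven, from Rolle's
    theorem applied to polar derivatives. *)
Require Import Defs.
From Stdlib Require Import Reals Classical_Prop ClassicalEpsilon FunctionalExtensionality.
From mathcomp Require Import all_boot all_order all_algebra.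
From mathcomp Require Import Rstruct.
From mathcomp.real_closed Require Import complex polyorder polyrcf.
From mathcomp Require Import mpoly.
From mathcomp Require Import zify ring lra.
Set Implicit Arguments. Unset Strict Implicit. Unset Printing Implicit Defensive.
Import Order.TTheory GRing.Theory Num.Theory.
Local Open Scope ring_scope.
Local Notation closure := Defs.closure.
Local Notation interior := Defs.interior.

(** * Apolarity *)

(** A form of degree [e] kills a septic by [8 - e] linear equations, so a generic septic is killed
    by a line of quartics, a three-dimensional space of quintics and a five-dimensional space of
    sextics. On a line of quartics nothing can move a double zero away, so [l^2 m n] alone bounds
    rank four. In higher degree there is room to move, and it fails only when the equations
    degenerate on the forms that keep each zero with multiplicity one less; such a degeneration is
    again a killing form, which is what lets the argument be iterated. Accordingly [l^2 m n]
    separates rank four from five, [l^3 m^2] and [l^4 m] five from six, and [l^6] six from seven.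

    For the converse, nothing says that every real point of a dual variety is a boundary point. One
    small piece suffices because each variety is dominated by an affine space, matrices times a
    linear space of normal forms, on which a polynomial that vanishes near one real point vanishes
    identically. The numerical work then consists in finding one real point in each normal form
    around which two ranks can be told apart. *)

Section Functional.
Variable F : fieldType.
Implicit Types (a : 'I_8 -> F) (g h y : {poly F}).

Definition Lf a h : F := \sum_(i < 8) h`_i * a i.

Lemma LfD a g h : Lf a (g + h) = Lf a g + Lf a h.
Proof. by rewrite -big_split; apply: eq_bigr => i _; rewrite coefD mulrDl. Qed.

Lemma LfZ a c g : Lf a (c *: g) = c * Lf a g.
Proof. by rewrite mulr_sumr; apply: eq_bigr => i _; rewrite coefZ mulrA. Qed.

Lemma Lf0 a : Lf a 0 = 0.
Proof. by apply: big1 => i _; rewrite coef0 mul0r. Qed.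

Lemma LfN a g : Lf a (- g) = - Lf a g.
Proof. by rewrite -scaleN1r LfZ mulN1r. Qed.

Lemma LfB a g h : Lf a (g - h) = Lf a g - Lf a h.
Proof. by rewrite LfD LfN. Qed.

Lemma Lf_sum a I (r : seq I) P (G : I -> {poly F}) :
  Lf a (\sum_(i <- r | P i) G i) = \sum_(i <- r | P i) Lf a (G i).
Proof. exact: (big_morph (Lf a) (LfD a) (Lf0 a)). Qed.

Lemma Lf_Xn a (i : 'I_8) : Lf a 'X^i = a i.
Proof.
rewrite /Lf (bigD1 i) //= coefXn eqxx mul1r big1 ?addr0 // => j ne.
by rewrite coefXn val_eqE (negbTE ne) mul0r.
Qed.

Lemma eq_Lf a b g : a =1 b -> Lf a g = Lf b g.
Proof. by move=> e; apply: eq_bigr => i _; rewrite e. Qed.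

Lemma Lf_addl a b g : Lf (fun i => a i + b i) g = Lf a g + Lf b g.
Proof. by rewrite -big_split; apply: eq_bigr => i _; rewrite mulrDr. Qed.

Lemma Lf_scalel c a g : Lf (fun i => c * a i) g = c * Lf a g.
Proof. by rewrite mulr_sumr; apply: eq_bigr => i _; ring. Qed.

Lemma poly_sumX n g : (size g <= n)%N -> g = \sum_(i < n) g`_i *: 'X^i.
Proof.
move=> le; apply/polyP => i; rewrite coef_sum.
case: (ltnP i n) => h.
  rewrite (bigD1 (Ordinal h)) //= coefZ coefXn eqxx mulr1 big1 ?addr0 // => j.
  by rewrite -val_eqE /= coefZ coefXn eq_sym => /negbTE ->; rewrite mulr0.
rewrite nth_default ?(leq_trans le) // big1 // => j _.
by rewrite coefZ coefXn gtn_eqF ?mulr0 // (leq_trans (ltn_ord j)).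
Qed.

(* [g] is read as a binary form of degree [e], and [e] may exceed the degree of
   the polynomial: the missing factors are roots at infinity. *)
Definition kills e a g := forall y, (size y <= 8 - e)%N -> Lf a (g * y) = 0.

Lemma kills_monomials e a g :
  (forall k, (k < 8 - e)%N -> Lf a (g * 'X^k) = 0) -> kills e a g.
Proof.
move=> H y /poly_sumX ->; rewrite mulr_sumr Lf_sum big1 // => i _.
by rewrite -scalerAr LfZ H ?mulr0.
Qed.

Lemma kills_Xn e a g k : kills e a g -> (k < 8 - e)%N -> Lf a (g * 'X^k) = 0.
Proof. by move=> K lt; apply: K; rewrite size_polyXn. Qed.

Lemma size_mul_leq3 g h m n : (size g <= m)%N -> (size h <= n)%N ->
  (size (g * h)%R <= (m + n).-1)%N.
Proof. by move=> sg sh; have := size_polyMleq g h; lia. Qed.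

Lemma kills_mulr e e' a g g' : kills e a g -> (size g' <= e'.+1)%N ->
  kills (e + e') a (g * g').
Proof.
move=> K sg' y sy; rewrite -mulrA.
have [->|y0] := eqVneq y 0; first by rewrite !mulr0 Lf0.
apply: K; have := size_mul_leq3 sg' sy; move: y0; rewrite -size_poly_gt0; lia.
Qed.

Lemma kills_mull e e' a g g' : kills e a g -> (size g' <= e'.+1)%N ->
  kills (e' + e) a (g' * g).
Proof. by move=> K s; rewrite mulrC addnC; apply: kills_mulr. Qed.

Lemma killsZ e a c g : kills e a g -> kills e a (c *: g).
Proof. by move=> K y sy; rewrite -scalerAl LfZ K ?mulr0. Qed.

Lemma eq_kills e a b g : a =1 b -> kills e a g -> kills e b g.
Proof. by move=> e1 K y sy; rewrite -(eq_Lf _ e1) K. Qed.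

(** A pair with second coordinate zero gives a constant: as a factor of a form of prescribed degree
    it is the zero at infinity. *)
Definition lf (l : F * F) : {poly F} := l.1%:P + l.2 *: 'X.
Definition prodf (s : seq (F * F)) := \prod_(l <- s) lf l.

Lemma coef_lf l i : (lf l)`_i = if i is j.+1 then (if j is 0%N then l.2 else 0) else l.1.
Proof.
rewrite /lf coefD coefC coefZ coefX; case: i => [|[|i]] /=;
by rewrite ?mulr0 ?mulr1 ?addr0 ?add0r.
Qed.

Lemma size_lf l : (size (lf l) <= 2)%N.
Proof. by apply/leq_sizeP => -[|[|i]] // _; rewrite coef_lf. Qed.

Lemma lf_neq0 l : (l != (0, 0)) = (lf l != 0).
Proof.
case: l => u v; congr (~~ _); apply/eqP/eqP => [[-> ->]|H].
  by apply/polyP => -[|[|i]]; rewrite coef_lf coef0.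
by move: (coef_lf (u, v) 0) (coef_lf (u, v) 1); rewrite H !coef0 /= => <- <-.
Qed.

Lemma prodf_nonzero s : {in s, forall l, l != (0, 0)} -> prodf s != 0.
Proof.
move=> H; rewrite /prodf prodf_seq_neq0; apply/allP => l ls.
by rewrite -lf_neq0 H.
Qed.

Lemma prodf_cons l s : prodf (l :: s) = lf l * prodf s.
Proof. by rewrite /prodf big_cons. Qed.

Lemma prodf_cat s t : prodf (s ++ t) = prodf s * prodf t.
Proof. by rewrite /prodf big_cat. Qed.

Lemma prodf_nil : prodf [::] = 1. Proof. by rewrite /prodf big_nil. Qed.

Lemma prodf_nseq n l : prodf (nseq n l) = lf l ^+ n.
Proof. by rewrite /prodf big_nseq -Monoid.iteropE. Qed.

Lemma perm_prodf s t : perm_eq s t -> prodf s = prodf t.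
Proof. exact: perm_big. Qed.

Lemma size_prodf s : (size (prodf s) <= (size s).+1)%N.
Proof.
elim: s => [|l s IH]; first by rewrite prodf_nil size_poly1.
by rewrite prodf_cons; have := size_mul_leq3 (size_lf l) IH; rewrite /=; lia.
Qed.

End Functional.

(** * Binary forms and their derivatives *)

Section BinaryForms.
Variable F : numFieldType.
Implicit Types (a : nat -> F) (d : nat).

Definition bf d a : {mpoly F[2]} :=
  \sum_(i < d.+1) (('C(d, i))%:R * a i) *: ('X_0 ^+ (d - i) * 'X_1 ^+ i).

Definition dehom (p : {mpoly F[2]}) : {poly F} :=
  mmap (@polyC F) (fun i : 'I_2 => if i == 0 then 1 else 'X) p.

Lemma dehomX0 : dehom 'X_0 = 1. Proof. by rewrite /dehom mmapX mmap1U. Qed.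
Lemma dehomX1 : dehom 'X_1 = 'X. Proof. by rewrite /dehom mmapX mmap1U. Qed.

Lemma dehom_mono m n : dehom ('X_0 ^+ m * 'X_1 ^+ n) = 'X^n.
Proof.
rewrite /dehom rmorphM /=; set f := mmap _ _.
have fX p k : f (p ^+ k) = f p ^+ k.
  elim: k => [|k IH]; first by rewrite !expr0 /f rmorph1.
  by rewrite !exprS -IH /f rmorphM.
by rewrite !fX [f _]dehomX0 [f _]dehomX1 expr1n mul1r.
Qed.

Lemma dehom_bf d a : dehom (bf d a) = \poly_(i < d.+1) (('C(d, i))%:R * a i).
Proof.
rewrite poly_def /bf /dehom raddf_sum; apply: eq_bigr => i _.
by rewrite /= mmapZ [X in _ * X]dehom_mono mul_polyC.
Qed.

Lemma bf_inj d a b : bf d a = bf d b -> forall k, (k <= d)%N -> a k = b k.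
Proof.
move=> /(congr1 dehom); rewrite !dehom_bf => /polyP H k kd.
have := H k; rewrite !coef_poly ltnS kd => /mulfI; apply.
by rewrite pnatr_eq0 -lt0n bin_gt0.
Qed.

Lemma bf_eq0 d a : bf d a = 0 <-> forall k, (k <= d)%N -> a k = 0.
Proof.
split=> [H k kd|H].
  apply: (bf_inj (b := fun=> 0) _ kd); rewrite H /bf big1 // => i _.
  by rewrite mulr0 scale0r.
by rewrite /bf big1 // => i _; rewrite H ?mulr0 ?scale0r // -ltnS.
Qed.

Lemma mderiv_mono0 m n : mderiv (0 : 'I_2) ('X_0 ^+ m * 'X_1 ^+ n : {mpoly F[2]}) =
  m%:R *: ('X_0 ^+ m.-1 * 'X_1 ^+ n).
Proof.
rewrite !mpolyXn -!mpolyXD mderivX mnmDE !mulmnE !mnm1E eqxx mul1n.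
rewrite (_ : (1 == 0 :> 'I_2) = false) // mul0n addn0.
case: m => [|m]; first by rewrite !scale0r.
have -> : (U_(0%R) *+ m.+1 + U_(1%R) *+ n - U_(0%R) = U_(0%R) *+ m + U_(1%R) *+ n :> 'X_{1..2})%MM.
  by apply/mnmP => i; rewrite mnmBE !mnmDE !mulmnE !mnm1E; case: (0 == i); lia.
by [].
Qed.

Lemma mderiv_mono1 m n : mderiv (1 : 'I_2) ('X_0 ^+ m * 'X_1 ^+ n : {mpoly F[2]}) =
  n%:R *: ('X_0 ^+ m * 'X_1 ^+ n.-1).
Proof.
rewrite !mpolyXn -!mpolyXD mderivX mnmDE !mulmnE !mnm1E eqxx mul1n.
rewrite (_ : (0 == 1 :> 'I_2) = false) // mul0n add0n.
case: n => [|n]; first by rewrite !scale0r.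
have -> : (U_(0%R) *+ m + U_(1%R) *+ n.+1 - U_(1%R) = U_(0%R) *+ m + U_(1%R) *+ n :> 'X_{1..2})%MM.
  by apply/mnmP => i; rewrite mnmBE !mnmDE !mulmnE !mnm1E; case: (1 == i); lia.
by [].
Qed.

Lemma mderiv0_bf d a : mderiv (0 : 'I_2) (bf d.+1 a) = d.+1%:R *: bf d a.
Proof.
rewrite /bf raddf_sum big_ord_recr /= mderivZ mderiv_mono0 subnn scale0r scaler0 addr0.
rewrite scaler_sumr; apply: eq_bigr => i _; rewrite mderivZ mderiv_mono0 !scalerA.
have -> : ((d.+1 - i).-1 = d - i)%N by lia.
congr (_ *: _); rewrite mulrAC mulrA -!natrM; congr (_%:R * _).
by rewrite mulnC -mul_bin_left mul_bin_diag; have := ltn_ord i; lia.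
Qed.

Lemma mderiv1_bf d a :
  mderiv (1 : 'I_2) (bf d.+1 a) = d.+1%:R *: bf d (fun k => a k.+1).
Proof.
rewrite /bf raddf_sum big_ord_recl /= mderivZ mderiv_mono1 scale0r scaler0 add0r.
rewrite scaler_sumr; apply: eq_bigr => i _; rewrite mderivZ mderiv_mono1 !scalerA.
rewrite /bump /= add1n subSS; congr (_ *: _).
by rewrite mulrAC mulrA -!natrM mulnC mul_bin_diag.
Qed.

Lemma eq_bf d a b : (forall k, (k <= d)%N -> a k = b k) -> bf d a = bf d b.
Proof. by move=> H; apply: eq_bigr => i _; rewrite H // -ltnS. Qed.

End BinaryForms.

(** * Dual varieties in terms of killing forms *)

Section CoincidentRoots.
Implicit Types (z : 'I_8 -> CC) (g : {poly CC}).

(** The coefficients, in the binomial normalisation of [bf] and up to a scalar, of the form obtained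
    by applying [g] as a differential operator; see [iter_dop]. *)
Definition moments (F : fieldType) (a : 'I_8 -> F) (g : {poly F}) (k : nat) : F :=
  Lf a (g * 'X^k).

Lemma bform_bf z : bform z = bf 7 (moments z 1).
Proof. by apply: eq_bigr => i _; rewrite /moments mul1r Lf_Xn. Qed.

Lemma dop_bf d l (b : nat -> CC) :
  dop l (bf d.+1 b) = d.+1%:R *: bf d (fun k => l.1 * b k + l.2 * b k.+1).
Proof.
rewrite /dop mderiv0_bf mderiv1_bf !scalerA ![_ * _%:R]mulrC -!scalerA -scalerDr.
congr (_ *: _); rewrite /bf !scaler_sumr -big_split; apply: eq_bigr => i _ /=.
by rewrite !scalerA -scalerDl; congr (_ *: _); ring.
Qed.

Lemma dopZ l c F : dop l (c *: F) = c *: dop l F.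
Proof. by rewrite /dop !mderivZ scalerDr !scalerA ![_ * c]mulrC. Qed.

Lemma iter_dopZ m l c F : iter m (dop l) (c *: F) = c *: iter m (dop l) F.
Proof. by elim: m => //= m ->; exact: dopZ. Qed.

Lemma moments_lf (F : fieldType) (a : 'I_8 -> F) (g : {poly F}) l k :
  l.1 * moments a g k + l.2 * moments a g k.+1 = moments a (lf l * g) k.
Proof.
rewrite /moments /lf !mulrDl LfD -!mul_polyC exprS -!mulrA; congr (_ + _).
  by rewrite mul_polyC LfZ.
by rewrite mul_polyC LfZ mulrCA.
Qed.

Lemma iter_dop z m d g l : exists2 c : CC, c != 0 &
  iter m (dop l) (bf (m + d) (moments z g)) = c *: bf d (moments z (lf l ^+ m * g)).
Proof.
elim: m d => [|m IH] d; first by exists 1; rewrite ?oner_eq0 ?scale1r ?expr0 ?mul1r.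
have [c c0] := IH d.+1; rewrite addnS -addSn => E.
rewrite iterS E dopZ dop_bf scalerA; exists (c * d.+1%:R).
  by rewrite mulf_neq0 // pnatr_eq0.
congr (_ *: _); apply: eq_bf => k _.
by rewrite moments_lf exprS mulrA.
Qed.

Lemma apply_opsE z (s : seq ((CC * CC) * nat)) :
  let e := sumn [seq lm.2.-1 | lm <- s] in (e <= 7)%N ->
  exists2 c : CC, c != 0 &
    foldr (fun lm G => iter lm.2.-1 (dop lm.1) G) (bform z) s =
    c *: bf (7 - e) (moments z (\prod_(lm <- s) lf lm.1 ^+ lm.2.-1)).
Proof.
elim: s => [|lm s IH] /= le.
  by exists 1; rewrite ?oner_eq0 // scale1r big_nil bform_bf.
have [|c c0 ->] := IH; first by apply: leq_trans le; rewrite leq_addl.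
set e := sumn _ in le *; have E : (7 - e = lm.2.-1 + (7 - (lm.2.-1 + e)))%N by lia.
have [c' c'0 H] := iter_dop z lm.2.-1 (7 - (lm.2.-1 + e))
  (\prod_(lm <- s) lf lm.1 ^+ lm.2.-1) lm.1.
exists (c * c'); first by rewrite mulf_neq0.
by rewrite big_cons -scalerA -H E iter_dopZ.
Qed.

(** Differential operators disappear here: the differentiated form vanishes exactly when all its
    coefficients do, and these are the equations of [kills]. *)
Lemma dual_CRL_kills lam z : (sumn [seq m.-1 | m <- lam] <= 7)%N ->
  dual_CRL lam z <-> exists ls : seq (CC * CC),
    [/\ size ls = size lam, {in ls, forall l, l != (0, 0)} &
     kills (sumn [seq m.-1 | m <- lam]) z (\prod_(lm <- zip ls lam) lf lm.1 ^+ lm.2.-1)].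
Proof.
move=> le; have E ls : size ls = size lam ->
    sumn [seq lm.2.-1 | lm <- zip ls lam] = sumn [seq m.-1 | m <- lam].
  move=> sz; congr sumn; rewrite -[in RHS](@unzip2_zip _ _ ls lam) ?sz // /unzip2.
  by rewrite -map_comp.
split=> [[ls [sz [nz H]]]|[ls [sz nz H]]]; exists ls; split=> //.
  have [|c c0 H'] := @apply_opsE z (zip ls lam); first by rewrite E.
  apply: kills_monomials => k lt; move: H; rewrite /apply_ops H' => /eqP.
  rewrite scaler_eq0 (negbTE c0) /= => /eqP /bf_eq0; apply; rewrite E //; lia.
split=> //; rewrite /apply_ops.
have [|c c0 ->] := @apply_opsE z (zip ls lam); first by rewrite E.
rewrite (_ : bf _ _ = 0) ?scaler0 //; apply/bf_eq0 => k; rewrite E // => lt.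
apply: kills_Xn H _; lia.
Qed.

Lemma dual7P z : dual_CRL [:: 7]%N z <->
  exists2 l : CC * CC, l != (0, 0) & kills 6 z (lf l ^+ 6).
Proof.
rewrite dual_CRL_kills //; split=> [[ls [sz nz]]|[l nz K]].
  case: ls sz nz => [|l []] // _ nz.
  by rewrite /= big_seq1 => K; exists l; rewrite // nz ?inE.
by exists [:: l]; split; rewrite //= ?big_seq1 // => ?; rewrite inE => /eqP ->.
Qed.

Lemma dual2P z p q : (p + q <= 7)%N -> dual_CRL [:: p.+1; q.+1]%N z <->
  exists l m : CC * CC, [/\ l != (0, 0), m != (0, 0) &
    kills (p + q) z (lf l ^+ p * lf m ^+ q)].
Proof.
move=> le; rewrite dual_CRL_kills /= addn0 //.
split=> [[ls [sz nz]]|[l [m [nl nm K]]]].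
  case: ls sz nz => [|l [|m []]] // _ nz.
  rewrite /= big_cons big_seq1 => K; exists l, m.
  by split; rewrite // nz ?inE ?eqxx ?orbT.
exists [:: l; m]; split; rewrite //= ?big_cons ?big_nil ?mulr1 // => ?.
by rewrite !inE => /orP[] /eqP ->.
Qed.

Lemma dual322P z : dual_CRL [:: 3; 2; 2]%N z <->
  exists l m n : CC * CC, [/\ l != (0, 0), m != (0, 0), n != (0, 0) &
    kills 4 z (lf l ^+ 2 * (lf m * lf n))].
Proof.
rewrite dual_CRL_kills //.
split=> [[ls [sz nz]]|[l [m [n [nl nm nn K]]]]].
  case: ls sz nz => [|l [|m [|n []]]] // _ nz.
  rewrite /= !big_cons big_nil mulr1 !expr1 => K; exists l, m, n.
  by split; rewrite // nz ?inE ?eqxx ?orbT.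
exists [:: l; m; n]; split; rewrite //= ?big_cons ?big_nil ?mulr1 ?expr1 // => ?.
by rewrite !inE => /or3P[] /eqP ->.
Qed.

End CoincidentRoots.

(** * Linear changes of variables and real rank *)

Section Action.
Variable F : fieldType.
Implicit Types (a : 'I_8 -> F) (g h y : {poly F}) (m n l : F * F).

(** [g] is read as a form of degree [e] whose two variables are replaced by [lf m1] and [lf m2];
    hence the complementary exponent [e - i]. *)
Definition subst e m1 m2 g : {poly F} :=
  \sum_(i < e.+1) g`_i *: (lf m1 ^+ (e - i) * lf m2 ^+ i).

(** The transpose of [subst 7], by [Lf_act]: functionals move by [act] while their killing forms
    move by [subst]. *)
Definition act m1 m2 a : 'I_8 -> F :=
  fun k => Lf a (lf m1 ^+ (7 - k) * lf m2 ^+ k).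

Definition tr m1 m2 l : F * F :=
  (l.1 * m1.1 + l.2 * m2.1, l.1 * m1.2 + l.2 * m2.2).

Lemma Lf_act m1 m2 a h : Lf (act m1 m2 a) h = Lf a (subst 7 m1 m2 h).
Proof. by rewrite /subst Lf_sum; apply: eq_bigr => i _; rewrite LfZ. Qed.

Lemma substD e m1 m2 g h : subst e m1 m2 (g + h) = subst e m1 m2 g + subst e m1 m2 h.
Proof. by rewrite -big_split; apply: eq_bigr => i _; rewrite coefD scalerDl. Qed.

Lemma substZ e m1 m2 c g : subst e m1 m2 (c *: g) = c *: subst e m1 m2 g.
Proof. by rewrite scaler_sumr; apply: eq_bigr => i _; rewrite coefZ scalerA. Qed.

Lemma subst0 e m1 m2 : subst e m1 m2 0 = 0.
Proof. by apply: big1 => i _; rewrite coef0 scale0r. Qed.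

Lemma subst_sum e m1 m2 I (r : seq I) P (G : I -> {poly F}) :
  subst e m1 m2 (\sum_(i <- r | P i) G i) = \sum_(i <- r | P i) subst e m1 m2 (G i).
Proof. exact: (big_morph _ (substD e m1 m2) (subst0 e m1 m2)). Qed.

Lemma substXn e m1 m2 i : (i <= e)%N ->
  subst e m1 m2 'X^i = lf m1 ^+ (e - i) * lf m2 ^+ i.
Proof.
rewrite -ltnS => lt; rewrite /subst (bigD1 (Ordinal lt)) //= coefXn eqxx scale1r.
rewrite big1 ?addr0 // => j; rewrite -val_eqE /= => /negbTE ne.
by rewrite coefXn ne scale0r.
Qed.

Lemma substM e e' m1 m2 g h : (size g <= e.+1)%N -> (size h <= e'.+1)%N ->
  subst (e + e') m1 m2 (g * h) = subst e m1 m2 g * subst e' m1 m2 h.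
Proof.
move=> /poly_sumX sg /poly_sumX sh; rewrite {1}sg {1}sh mulr_suml subst_sum.
rewrite [subst e m1 m2 g]/subst [subst e' m1 m2 h]/subst mulr_suml; apply: eq_bigr => i _.
rewrite -[in LHS]scalerAl substZ -[in RHS]scalerAl; congr (_ *: _).
rewrite !mulr_sumr subst_sum; apply: eq_bigr => j _.
rewrite -[in LHS]scalerAr substZ -[in RHS]scalerAr -exprD; congr (_ *: _).
have := ltn_ord i; have := ltn_ord j; rewrite !ltnS => lj li.
rewrite substXn ?leq_add // mulrACA -!exprD; congr (_ ^+ _ * _); lia.
Qed.

Lemma size_subst e m1 m2 g : (size (subst e m1 m2 g) <= e.+1)%N.
Proof.
apply: (big_ind (fun p : {poly F} => (size p <= e.+1)%N)) => [|p q sp sq|i _].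
- by rewrite size_poly0.
- by rewrite (leq_trans (size_polyD _ _)) // geq_max sp.
rewrite (leq_trans (size_scale_leq _ _)) //.
have -> : lf m1 ^+ (e - i) * lf m2 ^+ i = prodf (nseq (e - i) m1 ++ nseq i m2).
  by rewrite prodf_cat !prodf_nseq.
by rewrite (leq_trans (size_prodf _)) // size_cat !size_nseq subnK // -ltnS.
Qed.

Lemma subst_lf m1 m2 l : subst 1 m1 m2 (lf l) = lf (tr m1 m2 l).
Proof.
rewrite /subst !big_ord_recl big_ord0 addr0 /= !expr1 !expr0 mulr1 mul1r.
by apply/polyP => -[|[|i]]; rewrite coefD !coefZ !coef_lf //= !mulr0 addr0.
Qed.

Lemma subst_prodf m1 m2 s :
  subst (size s) m1 m2 (prodf s) = prodf (map (tr m1 m2) s).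
Proof.
elim: s => [|l s IH] /=.
  by rewrite prodf_nil /subst big_ord_recl big_ord0 coefC /= scale1r !expr0 mulr1 addr0.
rewrite !prodf_cons -add1n substM ?size_lf ?size_prodf //.
by rewrite subst_lf IH.
Qed.

Lemma subst_subst e m1 m2 n1 n2 g :
  subst e n1 n2 (subst e m1 m2 g) = subst e (tr n1 n2 m1) (tr n1 n2 m2) g.
Proof.
rewrite {2}/subst subst_sum; apply: eq_bigr => i _; rewrite substZ; congr (_ *: _).
have := subst_prodf n1 n2 (nseq (e - i) m1 ++ nseq i m2).
rewrite size_cat !size_nseq subnK; last by rewrite -ltnS.
by rewrite map_cat !map_nseq !prodf_cat !prodf_nseq.
Qed.

Lemma subst_id e g : (size g <= e.+1)%N -> subst e (1, 0) (0, 1) g = g.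
Proof.
move=> /poly_sumX {2}->; apply: eq_bigr => i _; congr (_ *: _).
by rewrite /lf /= scale0r scale1r addr0 add0r expr1n mul1r.
Qed.

Lemma act_act m1 m2 n1 n2 a :
  act m1 m2 (act n1 n2 a) =1 act (tr n1 n2 m1) (tr n1 n2 m2) a.
Proof.
move=> k; rewrite /act Lf_act; congr (Lf a _).
have := subst_prodf n1 n2 (nseq (7 - k) m1 ++ nseq k m2).
rewrite size_cat !size_nseq subnK; last by rewrite -ltnS.
by rewrite map_cat !map_nseq !prodf_cat !prodf_nseq.
Qed.

Lemma act_id a : act (1, 0) (0, 1) a =1 a.
Proof.
move=> k; rewrite /act /lf /= scale0r scale1r addr0 add0r expr1n mul1r.
exact: Lf_Xn.
Qed.

Definition det2 m n : F := m.1 * n.2 - m.2 * n.1.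

Lemma tr_inv m1 m2 : det2 m1 m2 != 0 -> exists n1 n2,
  [/\ det2 n1 n2 != 0, tr m1 m2 n1 = (1, 0), tr m1 m2 n2 = (0, 1),
      tr n1 n2 m1 = (1, 0) & tr n1 n2 m2 = (0, 1)].
Proof.
case: m1 m2 => a b [c d]; rewrite /det2 /tr /= => D.
exists (d / (a * d - b * c), - b / (a * d - b * c)).
exists (- c / (a * d - b * c), a / (a * d - b * c)); split=> /=;
  try (congr pair; by field).
have -> : d / (a * d - b * c) * (a / (a * d - b * c)) -
   - b / (a * d - b * c) * (- c / (a * d - b * c)) = (a * d - b * c)^-1 by field.
by rewrite invr_eq0.
Qed.

Lemma act_inv m1 m2 : det2 m1 m2 != 0 -> exists n1 n2,
  [/\ det2 n1 n2 != 0, forall a, act m1 m2 (act n1 n2 a) =1 a &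
      forall a, act n1 n2 (act m1 m2 a) =1 a].
Proof.
move=> /tr_inv[n1 [n2 [D e1 e2 e3 e4]]]; exists n1, n2; split=> // a k.
  by rewrite act_act e3 e4 act_id.
by rewrite act_act e1 e2 act_id.
Qed.

Lemma kills_act e m1 m2 a g : (e <= 7)%N -> (size g <= e.+1)%N ->
  kills e a (subst e m1 m2 g) -> kills e (act m1 m2 a) g.
Proof.
move=> le sg K y sy; rewrite Lf_act -[X in subst X](subnKC le).
rewrite substM //; last by apply: leq_trans sy _; lia.
by apply: K; apply: leq_trans (size_subst _ _ _ _) _; lia.
Qed.

Lemma kills_act_prodf m1 m2 a s : (size s <= 7)%N ->
  kills (size s) a (prodf (map (tr m1 m2) s)) ->
  kills (size s) (act m1 m2 a) (prodf s).
Proof. by move=> le K; apply: kills_act; rewrite ?size_prodf ?subst_prodf. Qed.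

Lemma tr_eq0 m1 m2 l : det2 m1 m2 != 0 -> (tr m1 m2 l == (0, 0)) = (l == (0, 0)).
Proof.
move=> /tr_inv[n1 [n2 [_ e1 e2 e3 e4]]]; apply/eqP/eqP => [E|->]; last first.
  by rewrite /tr /= !mul0r !addr0.
have : tr n1 n2 (tr m1 m2 l) = (0, 0) by rewrite E /tr /= !mul0r !addr0.
have -> : tr n1 n2 (tr m1 m2 l) = tr (tr n1 n2 m1) (tr n1 n2 m2) l.
  by rewrite /tr /=; congr pair; ring.
by rewrite e3 e4 /tr /= !mulr1 !mulr0 addr0 add0r; case: l {E}.
Qed.

End Action.

(** * Real rank and killing products of linear forms *)

Section Rank.
Implicit Types (a : 'I_8 -> RR).

Lemma rank_leP a r : rank_le a r <-> exists c p q : 'I_r -> RR,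
  forall k : 'I_8, a k = \sum_(j < r) c j * (p j ^+ (7 - k) * q j ^+ k).
Proof.
pose S (c p q : 'I_r -> RR) k := \sum_(j < r) c j * (p j ^+ (7 - k) * q j ^+ k).
have E c p q : \sum_(j < r) c j *: (p j *: 'X_0 + q j *: 'X_1 : {mpoly RR[2]}) ^+ 7 =
    bf 7 (S c p q).
  rewrite /bf /S (eq_bigr _ (fun j _ => congr1 _ (exprDn _ _ _))).
  under eq_bigr do rewrite scaler_sumr.
  rewrite exchange_big; apply: eq_bigr => i _ /=.
  rewrite mulr_sumr scaler_suml; apply: eq_bigr => j _.
  rewrite !exprZn -scalerAl -scalerAr scalerA -scaler_nat !scalerA; congr (_ *: _).
  by ring.
have B : bform a = bf 7 (fun k => a (inord k)).
  by apply: eq_bigr => i _; rewrite inord_val.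
split=> -[c [p [q H]]]; exists c, p, q.
  move=> k; have := bf_inj (etrans (esym B) (etrans H (E c p q))).
  by move=> /(_ k); rewrite inord_val; apply; rewrite -ltnS.
rewrite E B; apply: eq_bf => k k7; rewrite H inordK //; exact: leq_ltn_trans k7 _.
Qed.

Lemma rank_le_ext a b r : a =1 b -> rank_le a r -> rank_le b r.
Proof.
move=> e /rank_leP[c [p [q H]]]; apply/rank_leP; exists c, p, q => k.
by rewrite -e.
Qed.

Lemma rank_le_mono a r s : (r <= s)%N -> rank_le a r -> rank_le a s.
Proof.
move=> le /rank_leP[c [p [q H]]]; apply/rank_leP; rewrite -(subnKC le).
exists (fun j => if split j is inl i then c i else 0).
exists (fun j => if split j is inl i then p i else 0).
exists (fun j => if split j is inl i then q i else 0) => k.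
rewrite big_split_ord /= [X in _ + X]big1 ?addr0 => [|j _].
  rewrite H; apply: eq_bigr => j _.
  by rewrite (unsplitK (inl j : 'I_r + 'I_(s - r))).
by rewrite (unsplitK (inr j : 'I_r + 'I_(s - r))) mul0r.
Qed.

(* [subst 7 (p, 0) (q, 0) h] is the value at [(p, q)] of the form [h] of degree [7]. *)
Lemma Lf_rank a r (c p q : 'I_r -> RR) h :
  (forall k : 'I_8, a k = \sum_(j < r) c j * (p j ^+ (7 - k) * q j ^+ k)) ->
  (Lf a h)%:P = \sum_(j < r) c j *: subst 7 (p j, 0) (q j, 0) h.
Proof.
move=> H; rewrite /Lf raddf_sum /=.
under [RHS]eq_bigr do rewrite /subst scaler_sumr.
rewrite [RHS]exchange_big; apply: eq_bigr => i _ /=.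
rewrite H mulr_sumr raddf_sum; apply: eq_bigr => j _ /=.
rewrite /lf /= !scale0r !addr0 !polyCM !polyC_exp -!mul_polyC; ring.
Qed.

Lemma rank_act m1 m2 a r : rank_le a r -> rank_le (act m1 m2 a) r.
Proof.
move=> /rank_leP[c [p [q H]]]; apply/rank_leP.
exists c, (fun j => m1.1 * p j + m1.2 * q j), (fun j => m2.1 * p j + m2.2 * q j) => k.
apply: (@polyC_inj RR); rewrite /act (Lf_rank _ H) raddf_sum; apply: eq_bigr => j _ /=.
have := subst_prodf (p j, 0) (q j, 0) (nseq (7 - k) m1 ++ nseq k m2).
rewrite size_cat !size_nseq subnK; last by rewrite -ltnS.
rewrite map_cat !map_nseq !prodf_cat !prodf_nseq => ->.
by rewrite /lf /tr /= !mulr0 !addr0 !scale0r !addr0 polyCM polyCM !polyC_exp mul_polyC.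
Qed.

Definition RR_forms r a := exists s : seq (RR * RR),
  [/\ size s = r, {in s, forall l, l != (0, 0)} & kills r a (prodf s)].

Lemma rank_le_forms a r : (r <= 7)%N -> rank_le a r -> RR_forms r a.
Proof.
move=> r7 /rank_leP[c [p [q H]]].
(* The linear form vanishing at the point [(p j, q j)]. At the zero vector any form vanishes, and
   [(1, 0)] is taken. *)
pose l j : RR * RR := if (q j, - p j) == (0, 0) then (1, 0) else (q j, - p j).
exists [seq l j | j <- enum 'I_r]; split; first by rewrite size_map size_enum_ord.
  move=> _ /mapP[j _ ->]; rewrite /l; case: ifP => [_|->//].
  by rewrite xpair_eqE oner_eq0.
move=> y sy; apply: (@polyC_inj RR); rewrite (Lf_rank _ H) big1 // => j _.
set s := [seq _ | _ <- _].
have sz : size s = r by rewrite size_map size_enum_ord.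
have -> : 7%N = (size s + (7 - r))%N by rewrite sz subnKC.
rewrite substM ?size_prodf //; last by rewrite (leq_trans sy) // -subSn.
rewrite subst_prodf; suff -> : prodf (map (tr (p j, 0) (q j, 0)) s) = 0.
  by rewrite mul0r scaler0.
apply/eqP; rewrite /prodf big_map prodf_seq_eq0; apply/hasP; exists (l j).
  by apply/mapP; exists j; rewrite ?mem_enum.
rewrite /lf /tr /= !mulr0 addr0 scale0r addr0 polyC_eq0 /l.
case: ifP => [|_] /=.
  by rewrite xpair_eqE oppr_eq0 => /andP[/eqP -> /eqP ->]; rewrite !mulr0 addr0.
by rewrite mulNr mulrC subrr.
Qed.

End Rank.

(** * Splitting multiple zeros *)

Section DualFamily.
Variable F : fieldType.

(** Independence makes the matrix of values on monomials row-free; the columns of a right inverse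
    are the coefficients of the dual polynomials. This solves the equations of [kills] within a
    prescribed space of corrections. *)
Lemma dual_family c N (phi : 'I_c -> {poly F} -> F) :
  (forall k p q, phi k (p + q) = phi k p + phi k q) ->
  (forall k s p, phi k (s *: p) = s * phi k p) ->
  (forall u : 'I_c -> F, (forall i, (i < N)%N -> \sum_k u k * phi k 'X^i = 0) ->
     forall k, u k = 0) ->
  exists w : 'I_c -> {poly F}, (forall k, (size (w k) <= N)%N) /\
    forall j k, phi j (w k) = (j == k)%:R.
Proof.
move=> phiD phiZ indep.
have phi_sum k (f : 'I_N -> {poly F}) : phi k (\sum_i f i) = \sum_i phi k (f i).
  apply: (big_morph (phi k) (phiD k)).
  by rewrite -(scale0r 0) phiZ mul0r.
pose A := \matrix_(k < c, i < N) phi k 'X^i.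
have : row_free A.
  rewrite -kermx_eq0; apply/rowV0P => u /sub_kermxP uA.
  apply/rowP => k; rewrite mxE; apply: (indep (fun k => u 0 k)) => i lt.
  have := congr1 (fun M : 'rV_N => M 0 (Ordinal lt)) uA; rewrite !mxE => E.
  by rewrite -[RHS]E; apply: eq_bigr => j _; rewrite mxE.
move=> /row_freeP[B AB]; exists (fun k => \sum_(i < N) B i k *: 'X^i); split=> [k|j k].
  apply/leq_sizeP => j le; rewrite coef_sum big1 // => i _.
  by rewrite coefZ coefXn gtn_eqF ?mulr0 // (leq_trans (ltn_ord i)).
rewrite phi_sum; have := congr1 (fun M : 'M_c => M j k) AB; rewrite !mxE => <-.
by apply: eq_bigr => i _; rewrite phiZ mxE mulrC.
Qed.

End DualFamily.

Definition rootsp (R : nzRingType) (t : seq R) : {poly R} := \prod_(x <- t) ('X - x%:P).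

Lemma size_rootsp (R : idomainType) (t : seq R) : size (rootsp t) = (size t).+1.
Proof. by rewrite size_prod_XsubC. Qed.

Lemma rootsp_eq0 (R : idomainType) (t : seq R) x : ((rootsp t).[x] == 0) = (x \in t).
Proof.
rewrite /rootsp horner_prod prodf_seq_eq0; apply/hasP/idP => [[y yt]|xt].
  by rewrite hornerXsubC subr_eq0 => /eqP ->.
by exists x => //=; rewrite hornerXsubC subrr eqxx.
Qed.

(** * Interpolation at the zeros and sign changes *)

Section Interpolation.

Lemma lagrange (F : fieldType) (t : seq F) : uniq t ->
  exists la : F -> {poly F}, forall p : {poly F}, (size p <= size t)%N ->
    p = \sum_(x <- t) p.[x] *: la x.
Proof.
move=> ut; pose l x : {poly F} := rootsp (rem x t).
exists (fun x => (l x).[x]^-1 *: l x) => p sp; apply/eqP; rewrite -subr_eq0; apply/eqP.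
apply: (@roots_geq_poly_eq0 _ _ t) => //.
  apply/allP => y yt; rewrite /root hornerD hornerN horner_sum subr_eq0.
  rewrite (perm_big _ (perm_to_rem yt)) big_cons !hornerZ mulVf; last first.
    by rewrite rootsp_eq0 mem_rem_uniq // inE eqxx.
  rewrite mulr1 big_seq big1 /= ?addr0 // => x; rewrite mem_rem_uniq // inE => /andP[ne xt].
  rewrite !hornerZ [_.[y]](_ : _ = 0) ?mulr0 //; apply/eqP.
  by rewrite rootsp_eq0 mem_rem_uniq // inE eq_sym ne.
rewrite (leq_trans (size_polyD _ _)) // geq_max sp size_polyN.
rewrite big_seq; apply: (big_ind (fun q : {poly F} => (size q <= size t)%N)).
- by rewrite size_poly0.
- by move=> q q' sq sq'; rewrite (leq_trans (size_polyD _ _)) // geq_max sq.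
move=> x xt; rewrite !(leq_trans (size_scale_leq _ _)) // size_rootsp.
by rewrite size_rem // prednK // lt0n size_eq0; case: t xt {ut sp l}.
Qed.

(** The remainder of [X^k] modulo [rootsp t] is interpolated at the zeros, and the functional
    vanishes on the multiple of [rootsp t]; this writes [a k] as a combination of the [k]-th powers
    of the zeros. *)
Lemma rank_le_rootsp (a : 'I_8 -> RR) (t : seq RR) : uniq t -> (size t <= 8)%N ->
  kills (size t) a (rootsp t) -> rank_le a (size t).
Proof.
move=> ut s8 K; have [la laP] := lagrange ut; set g := rootsp t in K.
have gm : g \is monic by apply: monic_prod_XsubC.
apply/rank_leP; exists (fun j => Lf a (la t`_j)), (fun=> 1), (fun j => t`_j) => k.
rewrite -[LHS](Lf_Xn a) (Pdiv.IdomainMonic.divp_eq gm 'X^k) LfD mulrC K ?add0r.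
  rewrite {1}[_ %% _](laP _ _); last first.
    by rewrite -ltnS -(size_rootsp t) ltn_modp monic_neq0.
  rewrite Lf_sum (big_nth 0) big_mkord; apply: eq_bigr => j _.
  rewrite LfZ mulrC expr1n mul1r; congr (_ * _).
  have gx : g.[t`_j] = 0 by apply/eqP; rewrite rootsp_eq0 mem_nth.
  have := congr1 (fun p => p.[t`_j]) (Pdiv.IdomainMonic.divp_eq gm 'X^k).
  by rewrite hornerD hornerM gx mulr0 add0r hornerXn => ->.
have gu : lead_coef g \is a GRing.unit by rewrite (monicP gm) unitr1.
rewrite size_divp ?monic_neq0 // size_polyXn size_rootsp /=.
by have := ltn_ord k; lia.
Qed.

(** The intervals of radius [d] around the points of [t] are disjoint, each sign change yields its
    own zero, and the degree bound leaves room for no others. *)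
Lemma sign_changes_split (R : rcfType) (v : {poly R}) (t : seq R) (d : R) : 0 < d ->
  (size v <= (size t).+1)%N -> uniq t -> v != 0 ->
  {in t &, forall x y : R, x != y -> d + d <= `|x - y|} ->
  {in t, forall x : R, v.[x - d] * v.[x + d] < 0} ->
  exists t' : seq R,
    [/\ uniq t', size t' = size t & exists2 c, c != 0 & v = c *: rootsp t'].
Proof.
move=> d0 sv ut v0 gap sgn.
have le (x : R) : x - d <= x + d by lra.
have sep (x y w : R) : x - d < w -> w < x + d -> y - d < w -> w < y + d ->
    d + d <= `|x - y| -> False.
  by move=> h1 h2 h3 h4; case: (lerP x y) => h g; lra.
pose z (x : R) : R := if @idP (v.[x - d] * v.[x + d] < 0) is ReflectT h then
  s2val (poly_ivtoo (le x) h) else x.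
have zP (x : R) : x \in t -> x - d < z x < x + d /\ root v (z x).
  move=> /sgn h; rewrite /z; case: {-}_ / idP => // h'.
  by case: (poly_ivtoo _ _) => y /=; rewrite in_itv.
have uz : uniq (map z t).
  rewrite map_inj_in_uniq // => x y xt yt E; apply/eqP/negPn/negP => ne.
  have g := gap _ _ xt yt ne; have [/andP[h1 h2] _] := zP _ xt.
  have [/andP[h3 h4] _] := zP _ yt; rewrite -E in h3 h4.
  exact: sep h1 h2 h3 h4 g.
exists (map z t); rewrite size_map; split=> //; exists (lead_coef v).
  by rewrite lead_coef_eq0.
have ra : all (root v) (map z t).
  by apply/allP => _ /mapP[x xt ->]; case: (zP _ xt).
apply: all_roots_prod_XsubC; rewrite ?uniq_rootsE // size_map.
apply/eqP; rewrite eqn_leq sv /=; have := max_poly_roots v0 ra uz.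
by rewrite size_map.
Qed.

End Interpolation.

(** * Spreading multiple zeros over a small parameter *)

Section Splitting.
Variable R : fieldType.
Implicit Types (a : 'I_8 -> R) (P Q : {poly {poly R}}).

(* Families of polynomials depending polynomially on a parameter [eps]: the
   coefficient ring [{poly R}] is the ring of polynomials in [eps]. *)
Definition lift_eps (p : {poly R}) : {poly {poly R}} := map_poly polyC p.
Definition at_eps (e : R) P : {poly R} := map_poly (horner_eval e) P.
Definition LfP a P : {poly R} := \sum_(i < 8) P`_i * (a i)%:P.

Lemma at_eps_up e (p : {poly R}) : at_eps e (lift_eps p) = p.
Proof. by apply/polyP => i; rewrite !coef_map /= /horner_eval hornerC. Qed.

Lemma LfPE a P e : (LfP a P).[e] = Lf a (at_eps e P).
Proof.
rewrite /LfP horner_sum; apply: eq_bigr => i _.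
by rewrite hornerM hornerC coef_map.
Qed.

Lemma LfPD a P Q : LfP a (P + Q) = LfP a P + LfP a Q.
Proof. by rewrite -big_split; apply: eq_bigr => i _; rewrite coefD mulrDl. Qed.

Lemma LfPZ a c P : LfP a (c%:P * P) = c * LfP a P.
Proof. by rewrite mulr_sumr; apply: eq_bigr => i _; rewrite coefCM mulrA. Qed.

Lemma LfP_up a (p : {poly R}) : LfP a (lift_eps p) = (Lf a p)%:P.
Proof.
by rewrite raddf_sum; apply: eq_bigr => i _ /=; rewrite coef_map polyCM.
Qed.

(** The offsets [1 - m, 3 - m, ..., m - 1]. Their sum is zero, so that moving an [m]-fold zero along
    them changes the product only at order [eps^2]. *)
Definition spread (m i : nat) : R := (i.*2.+1)%:R - m%:R.

Lemma sum_spread m : \sum_(i < m) spread m i = 0.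
Proof.
have H n : \sum_(i < m) (i.*2.+1)%:R - \sum_(i < m) n%:R = (m * m)%:R - (m * n)%:R :> R.
  rewrite sumr_const card_ord -mulrnA mulnC; congr (_ - _).
  elim: m => [|m IH]; first by rewrite big_ord0.
  by rewrite big_ord_recr /= IH -natrD; congr (_%:R); lia.
by rewrite /spread sumrB H subrr.
Qed.

Lemma prod_mod_eps2 (x : R) (c : nat -> R) m : exists H,
  \prod_(i < m) ('X - (x%:P + c i *: 'X)%:P) =
  lift_eps (('X - x%:P) ^+ m) - ((\sum_(i < m) c i) *: 'X)%:P * lift_eps (('X - x%:P) ^+ m.-1) +
  ('X^2)%:P * H.
Proof.
elim: m => [|m [H IH]].
  exists 0; rewrite !big_ord0 scale0r mul0r subr0 mulr0 addr0 expr0.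
  by rewrite /lift_eps rmorph1.
set T := lift_eps ('X - x%:P).
have upX k : lift_eps (('X - x%:P) ^+ k) = T ^+ k by rewrite /T /lift_eps rmorphXn.
have fac : 'X - (x%:P + c m *: 'X)%:P = T - (c m *: 'X)%:P.
  rewrite /T /lift_eps rmorphB /= map_polyX map_polyC /=.
  by rewrite polyCD opprD addrA.
rewrite !big_ord_recr /= IH fac !upX; set s := \sum_(i < m) c i.
exists (T * H - (c m *: 'X)%:P * H + ((c m * s)%:P)%:P * T ^+ m.-1).
(* For [m = 0] the predecessor is truncated, but then the empty sum [s] makes both sides vanish. *)
have E : (s *: 'X)%:P * T ^+ m.-1 * T = (s *: 'X)%:P * T ^+ m.
  case: m @s {IH fac} => [|m] s; last by rewrite -mulrA -exprSr.
  by rewrite /s big_ord0 scale0r !mul0r.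
have e2 : (c m *: 'X)%:P * (s *: 'X)%:P = ('X^2)%:P * ((c m * s)%:P)%:P.
  by rewrite -!polyCM; congr (_%:P); rewrite -!mul_polyC polyCM; ring.
rewrite scalerDl polyCD [T ^+ _.+1]exprSr.
transitivity (T ^+ m * T - (s *: 'X)%:P * T ^+ m.-1 * T - (c m *: 'X)%:P * T ^+ m +
   ((c m *: 'X)%:P * (s *: 'X)%:P) * T ^+ m.-1 + ('X^2)%:P * (T * H - (c m *: 'X)%:P * H)).
  ring.
rewrite E e2 /=; ring.
Qed.

(** [id] gives the form itself. [predn] lowers each multiplicity by one: its multiples are the
    corrections used in [split_multiple]. *)
Definition powD (D : seq (R * nat)) (f : nat -> nat) : {poly R} :=
  \prod_(p <- D) ('X - p.1%:P) ^+ f p.2.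

Definition spreadD (D : seq (R * nat)) : {poly {poly R}} :=
  \prod_(p <- D) \prod_(i < p.2) ('X - (p.1%:P + spread p.2 i *: 'X)%:P).

Lemma spreadD_mod D : exists H, spreadD D = lift_eps (powD D id) + ('X^2)%:P * H.
Proof.
elim: D => [|[x m] D [H IH]].
  by exists 0; rewrite /spreadD /powD !big_nil mulr0 addr0 /lift_eps rmorph1.
rewrite /spreadD /powD !big_cons -/(spreadD D) -/(powD D id) IH /=.
have [K ->] := prod_mod_eps2 x (spread m) m.
rewrite sum_spread scale0r mul0r subr0 /lift_eps rmorphM /= -/(lift_eps _) -/(lift_eps _).
exists (lift_eps (('X - x%:P) ^+ m) * H + K * lift_eps (powD D id) + K * (('X^2)%:P * H)); ring.
Qed.

Lemma size_spreadD D e :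
  (size (at_eps e (spreadD D)) <= (sumn [seq p.2 | p <- D]).+1)%N.
Proof.
have E : at_eps e (spreadD D) = \prod_(p <- D) \prod_(i < p.2)
    ('X - (p.1 + spread p.2 i * e)%:P).
  rewrite /at_eps rmorph_prod; apply: eq_bigr => p _ /=.
  rewrite rmorph_prod; apply: eq_bigr => i _ /=.
  rewrite rmorphB /= map_polyX map_polyC /= /horner_eval.
  by rewrite hornerD hornerC hornerZ hornerX.
rewrite E; elim: D {E} => [|p D IH]; first by rewrite big_nil size_poly1.
rewrite big_cons; have sp : (size (\prod_(i < p.2) ('X - (p.1 + spread p.2 i * e)%:P))%R <= p.2.+1)%N.
  by rewrite size_prod_XsubC /= /index_enum -enumT size_enum_ord.
by apply: leq_trans (size_mul_leq3 sp IH) _; rewrite addnS /= addSn.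
Qed.

Lemma size_powD D f : size (powD D f) = (sumn [seq f p.2 | p <- D]).+1.
Proof.
rewrite /powD; elim: D => [|p D IH]; first by rewrite big_nil size_poly1.
rewrite big_cons size_mul -?size_poly_gt0 ?IH ?size_exp_XsubC //.
by rewrite addnS addSn.
Qed.

End Splitting.

Section Eventually.
Variable R : rcfType.

Definition near0 (P : R -> Prop) := exists2 d : R, 0 < d & forall e, 0 < e < d -> P e.

Lemma near0_and (P Q : R -> Prop) : near0 P -> near0 Q -> near0 (fun e => P e /\ Q e).
Proof.
move=> [d d0 HP] [d' d'0 HQ]; exists (Num.min d d'); first by rewrite lt_min d0.
by move=> e /andP[e0]; rewrite lt_min => /andP[l l']; split; [apply: HP|apply: HQ];
   rewrite e0.
Qed.

Lemma near0_imp (P Q : R -> Prop) : (forall e, 0 < e -> P e -> Q e) -> near0 P -> near0 Q.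
Proof.
by move=> H [d d0 HP]; exists d => // e /andP[e0 ed]; apply: H => //; apply: HP; rewrite e0.
Qed.

Lemma near0_all (T : eqType) (s : seq T) (P : T -> R -> Prop) :
  {in s, forall x, near0 (P x)} -> near0 (fun e => {in s, forall x, P x e}).
Proof.
elim: s => [|x s IH] H; first by exists 1; rewrite ?ltr01.
have := near0_and (H x (mem_head _ _)) (IH (fun y ys => H y (mem_behead (s := x :: s) ys))).
apply: near0_imp => e _ [h1 h2] y; rewrite inE => /orP[/eqP ->|] //; exact: h2.
Qed.

Lemma near0_ex (P : R -> Prop) : near0 P -> exists2 e, 0 < e & P e.
Proof. by move=> [d d0 H]; exists (d / 2); [|apply: H]; lra. Qed.

Lemma near0_poly (p : {poly R}) : 0 < p.[0] -> near0 (fun e => 0 < p.[e]).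
Proof.
move=> p0; have [d d0 H] := poly_cont 0 p p0.
exists d => // e /andP[e0 ed].
have : `|p.[e] - p.[0]| < p.[0] by apply: H; rewrite subr0 gtr0_norm.
by rewrite ltr_distl => /andP[+ _]; rewrite subrr.
Qed.

End Eventually.

Section SplitMultiple.
Variable R : rcfType.
Implicit Types (a : 'I_8 -> R) (D : seq (R * nat)).

Lemma spread_gap m (i j : nat) : i != j -> 1 <= `|spread R m i - spread R m j|.
Proof.
move=> ne; rewrite /spread opprB addrA subrK.
wlog le : i j ne / (j < i)%N.
  move=> H; case: (ltngtP i j) => h; last by rewrite h eqxx in ne.
    by rewrite distrC H // eq_sym.
  exact: H.
have -> : i.*2.+1 = ((i - j).*2 + j.*2.+1)%N by lia.
by rewrite natrD addrK ger0_norm ?ler0n // ler1n; lia.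
Qed.

Lemma spread_bound m i : (i < m)%N -> `|spread R m i| <= m%:R.
Proof.
move=> lt; rewrite ler_norml /spread; apply/andP; split.
  by rewrite lerBrDr addNr ler0n.
by rewrite lerBlDr -natrD ler_nat; lia.
Qed.

(** The factor of index [i] contributes [-1/4]; every other one is [u^2 - 1/4] with [|u| >= 1] by
    [spread_gap]. *)
Lemma spread_sign m i : (i < m)%N ->
  (\prod_(j < m) (spread R m i - 2^-1 - spread R m j)) *
  (\prod_(j < m) (spread R m i + 2^-1 - spread R m j)) < 0.
Proof.
move=> lt; rewrite -big_split /= (bigD1 (Ordinal lt)) //= pmulr_llt0.
  set u := spread _ _ _; have -> : (u - 2^-1 - u) * (u + 2^-1 - u) = - 4^-1 by field.
  lra.
apply: prodr_gt0 => j; rewrite -val_eqE eq_sym /= => /(spread_gap m).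
set u := spread _ _ _ - _ => h.
have -> : (spread R m i - 2^-1 - spread R m j) * (spread R m i + 2^-1 - spread R m j) =
  u ^+ 2 - 4^-1 by rewrite /u; field.
have : 1 <= `|u| ^+ 2 by rewrite -(expr1n R 2) ler_sqr ?nnegrE.
rewrite real_normK ?num_real //; lra.
Qed.

(** Rescaling around one zero: at [x + tau * eps] the [m] points issued from [x] contribute exactly
    [eps^m], the other points tend to a constant, and lowering the multiplicities costs a single
    power of [eps]. *)
Lemma spreadD_local D x m (tau : R) : uniq (map fst D) -> (x, m) \in D ->
  exists C K : {poly R},
    [/\ (spreadD D).[x%:P + tau *: 'X] =
        'X^m * ((\prod_(j < m) (tau - spread R m j))%:P * C),
        C.[0] = \prod_(p <- rem (x, m) D) (x - p.1) ^+ p.2 &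
        (lift_eps (powD D predn)).[x%:P + tau *: 'X] = 'X^(m.-1) * K].
Proof.
move=> uD xD; set pt := x%:P + tau *: 'X.
exists (\prod_(p <- rem (x, m) D) \prod_(i < p.2) (pt - (p.1%:P + spread R p.2 i *: 'X))).
exists ((tau ^+ m.-1)%:P * (lift_eps (powD (rem (x, m) D) predn)).[pt]); split.
- rewrite /spreadD (perm_big _ (perm_to_rem xD)) big_cons hornerM mulrA; congr (_ * _).
    rewrite horner_prod /= rmorph_prod /= -[m in 'X^m]card_ord -prodr_const -big_split.
    apply: eq_bigr => i _ /=; rewrite hornerXsubC /pt opprD addrACA subrr add0r -scalerBl.
    by rewrite -mul_polyC mulrC.
  rewrite horner_prod; apply: eq_bigr => p _; rewrite horner_prod.
  by apply: eq_bigr => i _; rewrite hornerXsubC.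
- rewrite horner_prod; apply: eq_bigr => p _; rewrite horner_prod.
  rewrite -[p.2 in RHS]card_ord -prodr_const; apply: eq_bigr => i _.
  by rewrite /pt !hornerE /= ?mulr0 ?addr0.
have -> : powD D predn = ('X - x%:P) ^+ m.-1 * powD (rem (x, m) D) predn.
  by rewrite /powD (perm_big _ (perm_to_rem xD)) big_cons.
rewrite /lift_eps rmorphM hornerM /= mulrA; congr (_ * _).
rewrite rmorphXn rmorphB /= map_polyX map_polyC /= horner_exp hornerXsubC /pt addrC addKr.
by rewrite -mul_polyC exprMn polyC_exp mulrC.
Qed.

Lemma split_multiple a D r : uniq (map fst D) -> all (fun p => 0 < p.2)%N D ->
  sumn [seq p.2 | p <- D] = r -> (r <= 7)%N -> kills r a (powD D id) ->
  (forall q : {poly R}, (size q <= 8 - r)%N ->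
     kills (7 - size D) a (powD D predn * q) -> q = 0) ->
  exists t : seq R, [/\ uniq t, size t = r & kills r a (rootsp t)].
Proof.
move=> uD mD sD r7 Kg unob; set n := size D; set G0 := powD D predn.
have nr : (n <= r)%N.
  rewrite -sD /n; elim: D mD {uD sD Kg unob n G0} => //= p D IH /andP[p0 /IH]; lia.
have sG0 : size G0 = (r - n).+1.
  rewrite size_powD; congr _.+1; rewrite -sD /n.
  elim: D mD {uD sD Kg unob n G0 nr} => //= p D IH /andP[p0 mD].
  rewrite IH //; have : (size D <= sumn [seq p.2 | p <- D])%N.
    by elim: D mD {IH} => //= p' D IH /andP[p'0 /IH]; lia.
  lia.
pose phi (k : 'I_(8 - r)) (p : {poly R}) := Lf a (G0 * p * 'X^k).
(* The cofactors [w] have degree at most [n], which brings [G0 * w] back to degree [r]. *)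
have [||u Hu|w [sw dual]] := @dual_family R (8 - r) n.+1 phi.
- by move=> k p q; rewrite /phi mulrDr mulrDl LfD.
- by move=> k c p; rewrite /phi -scalerAr -scalerAl LfZ.
- pose q := \sum_k u k *: 'X^k : {poly R}.
  have cq (k : 'I_(8 - r)) : q`_k = u k.
    rewrite coef_sum (bigD1 k) //= coefZ coefXn eqxx mulr1 big1 ?addr0 // => j.
    by rewrite -val_eqE eq_sym /= => /negbTE ne; rewrite coefZ coefXn ne mulr0.
  have q0 : q = 0.
    apply: unob.
      apply/leq_sizeP => j le; rewrite coef_sum big1 // => i _.
      by rewrite coefZ coefXn gtn_eqF ?mulr0 // (leq_trans (ltn_ord i)).
    apply: kills_monomials => i lt; rewrite -[RHS](Hu i); last by rewrite /n; lia.
    rewrite -mulrA mulr_suml mulr_sumr Lf_sum; apply: eq_bigr => k _.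
    rewrite -scalerAl -scalerAr LfZ /phi; congr (_ * Lf a _).
    by rewrite -mulrA [_ * 'X^k]mulrC.
  by move=> k; rewrite -cq q0 coef0.
have [H EH] := spreadD_mod D.
pose la k := LfP a (H * lift_eps 'X^k).
pose g e := at_eps e (spreadD D).
have Lg e (k : nat) : (k < 8 - r)%N -> Lf a (g e * 'X^k) = e ^+ 2 * (la k).[e].
  move=> lt; rewrite -(at_eps_up e 'X^k) /g /at_eps -rmorphM -/(at_eps _ _) -LfPE EH.
  rewrite mulrDl LfPD /lift_eps -rmorphM -/(lift_eps _) LfP_up (kills_Xn Kg) // add0r.
  by rewrite -mulrA LfPZ hornerM hornerXn.
pose Pv := spreadD D - \sum_(k < 8 - r) ('X^2 * la k)%:P * lift_eps (G0 * w k).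
pose v e := at_eps e Pv.
have vE e : v e = g e - \sum_(k < 8 - r) (e ^+ 2 * (la k).[e]) *: (G0 * w k).
  rewrite /v /Pv /at_eps rmorphB rmorph_sum; congr (_ - _); apply: eq_bigr => k _.
  rewrite rmorphM /= map_polyC -/(at_eps e _) at_eps_up /= /horner_eval.
  by rewrite hornerM hornerXn mul_polyC.
have Kv e : kills r a (v e).
  apply: kills_monomials => k lt; rewrite vE mulrBl LfB Lg // mulr_suml Lf_sum.
  rewrite (bigD1 (Ordinal lt)) //= big1 ?addr0 => [|j ne].
    have := dual (Ordinal lt) (Ordinal lt); rewrite eqxx /phi /= => E.
    by rewrite -scalerAl LfZ E mulr1 subrr.
  have := dual (Ordinal lt) j; rewrite eq_sym (negbTE ne) /phi /= => E.
  by rewrite -scalerAl LfZ E mulr0.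
have sv e : (size (v e) <= r.+1)%N.
  rewrite vE (leq_trans (size_polyD _ _)) // size_polyN geq_max.
  have := size_spreadD D e; rewrite sD -/(g e) => -> /=.
  apply: (big_ind (fun q : {poly R} => (size q <= r.+1)%N)) => [|p q sp sq|k _].
  - by rewrite size_poly0.
  - by rewrite (leq_trans (size_polyD _ _)) // geq_max sp.
  rewrite (leq_trans (size_scale_leq _ _)) //.
  apply: leq_trans (size_mul_leq3 (leqnn (size G0)) (sw k)) _; rewrite sG0.
  by clear -nr; lia.
have local x m (tau : R) : (x, m) \in D -> exists W : {poly R},
    W.[0] = (\prod_(j < m) (tau - spread R m j)) * \prod_(p <- rem (x, m) D) (x - p.1) ^+ p.2
    /\ forall e, (v e).[x + tau * e] = e ^+ m * W.[e].
  move=> xD; have [C [K [E1 E2 E3]]] := spreadD_local tau uD xD.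
  have m0 : (0 < m)%N by have /allP/(_ _ xD) := mD.
  pose pt := x%:P + tau *: 'X.
  exists ((\prod_(j < m) (tau - spread R m j))%:P * C -
    'X * \sum_(k < 8 - r) la k * (K * (lift_eps (w k)).[pt])); split.
    by rewrite hornerD hornerN !hornerM hornerC hornerX E2 mul0r subr0.
  move=> e; have -> : x + tau * e = pt.[e] by rewrite /pt !hornerE.
  rewrite /v /at_eps -[pt.[e]]/(horner_eval e pt) horner_map /=.
  have -> : Pv.[pt] = 'X^m * ((\prod_(j < m) (tau - spread R m j))%:P * C -
    'X * \sum_(k < 8 - r) la k * (K * (lift_eps (w k)).[pt])).
    rewrite /Pv hornerD hornerN E1 mulrBr; congr (_ - _).
    rewrite horner_sum !mulr_sumr; apply: eq_bigr => k _.
    rewrite hornerM hornerC [lift_eps (G0 * _)]rmorphM hornerM -/(lift_eps _) E3 -/(lift_eps _).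
    case: m {xD E1 E2} m0 E3 => // m _ _; rewrite /= !exprS expr0; ring.
  by rewrite /horner_eval hornerM hornerXn.
have cnz x m : (x, m) \in D -> \prod_(p <- rem (x, m) D) (x - p.1) ^+ p.2 != 0.
  move=> xD; rewrite prodf_seq_neq0; apply/allP => -[x' m'] pD /=.
  rewrite expf_neq0 // subr_eq0; apply: contraL uD => /eqP E.
  rewrite (perm_uniq (perm_map fst (perm_to_rem xD))) /=; apply/nandP; left.
  by rewrite negbK; apply/mapP; exists (x', m').
have ev1 : near0 (fun e => {in D, forall p, {in iota 0 p.2, forall i,
    (v e).[p.1 + (spread R p.2 i - 2^-1) * e] * (v e).[p.1 + (spread R p.2 i + 2^-1) * e] < 0}}).
  apply: near0_all => -[x m] xD; apply: near0_all => i; rewrite mem_iota /= add0n => lt.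
  have [W1 [W10 E1]] := local x m (spread R m i - 2^-1) xD.
  have [W2 [W20 E2]] := local x m (spread R m i + 2^-1) xD.
  have : 0 < (- (W1 * W2)).[0].
    rewrite hornerN hornerM W10 W20 mulrACA oppr_gt0 -expr2 pmulr_llt0 ?spread_sign //.
    by rewrite exprn_even_gt0 //= cnz.
  move=> /near0_poly; apply: near0_imp => e e0; rewrite hornerN hornerM oppr_gt0 => lt0.
  by rewrite E1 E2 mulrACA -expr2 pmulr_rlt0 // exprn_gt0 // exprn_gt0.
(* Offsets have absolute value at most 7, so points issued from different zeros approach each other
   by at most [14 * e]; the bound 15 leaves the gap [e] needed below. *)
have ev2 : near0 (fun e => {in D, forall p, {in D, forall p', p.1 != p'.1 ->
    15 * e < `|p.1 - p'.1|}}).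
  apply: near0_all => p pD; apply: near0_all => p' p'D.
  have [E|ne] := eqVneq p.1 p'.1; first by exists 1; rewrite ?ltr01.
  have : 0 < ((`|p.1 - p'.1|)%:P - 15 *: 'X).[0].
    by rewrite hornerD hornerN hornerC hornerZ hornerX mulr0 subr0 normr_gt0 subr_eq0.
  move=> /near0_poly; apply: near0_imp => e _.
  by rewrite hornerD hornerN hornerC hornerZ hornerX subr_gt0.
have [e e0 [H1 H2]] := near0_ex (near0_and ev1 ev2).
pose t := [seq p.1 + spread R p.2 i * e | p <- D, i <- iota 0 p.2].
have st : size t = r.
  by rewrite size_allpairs_dep -sD; congr sumn; apply: eq_map => p; rewrite size_iota.
have gap p i p' i' : p \in D -> p' \in D -> (i < p.2)%N -> (i' < p'.2)%N ->
    (p, i) != (p', i') ->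
    e <= `|p.1 + spread R p.2 i * e - (p'.1 + spread R p'.2 i' * e)|.
  move=> pD p'D lti lti' ne; have [E|npp] := eqVneq p p'.
    rewrite -E in ne lti' *; have {}ne : i != i' by apply: contraNneq ne => ->.
    rewrite opprD addrACA subrr add0r -mulrBl normrM (gtr0_norm e0).
    by rewrite ler_peMl ?(ltW e0) // spread_gap.
  have n1 : p.1 != p'.1.
    apply: contraNneq npp => E; move: (uD) => /(uniqP (0 : R)) inj.
    have := inj (index p D) (index p' D); rewrite !inE size_map !index_mem.
    move=> /(_ pD p'D); rewrite !(nth_map p) ?index_mem // !nth_index // => /(_ E) Ei.
    by rewrite -(nth_index p pD) Ei nth_index.
  have hb := H2 _ pD _ p'D n1.
  have m7 q : q \in D -> (q.2 <= 7)%N.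
    move=> qD; apply: leq_trans r7; rewrite -sD.
    by rewrite (perm_sumn (perm_map _ (perm_to_rem qD))) /= leq_addr.
  have b1 : `|spread R p.2 i| <= 7.
    by rewrite (le_trans (spread_bound lti)) // ler_nat m7.
  have b2 : `|spread R p'.2 i'| <= 7.
    by rewrite (le_trans (spread_bound lti')) // ler_nat m7.
  rewrite opprD addrACA -mulrBl.
  have : `|(spread R p.2 i - spread R p'.2 i') * e| <= 14 * e.
    rewrite normrM (gtr0_norm e0) ler_pM2r // (le_trans (ler_normB _ _)) //; lra.
  have := lerB_dist (p.1 - p'.1) (- ((spread R p.2 i - spread R p'.2 i') * e)).
  rewrite opprK normrN; move=> h1 h2; apply: le_trans h1; lra.
have ut : uniq t.
  apply: allpairs_uniq_dep.
  - exact: map_uniq uD.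
  - by move=> p _; apply: iota_uniq.
  move=> _ _ /allpairsPdep[p [i [pD + ->]]] /allpairsPdep[p' [i' [p'D + ->]]] /=.
  rewrite !mem_iota /= !add0n => lti lti' E; have [|ne] := eqVneq (p, i) (p', i').
    by move=> [-> ->].
  have := gap _ _ _ _ pD p'D lti lti' ne; rewrite E subrr normr0 => h.
  by have := lt_le_trans e0 h; rewrite ltxx.
have v0 : r != 0 -> v e != 0.
  rewrite -st; case Et : t => [|y t'] // _; have : y \in t by rewrite Et inE eqxx.
  move=> /allpairsPdep[p [i [pD it _]]]; have := H1 _ pD _ it.
  by apply: contraTneq => ->; rewrite horner0 mul0r ltxx.
have [r0|r0] := eqVneq r 0.
  exists [::]; split=> //; rewrite r0 /rootsp big_nil; move: (Kg).
  rewrite r0 [powD _ _](_ : _ = 1) //; case: (D) sD mD => [|[x m] D'] /=.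
    by rewrite /powD big_nil.
  by rewrite r0; case: m.
have d0 : 0 < e / 2 by rewrite divr_gt0 ?ltr0n.
have [|||t' [ut' st' [c c0 E]]] := sign_changes_split d0 _ ut (v0 r0).
- by rewrite st.
- move=> _ _ /allpairsPdep[p [i [pD + ->]]] /allpairsPdep[p' [i' [p'D + ->]]].
  rewrite !mem_iota /= !add0n => lti lti' ne.
  have -> : e / 2 + e / 2 = e by field.
  by apply: gap => //; apply: contraNneq ne => -[-> ->].
- move=> _ /allpairsPdep[p [i [pD it ->]]]; have := H1 _ pD _ it.
  set u := spread _ _ _; have -> : p.1 + (u - 2^-1) * e = p.1 + u * e - e / 2 by field.
  by have -> : p.1 + (u + 2^-1) * e = p.1 + u * e + e / 2 by field.
exists t'; split; rewrite ?st' //; have := Kv e; rewrite E => K.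
by rewrite -[rootsp _](scalerK c0); apply: killsZ.
Qed.

End SplitMultiple.

(** * Products of linear forms with multiplicities *)

Section Forms.
Variable F : fieldType.
Implicit Types (l : F * F) (s : seq (F * F)) (D : seq ((F * F) * nat)).

Definition indep l m : bool := det2 l m != 0.

Definition prodm D (f : nat -> nat) : {poly F} := \prod_(p <- D) lf p.1 ^+ f p.2.

Definition wf D := all (fun p => (p.1 != (0, 0)) && (0 < p.2)%N) D &&
  pairwise (fun p q => indep p.1 q.1) D.

Lemma indepC l m : indep l m = indep m l.
Proof.
rewrite /indep (_ : det2 l m = - det2 m l) ?oppr_eq0 //.
by rewrite /det2 opprB ![_.1 * _.2]mulrC.
Qed.

Lemma indep_tr m1 m2 l m : det2 m1 m2 != 0 ->
  indep (tr m1 m2 l) (tr m1 m2 m) = indep l m.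
Proof.
move=> D; rewrite /indep (_ : det2 _ _ = det2 l m * det2 m1 m2).
  by rewrite mulf_eq0 (negbTE D) orbF.
by rewrite /det2 /tr /=; ring.
Qed.

Lemma dep_scale l m : l != (0, 0) -> m != (0, 0) -> ~~ indep l m ->
  exists2 c, c != 0 & lf l = c *: lf m.
Proof.
case: l m => a b [c d] /= n1 n2; rewrite /indep negbK /det2 /= subr_eq0 => /eqP E.
have [c0|c0] := eqVneq c 0.
  have d0 : d != 0 by move: n2; rewrite c0 xpair_eqE eqxx.
  have a0 : a = 0 by apply: (mulIf d0); rewrite E c0 mulr0 mul0r.
  exists (b / d).
    by rewrite mulf_neq0 ?invr_eq0 //; move: n1; rewrite a0 xpair_eqE eqxx.
  rewrite /lf /= a0 c0 !add0r scalerA; congr (_ *: _); field.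
  exact: d0.
exists (a / c).
  rewrite mulf_neq0 ?invr_eq0 //; apply: contraNneq n1 => a0; rewrite a0 mul0r in E.
  have /eqP := esym E; rewrite mulf_eq0 (negbTE c0) orbF => /eqP ->.
  by rewrite a0.
apply/polyP => -[|[|i]]; rewrite coefZ !coef_lf /= ?mulr0 //; first by field.
by apply: (mulIf c0); rewrite -E; field.
Qed.

(** A form proportional to a listed one raises its multiplicity, so the list stays pairwise
    independent; the scalar lost in this way reappears in [add_form_spec]. *)
Fixpoint add_form l D : seq ((F * F) * nat) :=
  if D is (m, k) :: D' then
    if indep l m then (m, k) :: add_form l D' else (m, k.+1) :: D'
  else [:: (l, 1%N)].

Lemma prodm_cons p D f : prodm (p :: D) f = lf p.1 ^+ f p.2 * prodm D f.
Proof. by rewrite /prodm big_cons. Qed.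

Lemma add_form_spec l D : wf D -> l != (0, 0) ->
  [/\ wf (add_form l D), sumn [seq p.2 | p <- add_form l D] = (sumn [seq p.2 | p <- D]).+1,
      size (add_form l D) = (size D + all (fun p => indep l p.1) D)%N &
      exists2 c, c != 0 & prodm (add_form l D) id = c *: (lf l * prodm D id)].
Proof.
move=> wD l0.
suff [h1 h2 [h3 [h4 h5]]] : [/\ wf (add_form l D),
   (forall m, m != (0, 0) -> indep m l -> all (fun p => indep m p.1) D ->
     all (fun p => indep m p.1) (add_form l D)) &
   sumn [seq p.2 | p <- add_form l D] = (sumn [seq p.2 | p <- D]).+1 /\
   (size (add_form l D) = (size D + all (fun p => indep l p.1) D)%N /\
    exists2 c, c != 0 & prodm (add_form l D) id = c *: (lf l * prodm D id))].
  by split.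
elim: D wD => [_|[m k] D IH] /=.
  split=> //; first by rewrite /wf /= l0.
    by move=> m _ -> .
  split=> //; split=> //; exists 1; rewrite ?oner_eq0 // scale1r.
  by rewrite /prodm big_seq1 big_nil mulr1.
rewrite /wf /= => /andP[/andP[/andP[m0 k0] aD] /andP[iD pD]].
have /IH[/andP[w1 w2] h2 [h3 [h4 [c c0 h5]]]] : wf D by rewrite /wf aD.
case: ifP => [il|/negbT dl] /=.
  split.
  - by rewrite m0 k0 w1 w2 andbT /= h2 // indepC.
  - by move=> n n0 nl /andP[-> nD] /=; apply: h2.
  split; first by rewrite h3 addnS.
  split; first by rewrite h4 /= addSn.
  exists c => //; rewrite !prodm_cons h5 /= -scalerAr; congr (_ *: _).
  by rewrite mulrCA.
split; [by rewrite m0 aD iD|by move=> n _ _ /andP[-> ->]|split=> //].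
split; first by rewrite addn0.
have [c' c'0 E] := dep_scale m0 l0 (etrans (congr1 negb (indepC _ _)) dl).
exists c' => //; rewrite !prodm_cons /= exprS -mulrA {1}E -scalerAl.
by rewrite mulrCA.
Qed.

Lemma size_add_form l D : wf D -> l != (0, 0) -> (size D <= size (add_form l D))%N.
Proof. by move=> wD l0; have [_ _ -> _] := add_form_spec wD l0; rewrite leq_addr. Qed.

Lemma add_forms_spec s D : wf D -> {in s, forall l, l != (0, 0)} ->
  [/\ wf (foldr add_form D s),
      sumn [seq p.2 | p <- foldr add_form D s] = (size s + sumn [seq p.2 | p <- D])%N,
      (size D <= size (foldr add_form D s))%N &
      exists2 c, c != 0 & prodm (foldr add_form D s) id = c *: (prodf s * prodm D id)].
Proof.
move=> wD; elim: s => [|l s IH] H /=.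
  by split=> //; exists 1; rewrite ?oner_eq0 // prodf_nil mul1r scale1r.
have [|w h1 h2 [c c0 h3]] := IH; first by move=> k ks; apply: H; rewrite inE ks orbT.
have l0 : l != (0, 0) by apply: H; rewrite inE eqxx.
have [w' h1' _ [c' c'0 h3']] := add_form_spec w l0; split=> //.
- by rewrite h1' h1.
- exact: leq_trans h2 (size_add_form _ _).
exists (c' * c); first exact: mulf_neq0.
by rewrite h3' h3 prodf_cons -scalerAr scalerA mulrA.
Qed.

Definition flat D : seq (F * F) := flatten [seq nseq p.2 p.1 | p <- D].

Lemma prodf_flat D : prodf (flat D) = prodm D id.
Proof.
elim: D => [|p D IH]; first by rewrite /prodm big_nil prodf_nil.
by rewrite /flat /= prodf_cat prodf_nseq -/(flat D) IH prodm_cons.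
Qed.

Lemma size_flat D : size (flat D) = sumn [seq p.2 | p <- D].
Proof.
by rewrite size_flatten /shape -map_comp; congr sumn; apply: eq_map => p /=; rewrite size_nseq.
Qed.

Lemma flat_neq0 D : wf D -> {in flat D, forall l, l != (0, 0)}.
Proof.
move=> /andP[/allP H _] l /flattenP[_ /mapP[p /H/andP[p0 _] ->]].
by rewrite mem_nseq => /andP[_ /eqP ->].
Qed.

Definition multiple D := [seq (p.1, p.2.-1) | p <- D & (1 < p.2)%N].

Lemma wf_multiple D : wf D -> wf (multiple D).
Proof.
move=> /andP[/allP a1 a2]; apply/andP; split.
  apply/allP => _ /mapP[p + ->]; rewrite mem_filter /= => /andP[p2 /a1/andP[-> _]].
  by rewrite /= -ltnS prednK // ltnW.
rewrite pairwise_map; apply: sub_pairwise (pairwise_filter _ a2).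
by move=> p q /=.
Qed.

Lemma prodm_multiple D : wf D -> prodm (multiple D) id = prodm D predn.
Proof.
move=> /andP[/allP + _]; rewrite /prodm big_map big_filter.
move=> H; rewrite [RHS](bigID (fun p => (1 < p.2)%N)) /= [X in _ * X]big1_seq ?mulr1 //.
by move=> p; rewrite -leqNgt => /andP[+ _]; case: p.2 => [|[]].
Qed.

Lemma sum_multiple D : wf D ->
  (sumn [seq p.2 | p <- multiple D] + size D)%N = sumn [seq p.2 | p <- D].
Proof.
move=> /andP[+ _]; rewrite /multiple; elim: D => //= p D IH /andP[/andP[_ p0] /IH].
by case: ifP => /= h; lia.
Qed.

End Forms.

(** * Charts in which no zero is at infinity *)

Section Charts.
Variable R : rcfType.
Implicit Types (l : R * R) (s : seq (R * R)) (D : seq ((R * R) * nat)) (a : 'I_8 -> R).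

Lemma exists_notin (s : seq R) : exists x : R, x \notin s.
Proof.
exists (1 + \sum_(y <- s) `|y|); apply/negP => h.
have : `|1 + \sum_(y <- s) `|y| | <= \sum_(y <- s) `|y|.
  rewrite {2}(perm_big _ (perm_to_rem h)) big_cons /= lerDl; exact: sumr_ge0.
rewrite ger0_norm ?gerDr ?ler10 //.
by rewrite addr_ge0 ?ler01 // sumr_ge0.
Qed.

Lemma exists_slope s : {in s, forall l, l != (0, 0)} ->
  exists y : R, {in s, forall l, indep (1, y) l}.
Proof.
move=> nz; have [y yP] := exists_notin [seq m.2 / m.1 | m <- s].
exists y => -[u v] ms; rewrite /indep /det2 /= mul1r subr_eq0.
have [u0|u0] := eqVneq u 0.
  by rewrite u0 mulr0; apply: contraNneq (nz _ ms) => ->; rewrite u0.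
apply: contraNneq yP => E; apply/mapP; exists (u, v) => //=.
by rewrite E mulfK.
Qed.

Lemma exists_indep n s : {in s, forall l, l != (0, 0)} -> exists s',
  [/\ size s' = n, {in s', forall l, l != (0, 0)}, pairwise (@indep R) s' &
      allrel (@indep R) s' s].
Proof.
move=> nz; elim: n => [|n [s' [sz nz' pw ar]]]; first by exists [::]; split.
have [|y yP] := @exists_slope (s' ++ s).
  by move=> l; rewrite mem_cat => /orP[/nz'|/nz].
have H : all (indep (1, y)) (s' ++ s) by apply/allP.
move: H; rewrite all_cat => /andP[h1 h2].
exists ((1, y) :: s'); split=> /=.
- by rewrite sz.
- move=> l; rewrite inE => /orP[/eqP ->|]; last exact: nz'.
  by rewrite xpair_eqE oner_eq0.
- by rewrite h1.
- by rewrite allrel_consl h2.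
Qed.

(** Only finitely many slopes are excluded. In the new chart no form vanishes at infinity, so
    products become polynomials of full degree. *)
Lemma exists_chart s : {in s, forall l, l != (0, 0)} -> exists m1 m2 : R * R,
  det2 m1 m2 != 0 /\ {in s, forall l, (tr m1 m2 l).2 != 0}.
Proof.
move=> /exists_slope[y yP]; exists (1, - y), (0, 1); split.
  by rewrite /det2 /= mulr1 mulr0 subr0 oner_eq0.
move=> l /yP; rewrite /indep /det2 /tr /= mul1r mulr1 mulrN addrC.
by rewrite [y * _]mulrC.
Qed.

Definition root_of l : R := - (l.1 / l.2).

Lemma lf_root l : l.2 != 0 -> lf l = l.2 *: ('X - (root_of l)%:P).
Proof.
move=> l20; apply/polyP => -[|[|i]]; rewrite coef_lf coefZ coefB coefX coefC /=.
- by rewrite /root_of sub0r opprK mulrC divfK.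
- by rewrite subr0 mulr1.
- by rewrite subr0 mulr0.
Qed.

Lemma root_of_indep l m : l.2 != 0 -> m.2 != 0 -> indep l m = (root_of l != root_of m).
Proof.
move=> l0 m0; rewrite /root_of eqr_opp /indep /det2 subr_eq0 eqr_div //.
by rewrite [m.1 * _]mulrC [l.2 * _]mulrC.
Qed.

Lemma uniq_root_of s : {in s, forall l, l.2 != 0} -> pairwise (@indep R) s ->
  uniq (map root_of s).
Proof.
move=> fin; rewrite uniq_pairwise pairwise_map => pw.
apply: (sub_in_pairwise (P := fun l => l.2 != 0)) pw; last by apply/allP.
by move=> l m l0 m0 /=; rewrite root_of_indep.
Qed.

Lemma prodf_rootsp s : {in s, forall l, l.2 != 0} ->
  exists2 c, c != 0 & prodf s = c *: rootsp (map root_of s).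
Proof.
elim: s => [|l s IH] H.
  by exists 1; rewrite ?oner_eq0 // scale1r prodf_nil /rootsp big_nil.
have [|c c0 E] := IH; first by move=> k ks; apply: H; rewrite inE ks orbT.
have l0 : l.2 != 0 by apply: H; rewrite inE eqxx.
exists (l.2 * c); first exact: mulf_neq0.
rewrite prodf_cons E (lf_root l0) /rootsp /= big_cons.
by rewrite -scalerAl -scalerAr scalerA.
Qed.

Lemma prodm_powD D f : {in D, forall p, p.1.2 != 0} ->
  exists2 c, c != 0 & prodm D f = c *: powD [seq (root_of p.1, p.2) | p <- D] f.
Proof.
elim: D => [|p D IH] H.
  by exists 1; rewrite ?oner_eq0 // scale1r /prodm /powD !big_nil.
have [|c c0 E] := IH; first by move=> k ks; apply: H; rewrite inE ks orbT.
have l0 : p.1.2 != 0 by apply: H; rewrite inE eqxx.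
exists (p.1.2 ^+ f p.2 * c); first by rewrite mulf_neq0 // expf_neq0.
rewrite prodm_cons E {1}(lf_root l0) /powD /= big_cons exprZn.
by rewrite -scalerAl -scalerAr scalerA.
Qed.

Lemma kills_scale e a c (g : {poly R}) : c != 0 -> kills e a (c *: g) <-> kills e a g.
Proof.
by move=> c0; split=> [/(killsZ c^-1)|/(killsZ c)//]; rewrite scalerA mulVf // scale1r.
Qed.

End Charts.

Section Inverse.
Variable F : fieldType.
Implicit Types (a : 'I_8 -> F) (m : F * F).

Lemma tr_tr m1 m2 n1 n2 k : tr m1 m2 n1 = (1, 0) -> tr m1 m2 n2 = (0, 1) ->
  tr m1 m2 (tr n1 n2 k) = k :> F * F.
Proof.
move=> e3 e4; have -> : tr m1 m2 (tr n1 n2 k) = tr (tr m1 m2 n1) (tr m1 m2 n2) k.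
  by rewrite /tr /=; congr pair; ring.
by rewrite e3 e4 /tr /= !mulr1 !mulr0 addr0 add0r -surjective_pairing.
Qed.

Lemma kills_act_inv e m1 m2 a (g : {poly F}) : (e <= 7)%N -> (size g <= e.+1)%N ->
  det2 m1 m2 != 0 -> kills e (act m1 m2 a) g -> kills e a (subst e m1 m2 g).
Proof.
move=> e7 sg /tr_inv[n1 [n2 [D e1 e2 e3 e4]]] K.
have E : act n1 n2 (act m1 m2 a) =1 a.
  by move=> k; rewrite act_act e1 e2 act_id.
apply: (eq_kills E); apply: kills_act => //; first exact: size_subst.
by rewrite subst_subst e3 e4 subst_id.
Qed.

Lemma subst_eq0 e m1 m2 (g : {poly F}) : (size g <= e.+1)%N -> det2 m1 m2 != 0 ->
  subst e m1 m2 g = 0 -> g = 0.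
Proof.
move=> sg /tr_inv[n1 [n2 [D e1 e2 e3 e4]]] E.
by rewrite -(subst_id sg) -e3 -e4 -subst_subst E subst0.
Qed.

Lemma prodm_flatten (D : seq ((F * F) * nat)) f :
  prodm D f = prodf (flatten [seq nseq (f p.2) p.1 | p <- D]).
Proof.
elim: D => [|p D IH]; first by rewrite /prodm big_nil prodf_nil.
by rewrite prodm_cons IH /= prodf_cat prodf_nseq.
Qed.

Lemma size_flatten_nseq (D : seq ((F * F) * nat)) f :
  size (flatten [seq nseq (f p.2) p.1 | p <- D]) = sumn [seq f p.2 | p <- D].
Proof.
rewrite size_flatten /shape -map_comp.
by rewrite (eq_map (g := fun p => f p.2)) // => p /=; rewrite size_nseq.
Qed.

Lemma size_prodm (D : seq ((F * F) * nat)) f :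
  (size (prodm D f) <= (sumn [seq f p.2 | p <- D]).+1)%N.
Proof. by rewrite prodm_flatten (leq_trans (size_prodf _)) // size_flatten_nseq. Qed.

Lemma subst_prodm m1 m2 (D : seq ((F * F) * nat)) f :
  subst (sumn [seq f p.2 | p <- D]) m1 m2 (prodm D f) =
  prodm [seq (tr m1 m2 p.1, p.2) | p <- D] f.
Proof.
rewrite prodm_flatten -size_flatten_nseq subst_prodf prodm_flatten; congr prodf.
rewrite map_flatten -!map_comp; congr flatten; apply: eq_map => p /=.
by rewrite map_nseq.
Qed.

End Inverse.

(** * The apolarity lemma over the reals *)

Section RealForms.
Implicit Types (a : 'I_8 -> RR) (s : seq (RR * RR)).

(** For [r <= 7] this is equivalent to real rank at most [r], by [hyp_rank_le] and [rank_le_hyp]. *)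
Definition hyp r a := exists s : seq (RR * RR),
  [/\ size s = r, {in s, forall l, l != (0, 0)}, pairwise (@indep _) s &
      kills r a (prodf s)].

Lemma hyp_chart r a : (r <= 7)%N -> hyp r a -> exists m1 m2 : RR * RR,
  det2 m1 m2 != 0 /\ exists t : seq RR,
    [/\ uniq t, size t = r & kills r (act m1 m2 a) (rootsp t)].
Proof.
move=> r7 [s [sz nz pw K]]; have [n1 [n2 [D fin]]] := exists_chart nz.
have [m1 [m2 [Dm _ _ e3 e4]]] := tr_inv D.
have fin' : {in map (tr n1 n2) s, forall l, l.2 != 0}.
  by move=> _ /mapP[l ls ->]; apply: fin.
exists m1, m2; split=> //; exists (map (@root_of _) (map (tr n1 n2) s)); split.
- apply: uniq_root_of => //; rewrite pairwise_map; apply: sub_pairwise pw => l m /=.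
  by rewrite indep_tr.
- by rewrite !size_map.
have [c c0 E] := prodf_rootsp fin'.
apply/(kills_scale _ _ _ c0); rewrite -E -sz -(size_map (tr n1 n2)).
apply: kills_act_prodf; rewrite ?size_map ?sz // -map_comp.
by rewrite (eq_map (g := id)) ?map_id // => k /=; apply: tr_tr.
Qed.

Lemma hyp_rank_le r a : (r <= 7)%N -> hyp r a -> rank_le a r.
Proof.
move=> r7 /(hyp_chart r7)[m1 [m2 [D [t [ut st K]]]]].
have [n1 [n2 [_ _ E]]] := act_inv D; apply: (rank_le_ext (E a)); apply: rank_act.
by rewrite -st; apply: rank_le_rootsp; rewrite ?st // (leq_trans r7).
Qed.

(* The zeros of [prodm D id] are spread by a small [eps] and the result is corrected, to second
   order in [eps], into a form killing [a]; the correction does not change the signs. *)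
Lemma split_forms r a D : wf D -> sumn [seq p.2 | p <- D] = r -> (r <= 7)%N ->
  kills r a (prodm D id) ->
  (forall q : {poly RR}, (size q <= 8 - r)%N ->
    kills (7 - size D) a (prodm D predn * q) -> q = 0) -> rank_le a r.
Proof.
move=> wD sD r7 K unob; have /andP[nzD pwD] := wD.
have [|n1 [n2 [Dn fin]]] := @exists_chart _ (map fst D).
  by move=> _ /mapP[p /(allP nzD)/andP[p0 _] ->].
have [m1 [m2 [Dm e1 e2 e3 e4]]] := tr_inv Dn.
pose D1 := [seq (tr n1 n2 p.1, p.2) | p <- D].
have fin1 : {in D1, forall p, p.1.2 != 0}.
  by move=> _ /mapP[p pD ->]; apply: fin; apply: map_f.
have D1K : [seq (tr m1 m2 p.1, p.2) | p <- D1] = D.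
  by rewrite -map_comp -[RHS]map_id; apply: eq_map => -[l k] /=; rewrite tr_tr.
have snd_D1 (f : nat -> nat) : [seq f p.2 | p <- D1] = [seq f p.2 | p <- D] by rewrite -map_comp.
pose D2 := [seq (root_of p.1, p.2) | p <- D1].
have snd_D2 : [seq p.2 | p <- D2] = [seq p.2 | p <- D] by rewrite -!map_comp.
have kills_D1 (f : nat -> nat) e (g : {poly RR}) : (sumn [seq f p.2 | p <- D] + e <= 7)%N ->
    (size g <= e.+1)%N ->
    kills (sumn [seq f p.2 | p <- D] + e) (act m1 m2 a) (powD D2 f * g) <->
    kills (sumn [seq f p.2 | p <- D] + e) a (prodm D f * subst e m1 m2 g).
  move=> le sg; have [c c0 E] := prodm_powD f fin1.
  rewrite -(kills_scale _ _ _ c0) scalerAl -E.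
  have sz : (size (prodm D1 f) <= (sumn [seq f p.2 | p <- D]).+1)%N.
    by rewrite -snd_D1 size_prodm.
  have sz2 : (size (prodm D1 f * g)%R <= (sumn [seq f p.2 | p <- D] + e).+1)%N.
    by apply: leq_trans (size_mul_leq3 sz sg) _; rewrite addnS /= addSn.
  have Es : subst (sumn [seq f p.2 | p <- D] + e) m1 m2 (prodm D1 f * g) =
      prodm D f * subst e m1 m2 g.
    by rewrite substM // -snd_D1 subst_prodm D1K.
  split=> [/kills_act_inv|K']; first by rewrite Es; apply.
  by apply: kills_act => //; rewrite Es.
have sumpred : (sumn [seq p.2.-1 | p <- D] + size D)%N = r.
  rewrite -sD; elim: (D) nzD => //= p D' IH /andP[/andP[_ p0] /IH]; lia.
have [|||||t [ut st Kt]] := @split_multiple _ (act m1 m2 a) D2 r _ _ _ r7.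
- have -> : map fst D2 = map (@root_of _) (map fst D1) by rewrite /D2 -!map_comp.
  apply: uniq_root_of; first by move=> _ /mapP[p pD ->]; apply: fin1.
  rewrite !pairwise_map; apply: sub_pairwise pwD => p q /=.
  by rewrite indep_tr.
- by rewrite !all_map; apply: sub_all nzD => p /andP[].
- by rewrite snd_D2.
- have le0 : (sumn [seq id p.2 | p <- D] + 0 <= 7)%N by rewrite addn0 sD.
  have [_] := kills_D1 id 0%N 1 le0 (eq_leq (size_poly1 _)).
  rewrite addn0 sD !mulr1; apply.
  rewrite (_ : subst _ _ _ _ = 1) ?mulr1 //.
  by rewrite /subst big_ord_recl big_ord0 coefC /= scale1r !expr0 mulr1 addr0.
- move=> q sq; have sz2 : size D2 = size D by rewrite !size_map.
  have E7 : (7 - size D = sumn [seq p.2.-1 | p <- D] + (7 - r))%N by lia.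
  rewrite sz2 E7 => /kills_D1 H.
  have sq' : (size q <= (7 - r).+1)%N by rewrite -subSn.
  apply: (subst_eq0 sq' Dm); apply: unob.
    by rewrite (_ : 8 - r = (7 - r).+1)%N ?size_subst // -subSn.
  rewrite E7; apply: H => //; lia.
have [k1 [k2 [_ _ E]]] := act_inv Dm; apply: (rank_le_ext (E a)); apply: rank_act.
by rewrite -st; apply: rank_le_rootsp; rewrite ?st // (leq_trans r7).
Qed.

Lemma rank_le_hyp r a : (r <= 7)%N -> rank_le a r -> hyp r a.
Proof.
move=> r7 /rank_leP[c [p [q H]]].
suff [s [sz nz pw vs]] : exists s : seq (RR * RR),
    [/\ size s = r, {in s, forall l, l != (0, 0)}, pairwise (@indep _) s &
    forall j, exists2 l, l \in s & l.1 * p j + l.2 * q j = 0].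
  exists s; split=> // y sy; apply: (@polyC_inj RR); rewrite (Lf_rank _ H) big1 // => j _.
  have -> : 7%N = (size s + (7 - r))%N by rewrite sz subnKC.
  rewrite substM ?size_prodf //; last by rewrite (leq_trans sy) // -subSn.
  rewrite subst_prodf; suff -> : prodf (map (tr (p j, 0) (q j, 0)) s) = 0.
    by rewrite mul0r scaler0.
  have [l ls l0] := vs j.
  apply/eqP; rewrite /prodf big_map prodf_seq_eq0; apply/hasP; exists l => //=.
  by rewrite /lf /tr /= l0 !mulr0 addr0 scale0r addr0.
elim: r c p q {H r7} => [|r IH] c p q; first by exists [::]; split=> // -[].
have [s [sz nz pw vs]] := IH (c \o lift ord0) (p \o lift ord0) (q \o lift ord0).
(* If the new point is already a zero of some chosen form, an arbitrary independent form keeps the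
   count exact. *)
have [/hasP[l ls /eqP l0]|/hasPn nv] :=
  boolP (has (fun l => l.1 * p ord0 + l.2 * q ord0 == 0) s).
  have [s' [sz' nz' _ ar]] := exists_indep 1 nz; case: s' sz' nz' ar => [|k []] // _ nzk.
  rewrite allrel_consl allrel0l andbT => ik; exists (k :: s); split=> /=.
  - by rewrite sz.
  - by move=> n; rewrite inE => /orP[/eqP ->|/nz //]; apply: nzk; rewrite inE.
  - by rewrite ik.
  move=> j; case: (unliftP ord0 j) => [i ->|->]; last by exists l; rewrite // inE ls orbT.
  by have [n ns n0] := vs i; exists n; rewrite // inE ns orbT.
pose k : RR * RR := if (q ord0, - p ord0) == (0, 0) then (1, 0) else (q ord0, - p ord0).
have [s0|s0] := eqVneq s [::].
  exists [:: k]; split=> //=; first by rewrite -sz s0.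
    move=> n; rewrite inE => /eqP ->; rewrite /k; case: ifP => [_|->//].
    by rewrite xpair_eqE oner_eq0.
  move=> j; case: (unliftP ord0 j) => [i ->|->].
    by have [n] := vs i; rewrite s0.
  exists k; rewrite ?inE // /k; case: ifP => [|_] /=.
    by rewrite xpair_eqE oppr_eq0 => /andP[/eqP -> /eqP ->]; rewrite !mulr0 addr0.
  by rewrite mulNr mulrC subrr.
(* With [s] non-empty the default cannot occur: every form vanishes at the zero vector, which [nv]
   excludes. *)
have kE : k = (q ord0, - p ord0).
  rewrite /k; case: ifP => //; rewrite xpair_eqE oppr_eq0 => /andP[/eqP q0 /eqP p0].
  by case: s s0 nv {sz nz pw vs} => // n s _ /(_ n (mem_head _ _)); rewrite p0 q0 !mulr0 addr0 eqxx.
exists (k :: s); split=> /=.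
- by rewrite sz.
- move=> n; rewrite inE => /orP[/eqP ->|/nz //]; rewrite kE xpair_eqE oppr_eq0.
  apply/negP => /andP[/eqP q0 /eqP p0].
  by case: s s0 nv {sz nz pw vs} => // m s _ /(_ m (mem_head _ _)); rewrite p0 q0 !mulr0 addr0 eqxx.
- rewrite pw andbT; apply/allP => n /nv; rewrite kE /indep /det2 /=; apply: contraNN.
  by move=> /eqP E; apply/eqP; rewrite -E; ring.
move=> j; case: (unliftP ord0 j) => [i ->|->].
  by have [n ns n0] := vs i; exists n; rewrite // inE ns orbT.
by exists k; rewrite ?inE ?eqxx // kE /= mulNr mulrC subrr.
Qed.

End RealForms.

Section Apolarity.
Variable F : fieldType.
Implicit Types (a : 'I_8 -> F) (g p q y : {poly F}).

(* Bezout: the multiples of [q] and [p] exhaust all forms of degree [7 - e]. *)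
Lemma kills_coprime a g p q e m n : size q = m.+1 -> (size p <= n.+1)%N ->
  coprimep q p -> (m + n + e <= 8)%N ->
  kills (e + m) a (g * q) -> kills (e + n) a (g * p) -> kills e a g.
Proof.
move=> sq sp cop le Kq Kp y sy.
have [[u v] /= uv] := Bezout_eq1_coprimepP _ _ cop.
pose B := (y * v) %% q; pose A := y * u + ((y * v) %/ q) * p.
have q0 : q != 0 by rewrite -size_poly_gt0 sq.
have sB : (size B <= m)%N by rewrite -ltnS -sq ltn_modp.
have E : y = A * q + B * p.
  rewrite -[LHS]mulr1 -uv /A mulrDr mulrDl mulrA -addrA; congr (_ + _).
  rewrite mulrA {1}(divp_eq (y * v) q) -/B; ring.
have sA : (size A <= 8 - (e + m))%N.
  have [->|A0] := eqVneq A 0; first by rewrite size_poly0.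
  have : (size (A * q)%R <= maxn (8 - e) (m + n))%N.
    have -> : A * q = y - B * p by rewrite E addrK.
    rewrite (leq_trans (size_polyD _ _)) // size_polyN geq_max leq_max sy /=.
    rewrite leq_max; apply/orP; right.
    by apply: leq_trans (size_mul_leq3 sB sp) _; rewrite addnS.
  rewrite size_mul // sq addnS /=.
  move: (size A) A0 => k _; clear -le; lia.
have sB' : (size B <= 8 - (e + n))%N by apply: leq_trans sB _; lia.
have -> : g * y = (g * q) * A + (g * p) * B by rewrite {1}E; ring.
by rewrite LfD Kq // Kp // addr0.
Qed.

Lemma size_le2_lf q : (size q <= 2)%N -> exists2 l, lf l = q & (q != 0 -> l != (0, 0)).
Proof.
move=> sq; have E : lf (q`_0, q`_1) = q.
  by apply/polyP => -[|[|i]]; rewrite coef_lf //= nth_default // (leq_trans sq).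
by exists (q`_0, q`_1); rewrite ?lf_neq0 ?E.
Qed.

Lemma coprime_prodm q (D : seq ((F * F) * nat)) f : (forall x, ~~ root q x) ->
  all (fun x => x.1 != (0, 0)) D -> coprimep q (prodm D f).
Proof.
move=> nr; elim: D => [|[l k] D IH] /=; first by rewrite /prodm big_nil coprimep1.
case/andP=> l0 /IH cD; rewrite prodm_cons coprimepMr cD andbT coprimep_expr //=.
have [l20|l20] := eqVneq l.2 0.
  have -> : lf l = l.1 *: 1 by rewrite /lf l20 scale0r addr0 alg_polyC.
  rewrite coprimepZr ?coprimep1 //; apply: contraNneq l0 => l10.
  by rewrite [l]surjective_pairing l10 l20.
have -> : lf l = l.2 *: ('X - (- (l.1 / l.2))%:P).
  apply/polyP => -[|[|i]]; rewrite coef_lf coefZ coefB coefX coefC /=.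
  - by rewrite sub0r opprK mulrC divfK.
  - by rewrite subr0 mulr1.
  - by rewrite subr0 mulr0.
by rewrite coprimepZr // coprimep_XsubC.
Qed.

Lemma quadratic_root q x : (size q <= 3)%N -> q != 0 -> root q x ->
  exists l m, [/\ l != (0, 0), m != (0, 0) & q = lf l * lf m].
Proof.
move=> sq q0 /factor_theorem[q' Eq].
have q'0 : q' != 0 by apply: contraNneq q0 => E; rewrite Eq E mul0r.
have sq' : (size q' <= 2)%N.
  by move: sq; rewrite Eq size_mul ?polyXsubC_eq0 // size_XsubC addn2.
have [l El nl] := size_le2_lf sq'.
exists l, (- x, 1); split; first exact: nl.
  by rewrite xpair_eqE oner_eq0 andbF.
by rewrite El Eq; congr (_ * _); rewrite /lf /= scale1r polyCN addrC.
Qed.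

Lemma quadratic_small q : (size q <= 2)%N -> q != 0 ->
  exists l m, [/\ l != (0, 0), m != (0, 0) & q = lf l * lf m].
Proof.
move=> sq q0; have [l El nl] := size_le2_lf sq.
exists l, (1, 0); split; [exact: nl|by rewrite xpair_eqE oner_eq0|].
by rewrite El /lf /= scale0r addr0 mulr1.
Qed.

End Apolarity.

Section ComplexForms.
Implicit Types (z : 'I_8 -> CC) (q : {poly CC}).

Lemma linear_factor q n : (size q <= n.+2)%N -> q != 0 ->
  exists l q', [/\ l != (0, 0), q' != 0, (size q' <= n.+1)%N & q = lf l * q'].
Proof.
move=> sq q0; have [sq'|ne] := eqVneq (size q) n.+2; last first.
  exists (1, 0), q; split=> //; first by rewrite xpair_eqE oner_eq0.
    by rewrite -ltnS ltn_neqAle ne.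
  by rewrite /lf /= scale0r addr0 mul1r.
have [x /factor_theorem[q' Eq]] : exists x, root q x.
  by apply/closed_rootP; rewrite sq'.
have q'0 : q' != 0 by apply: contraNneq q0 => E; rewrite Eq E mul0r.
exists (- x, 1), q'; split=> //.
- by rewrite xpair_eqE oner_eq0 andbF.
- by move: sq; rewrite Eq size_mul ?polyXsubC_eq0 // size_XsubC addn2.
by rewrite Eq mulrC; congr (_ * _); rewrite /lf /= scale1r polyCN addrC.
Qed.

Lemma quadratic_factor q : (size q <= 3)%N -> q != 0 ->
  exists l m, [/\ l != (0, 0), m != (0, 0) & q = lf l * lf m].
Proof.
move=> sq q0; have [l [q' [l0 q'0 sq' E]]] := linear_factor sq q0.
have [m Em nm] := size_le2_lf sq'.
by exists l, m; rewrite Em; split=> //; apply: nm.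
Qed.

Lemma dual322P' z : dual_CRL [:: 3; 2; 2]%N z <->
  exists (l : CC * CC) q, [/\ l != (0, 0), q != 0, (size q <= 3)%N & kills 4 z (lf l ^+ 2 * q)].
Proof.
rewrite dual322P; split=> [[l [m [n [l0 m0 n0 K]]]]|[l [q [l0 q0 sq K]]]].
  exists l, (lf m * lf n); split=> //; first by rewrite mulf_neq0 // -lf_neq0.
  exact: leq_trans (size_mul_leq3 (size_lf _) (size_lf _)) _.
by have [m [n [m0 n0 E]]] := quadratic_factor sq q0; exists l, m, n; rewrite -E.
Qed.

End ComplexForms.

Section Complexify.
Implicit Types (a : 'I_8 -> RR) (g : {poly RR}).

Definition toC g : {poly CC} := map_poly (real_complex RR) g.

Lemma Lf_complexify a g : Lf (complexify a) (toC g) = (Lf a g)%:C%C.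
Proof.
rewrite /Lf rmorph_sum; apply: eq_bigr => i _; rewrite coef_map /=.
by rewrite rmorphM.
Qed.

Lemma kills_complexify e a g : kills e a g -> kills e (complexify a) (toC g).
Proof.
move=> K; apply: kills_monomials => k lt.
have -> : toC g * 'X^k = toC (g * 'X^k) by rewrite /toC rmorphM /= map_polyXn.
by rewrite Lf_complexify (kills_Xn K) ?rmorph0.
Qed.

Definition lC (l : RR * RR) : CC * CC := (l.1%:C%C, l.2%:C%C).

Lemma toC_lf l : toC (lf l) = lf (lC l).
Proof.
apply/polyP => i; rewrite coef_map !coef_lf.
by case: i => [|[|i]] //=; rewrite rmorph0.
Qed.

Lemma lC_neq0 l : l != (0, 0) -> lC l != (0, 0).
Proof.
by case: l => u v; rewrite /lC !xpair_eqE /= !(fmorph_eq0 (real_complex RR)).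
Qed.

Lemma toC_neq0 g : g != 0 -> toC g != 0.
Proof. by move=> g0; rewrite map_poly_eq0. Qed.

Lemma size_toC g : size (toC g) = size g.
Proof. exact: size_map_poly. Qed.

End Complexify.

(** * Obstructions to splitting *)

Section KeyReal.
Implicit Types (a : 'I_8 -> RR) (D : seq ((RR * RR) * nat)).

(** Raises the degree of a killing form and gains one distinct zero for each degree; the inductions
    below count distinct zeros. *)
Lemma add_simple_roots e k D1 a : wf D1 -> sumn [seq p.2 | p <- D1] = e ->
  kills e a (prodm D1 id) -> exists D2,
    [/\ wf D2, size D2 = (size D1 + k)%N, sumn [seq p.2 | p <- D2] = (e + k)%N &
        kills (e + k) a (prodm D2 id)].
Proof.
move=> /andP[nz1 pw1] s1 K1; have [|s [sz nz pw ar]] := @exists_indep _ k (map fst D1).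
  by move=> _ /mapP[p /(allP nz1)/andP[p0 _] ->].
exists ([seq (l, 1%N) | l <- s] ++ D1).
have Es : prodm [seq (l, 1%N) | l <- s] id = prodf s.
  by rewrite /prodm big_map /prodf; apply: eq_bigr => l _; rewrite expr1.
split.
- apply/andP; split.
    rewrite all_cat nz1 andbT all_map; apply/allP => l ls /=.
    by rewrite nz.
  rewrite pairwise_cat pw1 andbT pairwise_map pw andbT.
  apply/allrelP => _ p /mapP[l ls ->] pD /=.
  by move/allrelP: ar; apply; rewrite ?map_f.
- by rewrite size_cat size_map sz addnC.
- rewrite map_cat sumn_cat s1 -map_comp addnC; congr (_ + _)%N.
  by rewrite -sz; elim: s {sz nz pw ar Es} => //= l s ->.
have -> : prodm ([seq (l, 1%N) | l <- s] ++ D1) id = prodf s * prodm D1 id.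
  by rewrite -Es /prodm big_cat.
by rewrite addnC; apply: kills_mull => //; rewrite -sz size_prodf.
Qed.

Lemma size_wf D : wf D -> (size D <= sumn [seq p.2 | p <- D])%N.
Proof. by move=> wD; rewrite -(sum_multiple wD) leq_addl. Qed.

(** Induction on the number of distinct zeros. An obstruction to splitting is a killing form of
    degree [7 - size D]; [size D - 1] fresh simple zeros bring it back to degree six with more
    distinct zeros than before, unless it is a power of one linear form, whose sixth power then
    kills [a]. *)
Lemma rank6_of_forms a : (forall l, l != (0, 0) -> ~ kills 6 a (lf l ^+ 6)) ->
  forall D, wf D -> sumn [seq p.2 | p <- D] = 6%N -> kills 6 a (prodm D id) -> rank_le a 6.
Proof.
move=> no6 D; have [n] := ubnP (6 - size D); elim: n D => // n IH D lt wD sD KD.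
have sD6 : (size D <= 6)%N by rewrite -sD size_wf.
have D0 : (0 < size D)%N by case: (D) sD.
have [[q [q0 sq Kq]]|unob] := classic (exists q : {poly RR},
    [/\ q != 0, (size q <= 2)%N & kills (7 - size D) a (prodm D predn * q)]); last first.
  apply: (split_forms wD sD) => // q sq Kq; apply/eqP/negPn/negP => q0; apply: unob.
  by exists q.
have [l El nl] := size_le2_lf sq; have {}nl := nl q0.
have wM := wf_multiple wD; have sM := sum_multiple wD; rewrite sD in sM.
have [w1 s1 sz1 [c c0 E1]] := add_form_spec wM nl.
set D1 := add_form l (multiple D) in w1 s1 sz1 E1.
have K1 : kills (7 - size D) a (prodm D1 id).
  by rewrite E1 kills_scale // El mulrC prodm_multiple.
have {}s1 : sumn [seq p.2 | p <- D1] = (7 - size D)%N.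
  have ar x y : (x + y = 6)%N -> (y <= 6)%N -> x.+1 = (7 - y)%N by clear; lia.
  by rewrite s1; apply: ar sM sD6.
have [D2 [w2 sz2 s2 K2]] := add_simple_roots (size D).-1 w1 s1 K1.
have e6 : (7 - size D + (size D).-1 = 6)%N by clear -D0 sD6; lia.
rewrite e6 in s2 K2.
have [h|h] := leqP 2 (size D1).
  have ar x y : (6 - y < n.+1)%N -> (0 < y)%N -> (y <= 6)%N -> (1 < x)%N ->
    (x + y.-1 <= 6)%N -> (6 - (x + y.-1) < n)%N by clear; lia.
  have := size_wf w2; rewrite s2 sz2 => le6.
  by apply: (IH D2) => //; rewrite sz2; apply: ar lt D0 sD6 h le6.
have sz10 : (0 < size D1)%N by case: (D1) s1 => //=; clear -sD6; lia.
case ED : D1 => [|[m k] [|? ?]] in sz10 h w1 s1 K1 *; rewrite // ?ltnS ?ltn0 //= in sz10 h.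
case: (no6 m); first by move: w1; rewrite /wf /= => /andP[/andP[/andP[]]].
move: K1 s1; rewrite prodm_cons /prodm big_nil mulr1 /= addn0 => K1 Ek; rewrite Ek in K1.
have -> : 6%N = (7 - size D + (size D).-1)%N by rewrite e6.
rewrite exprD; apply: kills_mulr => //.
rewrite -prodf_nseq -[X in (_ <= X.+1)%N](size_nseq _ m); exact: size_prodf.
Qed.

Lemma no_linear a : (forall l, l != (0, 0) -> ~ kills 6 a (lf l ^+ 6)) ->
  forall q : {poly RR}, (size q <= 2)%N -> kills 1 a q -> q = 0.
Proof.
move=> no6 q sq Kq; apply/eqP/negPn/negP => q0.
have [l El nl] := size_le2_lf sq; apply: (no6 l (nl q0)).
rewrite -El in Kq; rewrite exprS; apply: (kills_mulr (e := 1) (e' := 5)) => //.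
by rewrite -prodf_nseq; exact: size_prodf.
Qed.

Lemma kills_pow e p q a (l m : RR * RR) (p' q' : nat) : (p <= p')%N -> (q <= q')%N ->
  e = (p + q)%N -> kills e a (lf l ^+ p * lf m ^+ q) ->
  kills (p' + q') a (lf l ^+ p' * lf m ^+ q').
Proof.
move=> lep leq -> K.
have -> : lf l ^+ p' * lf m ^+ q' =
    lf l ^+ p * lf m ^+ q * (lf l ^+ (p' - p) * lf m ^+ (q' - q)).
  by rewrite mulrACA -!exprD !subnKC.
have -> : (p' + q' = p + q + ((p' - p) + (q' - q)))%N by lia.
apply: kills_mulr => //; rewrite -!prodf_nseq -prodf_cat.
by rewrite -[X in (_ <= (X + _).+1)%N](size_nseq _ l)
  -[X in (_ <= (_ + X).+1)%N](size_nseq _ m) -size_cat size_prodf.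
Qed.

Section NoTwoRoots.
Variable a : 'I_8 -> RR.
Hypothesis no32 : forall l m, l != (0, 0) -> m != (0, 0) ->
  ~ kills 5 a (lf l ^+ 3 * lf m ^+ 2).
Hypothesis no41 : forall l m, l != (0, 0) -> m != (0, 0) ->
  ~ kills 5 a (lf l ^+ 4 * lf m ^+ 1).

(** Every [l^p m^q] with [p + q <= 5] divides one of the excluded quintics, up to exchanging [l] and
    [m] and allowing [m = l]. *)
Lemma two_roots_absurd D e : wf D -> (size D <= 2)%N ->
  sumn [seq p.2 | p <- D] = e -> (e <= 5)%N -> kills e a (prodm D id) -> False.
Proof.
have n10 : ((1, 0) : RR * RR) != (0, 0) by rewrite xpair_eqE oner_eq0.
have key l m p q : l != (0, 0) -> m != (0, 0) -> (p + q <= 5)%N ->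
    kills (p + q) a (lf l ^+ p * lf m ^+ q) -> False.
  move=> l0 m0 le K.
  have [/andP[h1 h2]|nh1] := boolP ((p <= 3)%N && (q <= 2)%N).
    by apply: (no32 l0 m0); apply: (kills_pow h1 h2 _ K).
  have [/andP[h1 h2]|nh2] := boolP ((p <= 4)%N && (q <= 1)%N).
    by apply: (no41 l0 m0); apply: (kills_pow h1 h2 _ K).
  have [/andP[h1 h2]|nh3] := boolP ((q <= 3)%N && (p <= 2)%N).
    apply: (no32 m0 l0).
    by apply: (kills_pow h1 h2 _ (_ : kills (q + p) _ _)); rewrite // addnC mulrC.
  have [/andP[h1 h2]|nh4] := boolP ((q <= 4)%N && (p <= 1)%N).
    apply: (no41 m0 l0).
    by apply: (kills_pow h1 h2 _ (_ : kills (q + p) _ _)); rewrite // addnC mulrC.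
  have [p5|q5] : (p = 5 /\ q = 0)%N \/ (p = 0 /\ q = 5)%N by lia.
    case: p5 K => -> ->; rewrite expr0 mulr1 => K; apply: (no41 l0 l0).
    by rewrite -exprD.
  case: q5 K => -> ->; rewrite expr0 mul1r => K; apply: (no41 m0 m0).
  by rewrite -exprD.
move=> /andP[nz _]; case: D nz => [|[l p] [|[m q] []]] //=.
- move=> _ _ <- _; rewrite /prodm big_nil => K.
  by apply: (key (1, 0) (1, 0) 0%N 0%N); rewrite // !expr0 mulr1.
- case/andP=> /andP[l0 _] _ _ <- le; rewrite prodm_cons /prodm big_nil mulr1 /= => K.
  by apply: (key l l p 0%N); rewrite // expr0 mulr1.
case/andP=> /andP[l0 _] /andP[/andP[m0 _] _] _ <-; rewrite addn0 => le.
rewrite !prodm_cons /prodm big_nil mulr1 /= => K; exact: (key l m p q).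
Qed.

(** The obstruction is now a quadratic cofactor [q]. If [q] splits over the reals, the induction on
    the number of distinct zeros goes on as in degree six, killing forms with at most two zeros
    being excluded. If not, [q] has no zero in common with the form, and Bezout removes it:
    [prodm D predn] alone kills [a] in degree [5 - size D], again with at most two zeros. *)
Lemma rank5_of_forms D : wf D -> sumn [seq p.2 | p <- D] = 5%N ->
  kills 5 a (prodm D id) -> rank_le a 5.
Proof.
have [n] := ubnP (5 - size D); elim: n D => // n IH D lt wD sD KD.
have sD5 : (size D <= 5)%N by rewrite -sD size_wf.
have [le2|D3] := leqP (size D) 2; first by case: (two_roots_absurd wD le2 sD).
have [[q [q0 sq Kq]]|unob] := classic (exists q : {poly RR},
    [/\ q != 0, (size q <= 3)%N & kills (7 - size D) a (prodm D predn * q)]); last first.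
  apply: (split_forms wD sD) => // q sq Kq; apply/eqP/negPn/negP => q0; apply: unob.
  by exists q.
have wM := wf_multiple wD; have sM := sum_multiple wD; rewrite sD in sM.
have [[l [m [l0 m0 Eq]]]|nsplit] := classic (exists l m : RR * RR,
    [/\ l != (0, 0), m != (0, 0) & q = lf l * lf m]).
  have [w0 s0 _ [c c0 E0]] := add_form_spec wM m0.
  have [w1 s1 _ [c1 c10 E1]] := add_form_spec w0 l0.
  set D1 := add_form l _ in w1 s1 E1.
  have K1 : kills (7 - size D) a (prodm D1 id).
    rewrite E1 kills_scale // E0 -scalerAr kills_scale // mulrA -Eq mulrC.
    by rewrite prodm_multiple.
  have {}s1 : sumn [seq p.2 | p <- D1] = (7 - size D)%N.
    have ar x y : (x + y = 5)%N -> (y <= 5)%N -> x.+2 = (7 - y)%N by clear; lia.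
    by rewrite s1 s0; apply: ar sM sD5.
  have [h|h] := leqP (size D1) 2.
    by case: (two_roots_absurd w1 h s1) => //; clear -D3; lia.
  have [D2 [w2 sz2 s2 K2]] := add_simple_roots (size D - 2) w1 s1 K1.
  have e5 : (7 - size D + (size D - 2) = 5)%N by clear -D3 sD5; lia.
  rewrite e5 in s2 K2; have := size_wf w2; rewrite s2 sz2 => le5.
  have ar x y : (5 - y < n.+1)%N -> (2 < y)%N -> (y <= 5)%N -> (2 < x)%N ->
    (x + (y - 2) <= 5)%N -> (5 - (x + (y - 2)) < n)%N by clear; lia.
  by apply: (IH D2) => //; rewrite sz2; apply: ar lt D3 sD5 h le5.
have sq3 : size q = 3%N.
  apply/eqP; rewrite eqn_leq sq ltnNge; apply/negP => sq2; apply: nsplit.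
  exact: quadratic_small.
have nr x : ~~ root q x.
  by apply/negP => rx; apply: nsplit; apply: quadratic_root rx.
have nzD : all (fun p => p.1 != (0, 0)) D.
  by move: wD => /andP[+ _]; apply: sub_all => p /andP[].
have Eg : prodm D predn * prodm D (fun=> 1%N) = prodm D id.
  rewrite /prodm -big_split /=; move: wD => /andP[/allP pos _].
  by apply: eq_big_seq => p /pos/andP[_ p0] /=; rewrite -exprSr prednK.
have K0 : kills (5 - size D) a (prodm D predn).
  have s1 : sumn [seq 1%N | _ <- D] = size D by elim: (D) => //= _ ? ->.
  apply: (@kills_coprime _ a _ (prodm D (fun=> 1%N)) q _ 2 (size D)) => //.
  - by have := size_prodm D (fun=> 1%N); rewrite s1.
  - exact: coprime_prodm.
  - lia.
  - by have -> : (5 - size D + 2 = 7 - size D)%N by lia.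
  - by rewrite Eg subnK.
case: (@two_roots_absurd (multiple D) (5 - size D)%N wM).
- apply: leq_trans (size_wf wM) _.
  have ar x y : (x + y = 5)%N -> (2 < y)%N -> (x <= 2)%N by clear; lia.
  exact: ar sM D3.
- have ar x y : (x + y = 5)%N -> x = (5 - y)%N by clear; lia.
  exact: ar sM.
- exact: leq_subr.
by rewrite prodm_multiple.
Qed.

End NoTwoRoots.

End KeyReal.

(** * What holds off the dual varieties *)

Section Keys.
Implicit Types (a : 'I_8 -> RR).

Definition killed_by k a := exists q : {poly RR}, [/\ q != 0, (size q <= k.+1)%N & kills k a q].

Lemma forms_group r a : RR_forms r a -> exists D,
  [/\ wf D, sumn [seq p.2 | p <- D] = r & kills r a (prodm D id)].
Proof.
move=> [s [sz nz K]]; have [//|w s1 _ [c c0 E]] := @add_forms_spec _ s [::] _ nz.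
exists (foldr (@add_form _) [::] s); split=> //; first by rewrite s1 sz addn0.
by rewrite E kills_scale // /prodm big_nil mulr1.
Qed.

Lemma toC_pow (l m : RR * RR) p q :
  toC (lf l ^+ p * lf m ^+ q) = lf (lC l) ^+ p * lf (lC m) ^+ q.
Proof. by rewrite /toC rmorphM !rmorphXn /= -!toC_lf. Qed.

(** Six zeros are prescribed at [0, ..., 5], and the single equation of degree seven is solved by
    the last factor. If the resulting form is obstructed, [a] is zero or killed by one linear
    form. *)
Lemma key7 a : rank_le a 7.
Proof.
have kill1 (l : RR * RR) : l != (0, 0) -> kills 1 a (lf l) -> rank_le a 7.
  move=> l0 K; apply: (@rank_le_mono a 1) => //; apply: hyp_rank_le => //.
  exists [:: l]; split=> //; first by move=> k; rewrite inE => /eqP ->.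
  by rewrite prodf_cons prodf_nil mulr1.
pose D0 : seq ((RR * RR) * nat) := [seq ((- i%:R, 1), 1%N) | i <- iota 0 6].
have wD0 : wf D0.
  rewrite /wf all_map pairwise_map; apply/andP; split.
    by apply/allP => i _ /=; rewrite xpair_eqE oner_eq0 andbF.
  have : pairwise (fun i j : nat => i != j) (iota 0 6) by [].
  apply: sub_pairwise => i j /=; rewrite /indep /det2 /= mulr1 mul1r subr_eq0.
  by rewrite eqr_opp eqr_nat.
pose G := prodm D0 id; pose u := Lf a G; pose w := Lf a (G * 'X).
(* The solution of one homogeneous linear equation in two unknowns, with a default when both
   coefficients vanish. *)
pose y : RR * RR := if (w, - u) == (0, 0) then (1, 0) else (w, - u).
have y0 : y != (0, 0).
  by rewrite /y; case: ifP => [_|->//]; rewrite xpair_eqE oner_eq0.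
have Ky : kills 7 a (lf y * G).
  apply: kills_monomials => -[|//] _; rewrite mulr1 mulrC /lf mulrDr.
  rewrite -scalerAr mulrC mul_polyC LfD !LfZ -/u -/w /y.
  case: ifP => [|_] /=; last by rewrite mulNr mulrC subrr.
  by rewrite xpair_eqE oppr_eq0 => /andP[/eqP -> /eqP ->]; rewrite !mulr0 addr0.
have [w1 s1 sz1 [c c0 E1]] := add_form_spec wD0 y0.
set D := add_form y D0 in w1 s1 sz1 E1.
have KD : kills 7 a (prodm D id) by rewrite E1 kills_scale.
have [[q [q0 sq Kq]]|unob] := classic (exists q : {poly RR},
    [/\ q != 0, (size q <= 1)%N & kills (7 - size D) a (prodm D predn * q)]); last first.
  apply: (split_forms w1 s1) => // q sq Kq; apply/eqP/negPn/negP => q0; apply: unob.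
  by exists q.
have [c' c'0 Eq] : exists2 c', c' != 0 & q = c'%:P.
  by apply/size_poly1P; rewrite eqn_leq sq size_poly_gt0.
move: Kq; rewrite Eq mulrC mul_polyC => /(kills_scale _ _ _ c'0).
rewrite -prodm_multiple //; have wM := wf_multiple w1; have sM := sum_multiple w1.
rewrite s1 sz1 in sM *; case: (all _ _) sM => /= sM.
  case: (multiple D) sM (size_wf wM) => [_ _|p D' /= sM]; last by move: sM; lia.
  rewrite /prodm big_nil => K; apply: (kill1 (1, 0)); first by rewrite xpair_eqE oner_eq0.
  by rewrite -[lf _]mul1r; apply: (kills_mulr (e := 0) (e' := 1)) => //; rewrite size_lf.
have [p [D' E]] : exists p D', multiple D = p :: D'.
  by case: (multiple D) sM => // p D' _; exists p, D'.
move: (wM) sM; rewrite E /= => /andP[/= /andP[/andP[p0 p1] _] _] sM K.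
have ar i j : (i + j + 6 = 7)%N -> (0 < i)%N -> i = 1%N /\ j = 0%N by clear; lia.
have [Ep ED0] := ar _ _ sM p1.
have ED' : D' = [::].
  by have := size_wf wM; rewrite E /= Ep ED0 ltnS; case: (D').
apply: (kill1 p.1 p0); move: K.
by rewrite ED' prodm_cons Ep expr1 /prodm big_nil mulr1.
Qed.

(** Two facts are needed off the walls: a limit of points of rank at most [r] still has rank at most
    [r], and the equations of [kills r] are independent, which fails exactly when a form of degree
    [7 - r] kills [a]. The same pair returns in [key5] and [key4]. *)
Lemma key6 a : ~ dual_CRL [:: 7]%N (complexify a) ->
  (RR_forms 6 a -> rank_le a 6) /\ ~ killed_by 1 a.
Proof.
move=> nd; have no6 l : l != (0, 0) -> ~ kills 6 a (lf l ^+ 6).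
  move=> l0 K; apply: nd; apply/dual7P; exists (lC l); first exact: lC_neq0.
  have := kills_complexify K; have := toC_pow l l 6 0.
  by rewrite !expr0 !mulr1 => ->.
split; first by move=> /forms_group[D [wD sD K]]; apply: rank6_of_forms K.
by move=> [q [q0 sq Kq]]; rewrite (no_linear no6 sq Kq) eqxx in q0.
Qed.

Lemma key5 a : ~ dual_CRL [:: 4; 3]%N (complexify a) ->
  ~ dual_CRL [:: 5; 2]%N (complexify a) ->
  (RR_forms 5 a -> rank_le a 5) /\ ~ killed_by 2 a.
Proof.
move=> nd43 nd52; split.
  move=> /forms_group[D [wD sD K]]; apply: rank5_of_forms K => // l m l0 m0 Klm.
    apply: nd43; apply/(@dual2P _ 3 2) => //; exists (lC l), (lC m).
    by rewrite !lC_neq0 // -toC_pow; split=> //; apply: kills_complexify.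
  apply: nd52; apply/(@dual2P _ 4 1) => //; exists (lC l), (lC m).
  by rewrite !lC_neq0 // -toC_pow; split=> //; apply: kills_complexify.
move=> [q [q0 sq Kq]]; apply: nd43; apply/(@dual2P _ 3 2) => //.
have [||l [m [l0 m0 E]]] := @quadratic_factor (toC q); rewrite ?size_toC ?toC_neq0 //.
exists l, m; split=> //.
have -> : lf l ^+ 3 * lf m ^+ 2 = toC q * (lf l ^+ 2 * lf m) by rewrite E; ring.
apply: (kills_mulr (e := 2) (e' := 3)); first exact: kills_complexify.
have -> : lf l ^+ 2 * lf m = prodf [:: l; l; m] by rewrite !prodf_cons prodf_nil; ring.
exact: size_prodf.
Qed.

(** Multiplying a killing cubic by one of its complex linear factors gives a killing quartic with a
    double zero. *)
Lemma killed_by3 a : killed_by 3 a -> dual_CRL [:: 3; 2; 2]%N (complexify a).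
Proof.
move=> [q [q0 sq /kills_complexify Kq]]; apply/dual322P'.
have [||l [q' [l0 q'0 sq' E]]] := @linear_factor (toC q) 2; rewrite ?size_toC ?toC_neq0 //.
exists l, q'; split=> //; rewrite expr2 -mulrA -E.
by apply: (kills_mull (e := 3) (e' := 1)) => //; apply: size_lf.
Qed.

Lemma RR_forms_killed r a : RR_forms r a -> killed_by r a.
Proof.
by move=> [s [sz nz K]]; exists (prodf s); rewrite prodf_nonzero // -sz size_prodf sz.
Qed.

(** No deformation is involved: a killing quartic with a repeated real factor is already of the form
    [l^2 m n] over the complex numbers, so off the wall all factors are simple. *)
Lemma key4 a : ~ dual_CRL [:: 3; 2; 2]%N (complexify a) ->
  (RR_forms 4 a -> rank_le a 4) /\ ~ killed_by 3 a.
Proof.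
move=> nd; split; last by move=> /killed_by3.
move=> /forms_group[D [wD sD K]].
have [/hasP[p pD p2]|/hasPn simple] := boolP (has (fun p => 1 < p.2)%N D).
  case: nd; apply/dual322P'; have /andP[/allP/(_ _ pD)/andP[p0 _] _] := wD.
  have Ep : prodm D id = lf p.1 ^+ 2 * (lf p.1 ^+ (p.2 - 2) * prodm (rem p D) id).
    rewrite /prodm (perm_big _ (perm_to_rem pD)) big_cons /= mulrA -exprD subnKC //.
  exists (lC p.1), (toC (lf p.1 ^+ (p.2 - 2) * prodm (rem p D) id)); split.
  - exact: lC_neq0.
  - rewrite toC_neq0 //; have /prodf_nonzero := flat_neq0 wD; rewrite prodf_flat Ep.
    by rewrite mulf_eq0 negb_or => /andP[].
  - rewrite size_toC -prodf_nseq -prodf_flat -prodf_cat (leq_trans (size_prodf _)) //.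
    rewrite size_cat size_nseq size_flat ltnS.
    have ar x y : (1 < x)%N -> (x + y = 4)%N -> (x - 2 + y <= 2)%N by clear; lia.
    apply: ar p2 _; move: sD.
    by rewrite (perm_sumn (perm_map snd (perm_to_rem pD))).
  rewrite -toC_lf -rmorphXn -rmorphM /= -Ep; exact: kills_complexify.
have one p : p \in D -> p.2 = 1%N.
  move=> pD; have /andP[/allP/(_ _ pD)/andP[_ p1] _] := wD.
  by apply/eqP; rewrite eqn_leq p1 andbT leqNgt simple.
have /andP[nz pw] := wD; apply: hyp_rank_le => //; exists (map fst D); split.
- rewrite size_map -sD; elim: (D) one => //= p D' IH one.
  by rewrite one ?inE ?eqxx // -IH // => x xD; apply: one; rewrite inE xD orbT.
- by move=> _ /mapP[p /(allP nz)/andP[p0 _] ->].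
- by rewrite pairwise_map.
have -> : prodf (map fst D) = prodm D id.
  rewrite /prodf big_map /prodm; apply: eq_big_seq => p /one ->.
  by rewrite expr1.
exact: K.
Qed.

End Keys.

(** * Polynomial functions and limits *)

Section PolynomialFunctions.
Variables (K : comNzRingType) (I : Type).

(** An inductive class closed under [=1]: continuity along sequences, restriction to lines and
    conversion to [{mpoly CC[8]}] are each one induction. *)
Inductive polyfun : ((I -> K) -> K) -> Prop :=
| polyfun_cst c : polyfun (fun=> c)
| polyfun_var i : polyfun (fun x => x i)
| polyfun_add F G : polyfun F -> polyfun G -> polyfun (fun x => F x + G x)
| polyfun_mul F G : polyfun F -> polyfun G -> polyfun (fun x => F x * G x)
| polyfun_ext F G : F =1 G -> polyfun F -> polyfun G.

Lemma polyfun_opp F : polyfun F -> polyfun (fun x => - F x).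
Proof.
move=> pF; apply: (polyfun_ext _ (polyfun_mul (polyfun_cst (-1)) pF)) => x.
by rewrite mulN1r.
Qed.

Lemma polyfun_sub F G : polyfun F -> polyfun G -> polyfun (fun x => F x - G x).
Proof. by move=> pF pG; apply: polyfun_add => //; apply: polyfun_opp. Qed.

Lemma polyfun_sum J (r : seq J) (P : pred J) (F : J -> (I -> K) -> K) :
  (forall j, P j -> polyfun (F j)) -> polyfun (fun x => \sum_(j <- r | P j) F j x).
Proof.
move=> H; elim: r => [|j r IH].
  by apply: (polyfun_ext _ (polyfun_cst 0)) => x; rewrite big_nil.
case Pj: (P j); last by apply: polyfun_ext IH => x; rewrite big_cons Pj.
apply: (polyfun_ext _ (polyfun_add (H j Pj) IH)) => x; by rewrite big_cons Pj.
Qed.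

Lemma polyfun_prod J (r : seq J) (P : pred J) (F : J -> (I -> K) -> K) :
  (forall j, P j -> polyfun (F j)) -> polyfun (fun x => \prod_(j <- r | P j) F j x).
Proof.
move=> H; elim: r => [|j r IH].
  by apply: (polyfun_ext _ (polyfun_cst 1)) => x; rewrite big_nil.
case Pj: (P j); last by apply: polyfun_ext IH => x; rewrite big_cons Pj.
apply: (polyfun_ext _ (polyfun_mul (H j Pj) IH)) => x; by rewrite big_cons Pj.
Qed.

Lemma polyfun_exp F n : polyfun F -> polyfun (fun x => F x ^+ n).
Proof.
move=> pF; elim: n => [|n IH]; first by apply: (polyfun_ext _ (polyfun_cst 1)).
by apply: (polyfun_ext _ (polyfun_mul pF IH)) => x; rewrite exprS.
Qed.

Lemma polyfun_det n (M : (I -> K) -> 'M[K]_n) :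
  (forall i j, polyfun (fun x => M x i j)) -> polyfun (fun x => \det (M x)).
Proof.
move=> H; rewrite /determinant; apply: polyfun_sum => s _.
by apply: polyfun_mul; [exact: polyfun_cst|apply: polyfun_prod].
Qed.

Lemma polyfun_adj n (M : (I -> K) -> 'M[K]_n) :
  (forall i j, polyfun (fun x => M x i j)) -> forall i j, polyfun (fun x => \adj (M x) i j).
Proof.
move=> H i j; apply: (@polyfun_ext (fun x =>
  (-1) ^+ (j + i) * \det (\matrix_(k, l) M x (lift j k) (lift i l)))) => [x|].
  rewrite mxE /cofactor; congr (_ * \det _); apply/matrixP => k l; by rewrite !mxE.
apply: polyfun_mul; first exact: polyfun_cst.
by apply: polyfun_det => k l; apply: polyfun_ext (H (lift j k) (lift i l)) => x; rewrite mxE.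
Qed.

Definition polyfun_coefs (H : (I -> K) -> {poly K}) := forall k, polyfun (fun x => (H x)`_k).

Lemma polyfun_coefs_cst p : polyfun_coefs (fun=> p).
Proof. by move=> k; apply: polyfun_cst. Qed.

Lemma polyfun_coefs_add H G : polyfun_coefs H -> polyfun_coefs G ->
  polyfun_coefs (fun x => H x + G x).
Proof.
move=> h g k; apply: (polyfun_ext _ (polyfun_add (h k) (g k))) => x.
by rewrite coefD.
Qed.

Lemma polyfun_coefs_mul H G : polyfun_coefs H -> polyfun_coefs G ->
  polyfun_coefs (fun x => H x * G x).
Proof.
move=> h g k; apply: (@polyfun_ext (fun x => \sum_(i < k.+1) (H x)`_i * (G x)`_(k - i))).
  by move=> x; rewrite coefM.
by apply: polyfun_sum => i _; apply: polyfun_mul.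
Qed.

Lemma polyfun_coefs_prod J (r : seq J) (F : J -> (I -> K) -> {poly K}) :
  (forall j, polyfun_coefs (F j)) -> polyfun_coefs (fun x => \prod_(j <- r) F j x).
Proof.
move=> H; elim: r => [|j r IH] k.
  by apply: (polyfun_ext _ (polyfun_coefs_cst 1 k)) => x; rewrite big_nil.
apply: (polyfun_ext _ (polyfun_coefs_mul (H j) IH k)) => x; by rewrite big_cons.
Qed.

End PolynomialFunctions.

Section PolynomialFunctionsField.
Variables (F : fieldType) (I : Type).

Lemma polyfun_Lf (A : 'I_8 -> (I -> F) -> F) H : (forall i, polyfun (A i)) ->
  polyfun_coefs H -> polyfun (fun x => Lf (A^~ x) (H x)).
Proof. by move=> pA pH; apply: polyfun_sum => i _; apply: polyfun_mul. Qed.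

Lemma polyfun_coefs_lf (f g : (I -> F) -> F) : polyfun f -> polyfun g ->
  polyfun_coefs (fun x => lf (f x, g x)).
Proof.
move=> pf pg [|[|k]]; [apply: polyfun_ext pf|apply: polyfun_ext pg|
  apply: polyfun_ext (polyfun_cst _ 0)] => x; by rewrite coef_lf.
Qed.

Lemma polyfun_comp (J : Type) (G : (I -> F) -> F) (Phi : I -> (J -> F) -> F) :
  polyfun G -> (forall i, polyfun (Phi i)) -> polyfun (fun x => G (fun i => Phi i x)).
Proof.
move=> pG H; elim: pG => [c|i|G1 G2 _ h1 _ h2|G1 G2 _ h1 _ h2|G1 G2 e _ h].
- exact: polyfun_cst.
- exact: H.
- exact: polyfun_add.
- exact: polyfun_mul.
by apply: polyfun_ext h => x.
Qed.

Lemma polyfun_line (G : (I -> F) -> F) : polyfun G -> forall x y : I -> F,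
  exists p : {poly F}, forall s, G (fun i => x i + s * y i) = p.[s].
Proof.
move=> pG x y; elim: pG => [c|i|G1 G2 _ [p Hp] _ [q Hq]|G1 G2 _ [p Hp] _ [q Hq]|G1 G2 e _ [p Hp]].
- by exists c%:P => s; rewrite hornerC.
- by exists ((x i)%:P + y i *: 'X) => s; rewrite hornerD hornerC hornerZ hornerX mulrC.
- by exists (p + q) => s; rewrite Hp Hq hornerD.
- by exists (p * q) => s; rewrite Hp Hq hornerM.
by exists p => s; rewrite -e Hp.
Qed.

End PolynomialFunctionsField.

(** * Limits of real sequences *)

Section Sequences.
Implicit Types (u v : nat -> RR) (l m : RR).

Definition cvgto u l := forall e : RR, 0 < e -> exists N, forall n, (N <= n)%N -> `|u n - l| < e.

Definition cvgs (I : Type) (X : nat -> I -> RR) (x : I -> RR) :=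
  forall i, cvgto (X^~ i) (x i).

Lemma cvgto_ext u v l : u =1 v -> cvgto u l -> cvgto v l.
Proof. by move=> e H d /H[N HN]; exists N => n /HN; rewrite e. Qed.

Lemma cvgto_cst c : cvgto (fun=> c) c.
Proof. by move=> e e0; exists 0%N => n _; rewrite subrr normr0. Qed.

Lemma cvgtoD u v l m : cvgto u l -> cvgto v m -> cvgto (fun n => u n + v n) (l + m).
Proof.
move=> hu hv e e0; have e2 : 0 < e / 2 by lra.
have [N HN] := hu _ e2; have [M HM] := hv _ e2.
exists (maxn N M) => n; rewrite geq_max => /andP[/HN h1 /HM h2].
have -> : u n + v n - (l + m) = (u n - l) + (v n - m) by ring.
rewrite (le_lt_trans (ler_normD _ _)) //; lra.
Qed.

Lemma cvgto_bounded u l : cvgto u l -> exists2 B : RR, 0 < B &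
  exists N, forall n, (N <= n)%N -> `|u n| <= B.
Proof.
move=> /(_ 1 ltr01)[N HN]; exists (`|l| + 1).
  by have := normr_ge0 l; lra.
exists N => n /HN h; have -> : u n = l + (u n - l) by ring.
by rewrite (le_trans (ler_normD _ _)) // lerD2l ltW.
Qed.

Lemma cvgtoM u v l m : cvgto u l -> cvgto v m -> cvgto (fun n => u n * v n) (l * m).
Proof.
move=> hu hv e e0; have [B B0 [N0 HB]] := cvgto_bounded hv.
have [|N HN] := hu (e / (2 * B)); first by rewrite divr_gt0 ?mulr_gt0.
have l1 : 0 < `|l| + 1 by have := normr_ge0 l; lra.
have [|M HM] := hv (e / (2 * (`|l| + 1))); first by rewrite divr_gt0 ?mulr_gt0.
exists (maxn N0 (maxn N M)) => n; rewrite !geq_max => /and3P[/HB h0 /HN h1 /HM h2].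
have -> : u n * v n - l * m = (u n - l) * v n + l * (v n - m) by ring.
rewrite (le_lt_trans (ler_normD _ _)) // !normrM.
have t1 : `|u n - l| * `|v n| <= e / (2 * B) * B.
  by apply: ler_pM => //; exact: ltW.
have t2 : `|l| * `|v n - m| < (`|l| + 1) * (e / (2 * (`|l| + 1))).
  apply: ltr_pM => //; lra.
have -> : e = e / (2 * B) * B + (`|l| + 1) * (e / (2 * (`|l| + 1))).
  by field; rewrite ?lt0r_neq0.
exact: ler_ltD.
Qed.

Lemma cvgto_abs u l : cvgto u l -> cvgto (fun n => `|u n|) `|l|.
Proof.
move=> H e /H[N HN]; exists N => n /HN h.
by apply: le_lt_trans h; apply: ler_dist_dist.
Qed.

Lemma cvgto_sub u l (phi : nat -> nat) : (forall n, (n <= phi n)%N) ->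
  cvgto u l -> cvgto (fun n => u (phi n)) l.
Proof. by move=> hp H e /H[N HN]; exists N => n le; apply: HN; apply: leq_trans le _. Qed.

Lemma cvgto_unique u l m : cvgto u l -> cvgto u m -> l = m.
Proof.
move=> hl hm; apply/eqP; rewrite -subr_eq0 -normr_eq0 -[_ == 0]negbK -normr_gt0 normr_id.
apply/negP => d0; have d2 : 0 < `|l - m| / 2 by lra.
have [N HN] := hl _ d2; have [M HM] := hm _ d2.
have := HN _ (leq_maxl N M); have := HM _ (leq_maxr N M).
set x := u _; move=> h1 h2; have : `|l - m| <= `|x - m| + `|x - l|.
  have -> : l - m = (x - m) - (x - l) by ring.
  exact: ler_normB.
lra.
Qed.

Lemma cvgto_lt u l m : cvgto u l -> l < m -> exists N, forall n, (N <= n)%N -> u n < m.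
Proof.
move=> H lm; have [|N HN] := H (m - l); first by rewrite subr_gt0.
by exists N => n /HN; rewrite ltr_norml => /andP[_]; lra.
Qed.

Lemma cvgto_gt u l m : cvgto u l -> m < l -> exists N, forall n, (N <= n)%N -> m < u n.
Proof.
move=> H lm; have [|N HN] := H (l - m); first by rewrite subr_gt0.
by exists N => n /HN; rewrite ltr_norml => /andP[+ _]; lra.
Qed.

Lemma cvg_polyfun (I : Type) (G : (I -> RR) -> RR) (X : nat -> I -> RR) x :
  polyfun G -> cvgs X x -> cvgto (fun n => G (X n)) (G x).
Proof.
move=> pG H; elim: pG => [c|i|G1 G2 _ h1 _ h2|G1 G2 _ h1 _ h2|G1 G2 e _ h].
- exact: cvgto_cst.
- exact: H.
- exact: cvgtoD.
- exact: cvgtoM.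
by rewrite -e; apply: cvgto_ext h.
Qed.

Lemma invn_lt (e : RR) : 0 < e -> exists N, forall n, (N <= n)%N -> (n.+1%:R)^-1 < e.
Proof.
move=> e0; exists (Num.bound e^-1) => n le.
rewrite -[e]invrK ltf_pV2 ?posrE ?invr_gt0 ?ltr0Sn //.
have ei : 0 <= e^-1 by rewrite invr_ge0 ltW.
by apply: lt_le_trans (archi_boundP ei) _; rewrite ler_nat ltnW.
Qed.

Definition extraction (phi : nat -> nat) := forall n, (n <= phi n)%N.

Lemma bounded_subseq u : (forall n, -1 <= u n <= 1) -> exists phi l,
  extraction phi /\ (forall n, (phi n < phi n.+1)%N) /\ cvgto (fun n => u (phi n)) l.
Proof.
move=> bd; have [|l Hl] := @Bolzano_Weierstrass u _ (compact_P3 (-1) 1).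
  by move=> n; have /andP[/RleP h1 /RleP h2] := bd n.
have adh N (e : RR) : 0 < e -> exists p, (N <= p)%N && (`|u p - l| < e).
  move=> e0; have e0' : Rlt 0 e by apply/RltP.
  have [|p [Np Hp]] := Hl (fun x => `|x - l| < e) N.
    exists (RIneq.mkposreal e e0') => x; rewrite /disc /= => /RltP.
    by rewrite RabsE.
  by exists p; rewrite Hp andbT; apply/ssrnat.leP.
have ex N k : exists p, (N <= p)%N && (`|u p - l| < k.+1%:R^-1).
  by apply: adh; rewrite invr_gt0 ltr0Sn.
pose step N k := xchoose (ex N k).
pose fix phi n := if n is n'.+1 then step (phi n').+1 n else step 0%N 0%N.
have lt n : (phi n < phi n.+1)%N by have /andP[] := xchooseP (ex (phi n).+1 n.+1).
have cl n : `|u (phi n) - l| < n.+1%:R^-1.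
  by case: n => [|n]; [have /andP[] := xchooseP (ex 0%N 0%N)
                      |have /andP[] := xchooseP (ex (phi n).+1 n.+1)].
exists phi, l; split; last split=> //.
  by elim=> // n IH; apply: leq_ltn_trans IH (lt n).
by move=> e /invn_lt[N HN]; exists N => n /HN; apply: lt_trans.
Qed.

(** Compactness of a finite-dimensional box; one coordinate is made convergent at a time. *)
Lemma bounded_subseqs (I : finType) (X : nat -> I -> RR) : (forall n i, -1 <= X n i <= 1) ->
  exists phi x, extraction phi /\ cvgs (fun n => X (phi n)) x.
Proof.
move=> bd.
suff [phi [hphi H]] : exists phi, extraction phi /\
    forall i, i \in enum I -> exists l, cvgto (fun n => X (phi n) i) l.
  have H' i : exists l, cvgto (fun n => X (phi n) i) l by apply: H; rewrite mem_enum.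
  have [x Hx] := ClassicalEpsilon.choice _ H'.
  by exists phi, x.
elim: (enum I) => [|i s [phi [hphi H]]]; first by exists id; split=> // n; apply: leqnn.
have [//|psi [l [hpsi [_ Hl]]]] := @bounded_subseq (fun n => X (phi n) i).
exists (phi \o psi); split; first by move=> n; apply: leq_trans (hpsi n) (hphi _).
move=> j; rewrite inE => /orP[/eqP ->|js]; first by exists l.
by have [l' Hl'] := H _ js; exists l'; apply: (@cvgto_sub (fun n => X (phi n) j)).
Qed.

End Sequences.

Section TopologySequences.
Implicit Types (S : ('I_8 -> RR) -> Prop) (a b : 'I_8 -> RR).

Lemma dist2_coord a b (e : RR) i : 0 < e -> dist2 a b < e ^+ 2 -> `|b i - a i| < e.
Proof.
move=> e0 h; rewrite distrC -ltr_sqr ?nnegrE ?(ltW e0) // real_normK ?num_real //.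
apply: le_lt_trans h; rewrite /dist2 (bigD1 i) //= lerDl; apply: sumr_ge0 => j _.
exact: sqr_ge0.
Qed.

Lemma cvgs_dist2 (A : nat -> 'I_8 -> RR) a (e : RR) : cvgs A a -> 0 < e ->
  exists N, forall n, (N <= n)%N -> dist2 a (A n) < e.
Proof.
move=> H e0; have pG : polyfun (fun x : 'I_8 -> RR => dist2 a x).
  apply: polyfun_sum => i _; apply: polyfun_exp.
  by apply: polyfun_sub; [apply: polyfun_cst|apply: polyfun_var].
apply: (cvgto_lt (cvg_polyfun pG H)).
by rewrite /dist2 big1 // => i _; rewrite subrr expr0n.
Qed.

Lemma closureP S a : closure S a <-> exists A, (forall n, S (A n)) /\ cvgs A a.
Proof.
split=> [H|[A [SA cA]] e e0]; last first.
  have [N HN] := cvgs_dist2 cA e0; exists (A N); split=> //; exact: HN.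
have H' n : exists b, S b /\ dist2 a b < (n.+1%:R^-1) ^+ 2.
  by apply: H; rewrite exprn_gt0 // invr_gt0 ltr0Sn.
have [A HA] := ClassicalEpsilon.choice _ H'.
exists A; split=> [n|i]; first by case: (HA n).
move=> e /invn_lt[N HN]; exists N => n /HN h; apply: lt_trans h.
have [_] := HA n; apply: dist2_coord; by rewrite invr_gt0 ltr0Sn.
Qed.

Lemma not_interiorP S a : ~ interior S a -> exists A, (forall n, ~ S (A n)) /\ cvgs A a.
Proof.
move=> nI; apply/(closureP (fun b => ~ S b)) => e e0; apply: NNPP => H; apply: nI.
exists e; split=> // b lt; apply: NNPP => nS; apply: H; by exists b.
Qed.

Lemma interior_cvg S a A : interior S a -> cvgs A a ->
  exists N, forall n, (N <= n)%N -> S (A n).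
Proof.
move=> [e [e0 H]] cA; have [N HN] := cvgs_dist2 cA e0.
by exists N => n /HN; apply: H.
Qed.

Lemma interior_seq S a : (forall A, cvgs A a -> exists n, S (A n)) -> interior S a.
Proof.
move=> H; apply: NNPP => /not_interiorP[A [nS /H[n Sn]]]; exact: (nS n).
Qed.

Lemma interior_sub S a : interior S a -> S a.
Proof.
move=> [e [e0 H]]; apply: H.
by rewrite /dist2 big1 // => i _; rewrite subrr expr0n.
Qed.

(** Points [A n] that are not interior have neighbours outside [S] at distance less than
    [1 / (n + 1)], and these converge to [a] as well. *)
Lemma interior_open S a : interior S a -> interior (interior S) a.
Proof.
move=> I; apply: interior_seq => A cA.
suff : exists n, ~ ~ interior S (A n) by move=> [n /NNPP h]; exists n.
apply: NNPP => H; have nI n : ~ interior S (A n).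
  by move=> h; apply: H; exists n => /(_ h).
have ex n : exists b, ~ S b /\ dist2 (A n) b < (n.+1%:R^-1) ^+ 2.
  have [B [nS cB]] := not_interiorP (nI n).
  have [|N HN] := cvgs_dist2 cB (_ : 0 < (n.+1%:R^-1 : RR) ^+ 2).
    by rewrite exprn_gt0 // invr_gt0 ltr0Sn.
  by exists (B N); split=> //; apply: HN.
have [B HB] := ClassicalEpsilon.choice _ ex.
have cB : cvgs B a.
  move=> i e e0; have e2 : 0 < e / 2 by lra.
  have [N HN] := cA i _ e2; have [M HM] := invn_lt e2.
  exists (maxn N M) => n; rewrite geq_max => /andP[/HN h1 /HM h2].
  have [_ h3] := HB n; have i0 : 0 < n.+1%:R^-1 :> RR by rewrite invr_gt0 ltr0Sn.
  have h4 := dist2_coord i i0 h3.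
  have -> : B n i - a i = (B n i - A n i) + (A n i - a i) by ring.
  have h5 := lt_trans h4 h2; rewrite (le_lt_trans (ler_normD _ _)) //.
  by have -> : e = e / 2 + e / 2 by [field]; apply: ltrD.
have [N HN] := interior_cvg I cB; exact: (HB N).1 (HN N (leqnn N)).
Qed.

End TopologySequences.

(** * Deforming a functional together with its killing form *)

Section Path.

(** Cramer's rule without division: the solution of a linear system, scaled by the determinant,
    stays polynomial in the entries. *)
Lemma cramer_sum (K : comNzRingType) n (N : 'M[K]_n) (l : 'I_n -> K) i :
  \sum_k (\sum_j \adj N k j * l j) * N i k = \det N * l i.
Proof.
transitivity (\sum_j (N *m \adj N) i j * l j).
  under eq_bigr do rewrite mulr_suml.
  rewrite exchange_big; apply: eq_bigr => j _ /=; rewrite mxE mulr_suml.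
  by apply: eq_bigr => k _; ring.
rewrite mul_mx_adj (bigD1 i) //= mxE eqxx mulr1n big1 ?addr0 // => j ne.
by rewrite mxE eq_sym (negbTE ne) mulr0n mul0r.
Qed.

Variable F : fieldType.

(* By Cramer's rule, the correction to [a] can be chosen polynomial in [s]. *)
Lemma kills_path (g : {poly {poly F}}) e (a : 'I_8 -> F) : (e <= 7)%N ->
  at_eps 0 g != 0 -> (forall s, (size (at_eps s g) <= e.+1)%N) -> kills e a (at_eps 0 g) ->
  exists A : 'I_8 -> {poly F}, (forall i, (A i).[0] = a i) /\
    forall s, kills e (fun i => (A i).[s]) (at_eps s g).
Proof.
move=> e7 g0 sg K.
pose phi (j : 'I_(8 - e)) (p : {poly F}) := Lf (fun i => p`_i) (at_eps 0 g * 'X^j).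
have [||u Hu j|w [sw dual]] := @dual_family F (8 - e) 8 phi.
- by move=> k p q; rewrite /phi -Lf_addl; apply: eq_Lf => i; rewrite coefD.
- by move=> k s p; rewrite /phi -Lf_scalel; apply: eq_Lf => i; rewrite coefZ.
- pose q := \sum_j u j *: 'X^j : {poly F}.
  have cq (k : 'I_(8 - e)) : q`_k = u k.
    rewrite coef_sum (bigD1 k) //= coefZ coefXn eqxx mulr1 big1 ?addr0 // => i.
    by rewrite -val_eqE eq_sym /= => /negbTE ne; rewrite coefZ coefXn ne mulr0.
  have sq : (size q <= 8 - e)%N.
    apply/leq_sizeP => k le; rewrite coef_sum big1 // => i _.
    by rewrite coefZ coefXn gtn_eqF ?mulr0 // (leq_trans (ltn_ord i)).
  suff q0 : q = 0 by rewrite -cq q0 coef0.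
  suff : at_eps 0 g * q = 0 by move/eqP; rewrite mulf_eq0 (negbTE g0) => /eqP.
  apply/polyP => i; rewrite coef0; have [lt|ge] := ltnP i 8; last first.
    rewrite nth_default // (leq_trans _ ge) //.
    by apply: leq_trans (size_mul_leq3 (sg 0) sq) _; rewrite addSn subnKC // ltnW.
  rewrite -[RHS](Hu i lt) mulr_sumr coef_sum; apply: eq_bigr => k _.
  rewrite -scalerAr coefZ /phi /Lf (bigD1 (Ordinal lt)) //= coefXn eqxx mulr1 big1 ?addr0 // => m.
  by rewrite -val_eqE /= => /negbTE ne; rewrite coefXn ne mulr0.
(* At parameter 0 the matrix is the identity and [l] vanishes, whence [A] starts at [a]. At other
   parameters the corrected functional is killed even if the determinant vanishes. *)
pose N := \matrix_(i < 8 - e, k < 8 - e) LfP (fun m => (w k)`_m) (g * lift_eps 'X^i).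
pose l (j : 'I_(8 - e)) := LfP a (g * lift_eps 'X^j).
pose A i := \det N * (a i)%:P - \sum_k (\sum_j \adj N k j * l j) * ((w k)`_i)%:P.
have evX s (p : {poly F}) : at_eps s (g * lift_eps p) = at_eps s g * p.
  by rewrite /at_eps rmorphM /= -/(at_eps s (lift_eps p)) at_eps_up.
have LA s h : Lf (fun i => (A i).[s]) h = (\det N).[s] * Lf a h -
    \sum_k (\sum_j \adj N k j * l j).[s] * Lf (fun i => (w k)`_i) h.
  rewrite -Lf_scalel.
  transitivity (Lf (fun i => (\det N).[s] * a i) h -
      \sum_k Lf (fun i => (\sum_j \adj N k j * l j).[s] * (w k)`_i) h); last first.
    by congr (_ - _); apply: eq_bigr => k _; rewrite Lf_scalel.
  rewrite /Lf exchange_big -sumrB; apply: eq_bigr => i _ /=.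
  rewrite -mulr_sumr -mulrBr; congr (_ * _).
  rewrite /A hornerD hornerN hornerM hornerC; congr (_ - _).
  rewrite horner_sum; apply: eq_bigr => k _.
  by rewrite hornerM hornerC.
exists A; split=> [i|s].
  have l0 j : (l j).[0] = 0.
    by rewrite /l LfPE evX; apply: kills_Xn K _.
  have N0 : (\det N).[0] = 1.
    rewrite -[_.[0]]/(horner_eval 0 _) -det_map_mx -(det1 _ (8 - e)); congr (\det _).
    apply/matrixP => i' k; rewrite !mxE /= /horner_eval LfPE evX.
    exact: dual.
  rewrite /A hornerD hornerN hornerM hornerC N0 mul1r horner_sum big1 ?subr0 // => k _.
  by rewrite hornerM horner_sum big1 ?mul0r // => j _; rewrite hornerM l0 mulr0.
apply: kills_monomials => m lt; rewrite LA.
have -> : Lf a (at_eps s g * 'X^m) = (l (Ordinal lt)).[s] by rewrite /l LfPE evX.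
rewrite -hornerM -(cramer_sum N l) horner_sum; apply/eqP; rewrite subr_eq0; apply/eqP.
by apply: eq_bigr => k _; rewrite hornerM mxE LfPE evX.
Qed.

End Path.

(** * Closed conditions by compactness *)

Section Closedness.
Implicit Types (a : 'I_8 -> RR).

Lemma cvgs_act m1 m2 A a : cvgs A a -> cvgs (fun n => act m1 m2 (A n)) (act m1 m2 a).
Proof.
move=> cA k; apply: (@cvg_polyfun _ (fun x => act m1 m2 x k)) cA.
apply: polyfun_Lf => [i|]; [exact: polyfun_var|exact: polyfun_coefs_cst].
Qed.

Lemma cvg_Lf_coefs (I : Type) A a (X : nat -> I -> RR) x H : cvgs A a -> cvgs X x ->
  polyfun_coefs H -> cvgto (fun n => Lf (A n) (H (X n))) (Lf a (H x)).
Proof.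
move=> cA cX pH; rewrite /Lf; elim: (index_enum _) => [|i s IH].
  by apply: (cvgto_ext _ (cvgto_cst _)) => n; rewrite !big_nil.
apply: (cvgto_ext (u := fun n => (H (X n))`_i * A n i + \sum_(j <- s) (H (X n))`_j * A n j)).
  by move=> n; rewrite big_cons.
rewrite big_cons; apply: cvgtoD IH; apply: cvgtoM (cA i).
exact: (cvg_polyfun (pH i) cX).
Qed.

Lemma cvg_kills (I : Type) A a (X : nat -> I -> RR) x H e : cvgs A a -> cvgs X x ->
  polyfun_coefs H -> (forall n, kills e (A n) (H (X n))) -> kills e a (H x).
Proof.
move=> cA cX pH K; apply: kills_monomials => k lt.
have pHX : polyfun_coefs (fun y => H y * 'X^k).
  by apply: polyfun_coefs_mul => //; apply: polyfun_coefs_cst.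
apply: (@cvgto_unique (fun=> 0)); last exact: cvgto_cst.
by apply: cvgto_ext (cvg_Lf_coefs cA cX pHX) => n; apply: kills_Xn (K n) lt.
Qed.

(** [e] fixes the number [8 - e] of equations and [k] bounds the degree of the polynomial; for
    [k < e] this is a killing form of degree [e] with a zero at infinity. *)
Definition killed_in e k a := exists q : {poly RR}, [/\ q != 0, (size q <= k.+1)%N & kills e a q].

(** Scaling the coefficients to absolute sum one keeps them in a compact set that avoids zero, so
    the limit polynomial is non-zero. *)
Lemma killed_in_closed e k A a : cvgs A a -> (forall n, killed_in e k (A n)) -> killed_in e k a.
Proof.
move=> cA H.
have H' n : exists x : 'I_k.+1 -> RR, \sum_i `|x i| = 1 /\
    kills e (A n) (\sum_(i < k.+1) x i *: 'X^i).
  have [q [q0 sq K]] := H n; pose S := \sum_(i < k.+1) `|q`_i|.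
  have S0 : S != 0.
    apply: contraNneq q0 => /psumr_eq0P S0; rewrite (poly_sumX sq) big1 // => i _.
    by have /normr0_eq0 -> := S0 (fun i _ => normr_ge0 _) i isT; rewrite scale0r.
  exists (fun i => S^-1 * q`_i); split.
    rewrite (eq_bigr (fun i : 'I_k.+1 => S^-1 * `|q`_i|)) -?mulr_sumr ?mulVf // => i _.
    by rewrite normrM ger0_norm // invr_ge0 sumr_ge0.
  rewrite (_ : \sum_i _ = S^-1 *: q); first exact: killsZ.
  rewrite [q in RHS](poly_sumX sq) scaler_sumr; apply: eq_bigr => i _.
  by rewrite scalerA.
have [X HX] := ClassicalEpsilon.choice _ H'.
have bd n i : -1 <= X n i <= 1.
  by rewrite -ler_norml -[leRHS](HX n).1 (bigD1 i) //= lerDl; apply: sumr_ge0.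
have [phi [x [hphi cx]]] := bounded_subseqs bd.
pose P y : {poly RR} := \sum_(i < k.+1) y i *: 'X^i.
have pP : polyfun_coefs P.
  move=> j; apply: (@polyfun_ext _ _ (fun y => \sum_(i < k.+1) y i * ('X^i)`_j)) => [y|].
    by rewrite coef_sum; apply: eq_bigr => i _; rewrite coefZ.
  by apply: polyfun_sum => i _; apply: polyfun_mul; [apply: polyfun_var|apply: polyfun_cst].
exists (P x); split.
- apply/negP => /eqP Px0; have : \sum_i `|x i| = 1.
    apply: (@cvgto_unique (fun=> 1)); last exact: cvgto_cst.
    apply: (cvgto_ext (u := fun n => \sum_i `|X (phi n) i|)); first by move=> n; case: (HX (phi n)).
    elim: (index_enum _) => [|i s IH].
      by apply: (cvgto_ext _ (cvgto_cst _)) => n; rewrite !big_nil.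
    apply: (cvgto_ext (u := fun n => `|X (phi n) i| + \sum_(j <- s) `|X (phi n) j|)).
      by move=> n; rewrite big_cons.
    by rewrite big_cons; apply: cvgtoD IH; apply: cvgto_abs.
  rewrite big1 => [/eqP|i _]; first by rewrite eq_sym oner_eq0.
  have : (P x)`_i = 0 by rewrite Px0 coef0.
  rewrite coef_sum (bigD1 i) //= coefZ coefXn eqxx mulr1 big1 ?addr0 => [->|j].
    exact: normr0.
  by rewrite -val_eqE eq_sym /= => /negbTE ne; rewrite coefZ coefXn ne mulr0.
- apply/leq_sizeP => j le; rewrite coef_sum big1 // => i _.
  by rewrite coefZ coefXn gtn_eqF ?mulr0 // (leq_trans (ltn_ord i)).
apply: (@cvg_kills _ (fun n => A (phi n)) _ (fun n => X (phi n)) _ P) => //.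
  by move=> i; apply: (@cvgto_sub (fun n => A n i)).
by move=> n; case: (HX (phi n)).
Qed.

Lemma killed_by_closed k A a : cvgs A a -> (forall n, killed_by k (A n)) -> killed_by k a.
Proof. exact: (@killed_in_closed k). Qed.

Definition forms_of r (x : 'I_r * bool -> RR) : seq (RR * RR) :=
  [seq (x (j, true), x (j, false)) | j <- enum 'I_r].

Lemma polyfun_prodf r : polyfun_coefs (fun x : 'I_r * bool -> RR => prodf (forms_of x)).
Proof.
move=> k; apply: (polyfun_ext (F := fun x : 'I_r * bool -> RR =>
  (\prod_(j <- enum 'I_r) lf (x (j, true), x (j, false)))`_k)).
  by move=> x; rewrite /prodf /forms_of [in RHS]big_map.
apply: polyfun_coefs_prod => j.
by apply: polyfun_coefs_lf; apply: polyfun_var.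
Qed.

(** Each linear form is scaled to [|u| + |v| = 1], a compact set that avoids zero. The convergent
    factors are returned together with their limit for the sake of [quintic_limit]. *)
Lemma forms_compact r A a : cvgs A a -> (forall n, RR_forms r (A n)) ->
  exists phi (X : nat -> 'I_r * bool -> RR) x, [/\ extraction phi, cvgs X x,
    forall n, kills r (A (phi n)) (prodf (forms_of (X n))),
    kills r a (prodf (forms_of x)) &
    (forall n, {in forms_of (X n), forall l, l != (0, 0)}) /\
    {in forms_of x, forall l, l != (0, 0)}].
Proof.
move=> cA H.
have H' n : exists x : 'I_r * bool -> RR,
    (forall j, `|x (j, true)| + `|x (j, false)| = 1) /\
    kills r (A n) (prodf (forms_of x)).
  have [s [sz nz K]] := H n; pose nrm (l : RR * RR) := `|l.1| + `|l.2|.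
  have n0 l : l \in s -> nrm l != 0.
    move=> /nz; apply: contraNneq => /eqP; rewrite paddr_eq0 // !normr_eq0.
    by case: l => u v /= /andP[/eqP -> /eqP ->].
  pose f (l : RR * RR) : RR * RR := ((nrm l)^-1 * l.1, (nrm l)^-1 * l.2).
  pose x (p : 'I_r * bool) : RR := if p.2 then (f (nth (0, 0) s p.1)).1 else (f (nth (0, 0) s p.1)).2.
  have Ex : forms_of x = map f s.
    rewrite -[s in RHS](mkseq_nth (0, 0)) /mkseq -map_comp sz -val_enum_ord -map_comp.
    by apply: eq_map => j /=; rewrite /x /=.
  exists x; split.
    move=> j; have js : nth (0, 0) s j \in s by rewrite mem_nth // sz.
    rewrite /x /= !normrM -mulrDr ger0_norm ?invr_ge0 ?addr_ge0 //.
    by rewrite mulVf // n0.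
  rewrite Ex; suff [c E] : exists c, prodf (map f s) = c *: prodf s by rewrite E; apply: killsZ.
  elim: s {sz nz K n0 x Ex} => [|l s [c E]]; first by exists 1; rewrite scale1r.
  exists ((nrm l)^-1 * c); rewrite /= !prodf_cons E (_ : lf (f l) = (nrm l)^-1 *: lf l).
    by rewrite -scalerAl -scalerAr scalerA.
  by apply/polyP => -[|[|i]]; rewrite coefZ !coef_lf //= mulr0.
have [X HX] := ClassicalEpsilon.choice _ H'.
have bd n i : -1 <= X n i <= 1.
  rewrite -ler_norml; case: i => j b; rewrite -[leRHS]((HX n).1 j).
  by case: b; rewrite ?lerDl ?lerDr.
have [phi [x [hphi cx]]] := bounded_subseqs bd.
have nx j : `|x (j, true)| + `|x (j, false)| = 1.
  apply: (@cvgto_unique (fun=> 1)); last exact: cvgto_cst.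
  apply: (cvgto_ext (u := fun n => `|X (phi n) (j, true)| + `|X (phi n) (j, false)|)).
    by move=> n; case: (HX (phi n)).
  by apply: cvgtoD; apply: cvgto_abs.
have nz (y : 'I_r * bool -> RR) : (forall j, `|y (j, true)| + `|y (j, false)| = 1) ->
    {in forms_of y, forall l, l != (0, 0)}.
  move=> ny _ /mapP[j _ ->]; apply/eqP => -[e1 e2]; have := ny j.
  by rewrite e1 e2 normr0 addr0 => /eqP; rewrite eq_sym oner_eq0.
exists phi, (fun n => X (phi n)), x; split=> //.
- by move=> n; case: (HX (phi n)).
- apply: (@cvg_kills _ (fun n => A (phi n)) _ (fun n => X (phi n)) _ (fun x => prodf (forms_of x))) => //.
  + by move=> i; apply: (@cvgto_sub (fun n => A n i)).
  + exact: polyfun_prodf.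
  by move=> n; case: (HX (phi n)).
by split=> [n|]; apply: nz => //; case: (HX (phi n)).
Qed.

Lemma size_forms_of r (x : 'I_r * bool -> RR) : size (forms_of x) = r.
Proof. by rewrite size_map size_enum_ord. Qed.

Lemma RR_forms_closed r A a : cvgs A a -> (forall n, RR_forms r (A n)) -> RR_forms r a.
Proof.
move=> cA /(forms_compact cA)[phi [X [x [_ _ _ K [_ nz]]]]].
by exists (forms_of x); rewrite size_forms_of.
Qed.

End Closedness.

(** * Boundary points *)

Section OpenConditions.
Implicit Types (a : 'I_8 -> RR).

Lemma root_gap (R : rcfType) (t : seq R) : uniq t -> exists2 d : R, 0 < d &
  {in t &, forall x y : R, x != y -> d + d <= `|x - y|} /\
  {in t, forall x : R, (rootsp t).[x - d] * (rootsp t).[x + d] < 0}.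
Proof.
move=> ut.
have ev1 : near0 (fun d : R => {in t, forall x, {in t, forall y, x != y -> d + d <= `|x - y|}}).
  apply: near0_all => x xt; apply: near0_all => y yt.
  have [E|ne] := eqVneq x y; first by exists 1; rewrite ?ltr01.
  have : 0 < ((`|x - y|)%:P - 2 *: 'X).[0].
    by rewrite hornerD hornerN hornerC hornerZ hornerX mulr0 subr0 normr_gt0 subr_eq0.
  move=> /near0_poly; apply: near0_imp => e _.
  by rewrite hornerD hornerN hornerC hornerZ hornerX subr_gt0 => /ltW h _; lra.
have ev2 : near0 (fun d : R => {in t, forall x, (rootsp t).[x - d] * (rootsp t).[x + d] < 0}).
  apply: near0_all => x xt; pose h := rootsp (rem x t).
  have Et : rootsp t = ('X - x%:P) * h.
    by rewrite /rootsp (perm_big _ (perm_to_rem xt)) big_cons.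
  have hx : h.[x] != 0.
    by rewrite rootsp_eq0 mem_rem_uniq // inE eqxx.
  have : 0 < ((h \Po (x%:P - 'X)) * (h \Po (x%:P + 'X))).[0].
    rewrite hornerM !horner_comp !hornerD hornerN hornerC hornerX subr0 addr0.
    by rewrite -expr2 exprn_even_gt0.
  move=> /near0_poly; apply: near0_imp => e e0.
  rewrite hornerM !horner_comp !hornerD hornerN hornerC hornerX => hp.
  rewrite Et !hornerM !hornerXsubC.
  have -> : (x - e - x) * h.[x - e] * ((x + e - x) * h.[x + e]) =
    - (e ^+ 2 * (h.[x - e] * h.[x + e])) by ring.
  by rewrite oppr_lt0 mulr_gt0 // exprn_gt0.
have [d d0 [h1 h2]] := near0_ex (near0_and ev1 ev2).
by exists d => //; split=> // x y xt yt; apply: h1.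
Qed.

Lemma subst_killed_by k m1 m2 a : (k <= 7)%N -> det2 m1 m2 != 0 ->
  killed_by k (act m1 m2 a) -> killed_by k a.
Proof.
move=> k7 D [q [q0 sq K]]; exists (subst k m1 m2 q); split.
- by apply: contraNneq q0 => /(subst_eq0 sq D) ->.
- exact: size_subst.
exact: kills_act_inv.
Qed.

(** With no killing form of degree [7 - r], the equations of [kills r] are independent at the base
    point. Cramer's rule then gives a killing form [v c] that depends polynomially on the functional
    [c] and equals [rootsp t] at the base point; the sign changes at the simple zeros persist
    nearby. *)
Lemma hyp_open r a A : (r <= 7)%N -> hyp r a -> ~ killed_by (7 - r) a -> cvgs A a ->
  exists N, forall n, (N <= n)%N -> rank_le (A n) r.
Proof.
move=> r7 /(hyp_chart r7)[m1 [m2 [D [t [ut st Kt]]]]] nk cA.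
pose b := act m1 m2 a; pose B n := act m1 m2 (A n).
have cB : cvgs B b by apply: cvgs_act.
suff [N HN] : exists N, forall n, (N <= n)%N -> rank_le (B n) r.
  have [n1 [n2 [_ _ E]]] := act_inv D; exists N => n /HN h.
  by apply: (rank_le_ext (E (A n))); apply: rank_act.
have nkb : ~ killed_by (7 - r) b by move=> /subst_killed_by h; apply/nk/h; rewrite ?leq_subr.
pose phi (k : 'I_(8 - r)) (p : {poly RR}) := Lf b (p * 'X^k).
have [||u Hu k|w [sw dual]] := @dual_family _ (8 - r) r.+1 phi.
- by move=> k p q; rewrite /phi mulrDl LfD.
- by move=> k c p; rewrite /phi -scalerAl LfZ.
- pose q := \sum_j u j *: 'X^j : {poly RR}.
  have cq (j : 'I_(8 - r)) : q`_j = u j.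
    rewrite coef_sum (bigD1 j) //= coefZ coefXn eqxx mulr1 big1 ?addr0 // => i.
    by rewrite -val_eqE eq_sym /= => /negbTE ne; rewrite coefZ coefXn ne mulr0.
  have [q0|q0] := eqVneq q 0; first by rewrite -cq q0 coef0.
  case: nkb; exists q; split=> //.
    rewrite -subSn //; apply/leq_sizeP => j le; rewrite coef_sum big1 // => i _.
    by rewrite coefZ coefXn gtn_eqF ?mulr0 // (leq_trans (ltn_ord i)).
  apply: kills_monomials => i lt; rewrite -[RHS](Hu i); last first.
    by apply: leq_trans lt _; rewrite leq_subLR; lia.
  rewrite mulr_suml Lf_sum; apply: eq_bigr => j _.
  by rewrite -scalerAl LfZ /phi ['X^i * _]mulrC.
pose g := rootsp t.
pose N (c : 'I_8 -> RR) := \matrix_(i < 8 - r, k < 8 - r) Lf c (w k * 'X^i).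
pose l c (j : 'I_(8 - r)) := Lf c (g * 'X^j).
pose v c := \det (N c) *: g - \sum_k (\sum_j \adj (N c) k j * l c j) *: w k.
have pL p : polyfun (fun c : 'I_8 -> RR => Lf c p).
  by apply: (polyfun_Lf (A := fun i c => c i)) => [i|]; [apply: polyfun_var|apply: polyfun_coefs_cst].
have pN i k : polyfun (fun c => N c i k).
  by apply: polyfun_ext (pL (w k * 'X^i)) => c; rewrite mxE.
have Kv c : kills r c (v c).
  apply: kills_monomials => m lt; rewrite /v mulrBl LfB -scalerAl LfZ [X in _ - Lf c X]mulr_suml Lf_sum.
  have := cramer_sum (N c) (l c) (Ordinal lt); rewrite {2}/l /= => <-.
  apply/eqP; rewrite subr_eq0; apply/eqP; apply: eq_bigr => k _.
  by rewrite -scalerAl LfZ mxE.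
have sv c : (size (v c) <= (size t).+1)%N.
  rewrite /v (leq_trans (size_polyD _ _)) // size_polyN geq_max.
  rewrite (leq_trans (size_scale_leq _ _)) ?size_rootsp //=.
  apply: (big_ind (fun q : {poly RR} => (size q <= (size t).+1)%N)) => [|p q sp sq|k _].
  - by rewrite size_poly0.
  - by rewrite (leq_trans (size_polyD _ _)) // geq_max sp.
  by rewrite (leq_trans (size_scale_leq _ _)) // st.
have pv x : polyfun (fun c => (v c).[x]).
  apply: (polyfun_ext (F := fun c => \det (N c) * g.[x] -
      \sum_k (\sum_j \adj (N c) k j * l c j) * (w k).[x])).
    move=> c; rewrite /v hornerD hornerN hornerZ horner_sum; congr (_ - _).
    by apply: eq_bigr => k _; rewrite hornerZ.
  apply: polyfun_sub; first by apply: polyfun_mul; [apply: polyfun_det|apply: polyfun_cst].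
  apply: polyfun_sum => k _; apply: polyfun_mul; last exact: polyfun_cst.
  apply: polyfun_sum => j _; apply: polyfun_mul; last exact: pL.
  exact: polyfun_adj.
have vb : v b = g.
  rewrite /v; have -> : N b = 1%:M.
    by apply/matrixP => i k; rewrite !mxE; apply: dual.
  rewrite det1 scale1r big1 ?subr0 // => k _; rewrite big1 ?scale0r // => j _.
  by rewrite /l (kills_Xn Kt) // mulr0.
have [d d0 [gap sgn]] := root_gap ut.
have [M HM] : exists M, forall n, (M <= n)%N ->
    {in t, forall x, (v (B n)).[x - d] * (v (B n)).[x + d] < 0} /\ v (B n) != 0.
  have [M1 HM1] : exists M, forall n, (M <= n)%N ->
      {in t, forall x, (v (B n)).[x - d] * (v (B n)).[x + d] < 0}.
    have H x : x \in t -> exists M, forall n, (M <= n)%N -> (v (B n)).[x - d] * (v (B n)).[x + d] < 0.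
      move=> xt; have := cvg_polyfun (polyfun_mul (pv (x - d)) (pv (x + d))) cB.
      by rewrite vb => /cvgto_lt; apply; apply: sgn.
    elim: (t) H => [|x s IH] H; first by exists 0%N.
    have [M1 h1] := H x (mem_head _ _).
    have [M2 h2] := IH (fun y ys => H y (mem_behead (s := x :: s) ys)).
    exists (maxn M1 M2) => n; rewrite geq_max => /andP[/h1 p1 /h2 p2] y.
    by rewrite inE => /orP[/eqP ->|/p2].
  have [x xt] := exists_notin t.
  have gx0 : 0 < g.[x] ^+ 2 by rewrite exprn_even_gt0 //= rootsp_eq0.
  have := cvg_polyfun (polyfun_mul (pv x) (pv x)) cB; rewrite vb => /cvgto_gt.
  move=> /(_ _ gx0)[M2 HM2]; exists (maxn M1 M2) => n; rewrite geq_max => /andP[/HM1 h1 /HM2 h2].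
  by split=> //; apply: contraTneq h2 => ->; rewrite horner0 mul0r ltxx.
exists M => n /HM[sg v0].
have [t' [ut' st' [c c0 E]]] := sign_changes_split d0 (sv (B n)) ut v0 gap sg.
rewrite -st -st'; apply: rank_le_rootsp => //; first by rewrite st' st (leq_trans r7).
rewrite st' st; have := Kv (B n); rewrite E => K.
by rewrite -[rootsp _](scalerK c0); apply: killsZ.
Qed.

Lemma rank_le_open r a : (r <= 7)%N -> rank_le a r -> ~ killed_by (7 - r) a ->
  interior (fun b => rank_le b r) a.
Proof.
move=> r7 /(rank_le_hyp r7) h nk; apply: interior_seq => A cA.
by have [N HN] := hyp_open r7 h nk cA; exists N; apply: HN.
Qed.

Lemma closure_rank_le r a : (r <= 7)%N -> closure (fun b => rank_le b r) a -> RR_forms r a.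
Proof.
move=> r7 /closureP[A [H cA]]; apply: RR_forms_closed cA _ => n.
exact: rank_le_forms.
Qed.

Lemma near0_neq0 (R : rcfType) (p : {poly R}) : p != 0 -> near0 (fun e => p.[e] != 0).
Proof.
move=> p0; have [m [q q0 ->]] := multiplicity_XsubC p 0; rewrite p0 /= in q0.
have : 0 < (q ^+ 2).[0].
  by rewrite horner_exp exprn_even_gt0.
move=> /near0_poly; apply: near0_imp => e e0; rewrite !horner_exp => qe.
rewrite hornerM mulf_neq0 //; first by apply: contraTneq qe => ->; rewrite expr0n ltxx.
by rewrite horner_exp hornerXsubC subr0 expf_neq0 // lt0r_neq0.
Qed.

Lemma closure_path (A : 'I_8 -> {poly RR}) (S : ('I_8 -> RR) -> Prop) :
  near0 (fun e : RR => S (fun i => (A i).[e])) -> closure S (fun i => (A i).[0]).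
Proof.
move=> [d d0 Hd].
apply/closureP; exists (fun n i => (A i).[d / n.+2%:R]); split.
  move=> n; apply: Hd; rewrite divr_gt0 //= ltr_pdivrMr ?ltr0Sn //.
  by rewrite ltr_pMr // ltr1n.
move=> i; have pA : polyfun (fun x : unit -> RR => (A i).[x tt]).
  apply: (polyfun_ext (F := fun x : unit -> RR => \sum_(k < size (A i)) (A i)`_k * x tt ^+ k)).
    by move=> x; rewrite horner_coef.
  apply: polyfun_sum => k _; apply: polyfun_mul; first exact: polyfun_cst.
  by apply: polyfun_exp; apply: polyfun_var.
apply: (@cvg_polyfun unit _ (fun n _ => d / n.+2%:R) (fun=> 0) pA) => _ e e0.
have [N HN] : exists N, forall n, (N <= n)%N -> n.+1%:R^-1 < e / d.
  by apply: invn_lt; rewrite divr_gt0.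
exists N => n le; rewrite subr0 gtr0_norm ?divr_gt0 ?ltr0Sn // mulrC -ltr_pdivlMr //.
by apply: HN; apply: leq_trans le _.
Qed.

Lemma RR_forms_closure r a : (r <= 7)%N -> RR_forms r a -> closure (fun b => rank_le b r) a.
Proof.
move=> r7 [s [sz nz K]].
(* The [j]-th factor moves with velocity [(j, 1)]: the determinant of the factors [i] and [j] has
   leading coefficient [i - j] in [e], so they are independent for small positive [e]. *)
pose L (j : nat) : {poly {poly RR}} :=
  ((nth (0, 0) s j).1%:P + j%:R *: 'X)%:P + ((nth (0, 0) s j).2%:P + 'X)%:P * 'X.
pose l (e : RR) j : RR * RR := ((nth (0, 0) s j).1 + j%:R * e, (nth (0, 0) s j).2 + e).
pose g := \prod_(j < r) L j.
have evL e j : at_eps e (L j) = lf (l e j).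
  rewrite /at_eps rmorphD rmorphM /= map_polyX !map_polyC /= /horner_eval.
  by rewrite !hornerE mul_polyC.
have evg e : at_eps e g = prodf [seq l e j | j <- iota 0 r].
  rewrite /at_eps rmorph_prod /prodf big_map /=.
  rewrite -(big_mkord xpredT (fun j => map_poly (horner_eval e) (L j))) /index_iota subn0.
  by apply: eq_bigr => j _; rewrite -evL.
have g0E : at_eps 0 g = prodf s.
  rewrite evg -[s in RHS](mkseq_nth (0, 0)) /mkseq sz; congr prodf; apply: eq_map => j.
  by rewrite /l mulr0 !addr0 -surjective_pairing.
have [|e||A [A0 HA]] := @kills_path _ g r a r7.
- by rewrite g0E prodf_nonzero.
- by rewrite evg (leq_trans (size_prodf _)) // size_map size_iota.
- by rewrite g0E.
have ev : near0 (fun e : RR => rank_le (fun i => (A i).[e]) r).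
  have ev1 : near0 (fun e : RR => {in iota 0 r, forall j, (nth (0, 0) s j).2 + e != 0}).
    apply: near0_all => j _; set c := (nth _ _ _).2.
    have : c%:P + 'X != 0 :> {poly RR}.
      by rewrite -size_poly_eq0 addrC size_XaddC.
    by move=> /near0_neq0; apply: near0_imp => e _; rewrite !hornerE.
  have ev2 : near0 (fun e : RR => {in iota 0 r, forall i, {in iota 0 r, forall j,
      (i < j)%N -> indep (l e i) (l e j)}}).
    apply: near0_all => i _; apply: near0_all => j _.
    have [lt|nlt] := boolP (i < j)%N; last by exists 1; rewrite ?ltr01.
    set u := nth (0, 0) s i; set v := nth (0, 0) s j.
    pose p : {poly RR} := (i%:R - j%:R) *: 'X^2 +
      ((u.1 + i%:R * v.2 - u.2 * j%:R - v.1)%:P * 'X + (u.1 * v.2 - u.2 * v.1)%:P).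
    have p0 : p != 0.
      apply: contraTneq isT => p0; have : p`_2 = 0 by rewrite p0 coef0.
      rewrite /p !coefD coefZ coefXn coefCM coefX coefC /= mulr1 mulr0 !addr0.
      by move/eqP; rewrite subr_eq0 eqr_nat ltn_eqF.
    move: (near0_neq0 p0); apply: near0_imp => e e0; rewrite /p !hornerE => h _.
    apply: contraNneq h => h; rewrite -h /det2 /l /= -/u -/v; apply/eqP; ring.
  apply: near0_imp (near0_and ev1 ev2) => e e0 [h1 h2].
  apply: hyp_rank_le => //; exists [seq l e j | j <- iota 0 r]; split.
  - by rewrite size_map size_iota.
  - by move=> _ /mapP[j /h1 jn ->]; rewrite /l xpair_eqE (negbTE jn) andbF.
  - rewrite pairwise_map; have : pairwise ltn (iota 0 r).
      by rewrite -sorted_pairwise ?iota_ltn_sorted //; apply: ltn_trans.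
    by apply: (sub_in_pairwise (P := mem (iota 0 r))); [move=> i j hi hj /= lt; apply: h2|apply/allP].
  by rewrite -evg; apply: HA.
have -> : a = fun i => (A i).[0] by apply: functional_extensionality => i; rewrite A0.
exact: closure_path ev.
Qed.

(** Rank at most [r] is an open condition here, and smaller ranks are excluded nearby because
    [RR_forms r.-1] is closed. *)
Lemma Rint_intro r a : (0 < r <= 7)%N -> rank_le a r -> ~ killed_by (7 - r) a ->
  ~ RR_forms r.-1 a -> Rint r a.
Proof.
move=> /andP[r0 r7] H nk nf; apply: interior_seq => A cA.
have [N HN] := interior_cvg (rank_le_open r7 H nk) cA.
suff : exists n, (N <= n)%N /\ ~ RR_forms r.-1 (A n).
  move=> [n [/HN h nf']]; exists n; split=> // s hs; rewrite leqNgt; apply/negP => lt.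
  have lt' : (s <= r.-1)%N by rewrite -ltnS prednK.
  apply: nf'; apply: rank_le_forms (rank_le_mono lt' hs).
  exact: leq_trans (leq_pred r) r7.
apply: NNPP => H'; apply: nf; apply: (@RR_forms_closed _ (fun n => A (N + n)%N)).
  by move=> i; apply: (@cvgto_sub (fun n => A n i)) => // n; apply: leq_addl.
move=> n; apply: NNPP => nf; apply: H'; exists (N + n)%N; split=> //; exact: leq_addr.
Qed.

(** Points of rank at most [r] accumulate at [a]; the two negated conditions are complements of
    closed ones, hence hold at those points too. *)
Lemma closure_Rint r a : (0 < r <= 7)%N -> RR_forms r a -> ~ RR_forms r.-1 a ->
  ~ killed_by (7 - r) a -> closure (Rint r) a.
Proof.
move=> hr; have /andP[r0 r7] := hr => /(RR_forms_closure r7)/closureP[A [H cA]] nf nk.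
have [N HN] : exists N, forall n, (N <= n)%N -> ~ RR_forms r.-1 (A n) /\ ~ killed_by (7 - r) (A n).
  have I1 : interior (fun b => ~ RR_forms r.-1 b) a.
    apply: interior_seq => B cB; apply: NNPP => H'; apply: nf; apply: (RR_forms_closed cB) => n.
    by apply: NNPP => h; apply: H'; exists n.
  have I2 : interior (fun b => ~ killed_by (7 - r) b) a.
    apply: interior_seq => B cB; apply: NNPP => H'; apply: nk; apply: (killed_by_closed cB) => n.
    by apply: NNPP => h; apply: H'; exists n.
  have [N1 h1] := interior_cvg I1 cA; have [N2 h2] := interior_cvg I2 cA.
  exists (maxn N1 N2) => n; rewrite geq_max => /andP[/h1 p1 /h2 p2]; by split.
apply/closureP; exists (fun n => A (N + n)%N); split.
  by move=> n; have [h1 h2] := HN _ (leq_addr n N); apply: Rint_intro.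
by move=> i; apply: (@cvgto_sub (fun n => A n i)) => // n; apply: leq_addl.
Qed.

Lemma closure_Rint_rank r a : closure (Rint r) a -> closure (fun b => rank_le b r) a.
Proof.
move=> /closureP[A [H cA]]; apply/closureP; exists A; split=> // n.
by have [] := interior_sub (H n).
Qed.

Lemma topbd_not_interior r a : (0 < r <= 7)%N -> topbd (Rint r) a ->
  (RR_forms r a -> rank_le a r) -> ~ killed_by (7 - r) a -> RR_forms r.-1 a.
Proof.
move=> hr; have /andP[r0 r7] := hr => -[cl nI] key nk; apply: NNPP => nf; apply: nI.
have R : Rint r a.
  apply: Rint_intro => //; apply: key.
  exact: (closure_rank_le r7 (closure_Rint_rank cl)).
have [e [e0 He]] := interior_open R; exists e; split=> // b /He h.
by apply/closureP; exists (fun=> b); split=> // i; apply: cvgto_cst.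
Qed.

Lemma closure_Rint_lower r a : (0 < r <= 7)%N -> closure (Rint r) a ->
  rank_le a r.-1 -> ~ killed_by (7 - r.-1) a -> False.
Proof.
move=> /andP[r0 r7] /closureP[A [H cA]] h nk.
have r7' : (r.-1 <= 7)%N := leq_trans (leq_pred r) r7.
have [N HN] := interior_cvg (rank_le_open r7' h nk) cA.
have [_ /(_ _ (HN N (leqnn N)))] := interior_sub (H N).
by rewrite leqNgt prednK // leqnn.
Qed.

Lemma topbd_dual4 a : topbd (Rint 4) a -> dual_CRL [:: 3; 2; 2]%N (complexify a).
Proof.
move=> T; apply: NNPP => nd; have [h1 h2] := key4 nd; apply: h2.
exact: RR_forms_killed (@topbd_not_interior 4 a isT T h1 (proj2 (key4 nd))).
Qed.

(** Off the quintic walls a boundary point must be killed by four real linear forms. Off the quartic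
    wall it would then have rank at most four together with all its neighbours, which contradicts
    being a limit of interior points of rank five. Ranks six and seven follow the same pattern. *)
Lemma topbd_dual5 a : topbd (Rint 5) a -> [\/ dual_CRL [:: 3; 2; 2]%N (complexify a),
  dual_CRL [:: 4; 3]%N (complexify a) | dual_CRL [:: 5; 2]%N (complexify a)].
Proof.
move=> T; apply: NNPP => H.
have n1 : ~ dual_CRL [:: 3; 2; 2]%N (complexify a) by move=> h; apply: H; constructor 1.
have n2 : ~ dual_CRL [:: 4; 3]%N (complexify a) by move=> h; apply: H; constructor 2.
have n3 : ~ dual_CRL [:: 5; 2]%N (complexify a) by move=> h; apply: H; constructor 3.
have [h1 h2] := key5 n2 n3; have [h3 h4] := key4 n1.
have f4 := @topbd_not_interior 5 a isT T h1 h2.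
exact: (@closure_Rint_lower 5 a isT T.1 (h3 f4) h4).
Qed.

Lemma topbd_dual6 a : topbd (Rint 6) a -> [\/ dual_CRL [:: 4; 3]%N (complexify a),
  dual_CRL [:: 5; 2]%N (complexify a) | dual_CRL [:: 7]%N (complexify a)].
Proof.
move=> T; apply: NNPP => H.
have n1 : ~ dual_CRL [:: 4; 3]%N (complexify a) by move=> h; apply: H; constructor 1.
have n2 : ~ dual_CRL [:: 5; 2]%N (complexify a) by move=> h; apply: H; constructor 2.
have n3 : ~ dual_CRL [:: 7]%N (complexify a) by move=> h; apply: H; constructor 3.
have [h1 h2] := key6 n3; have [h3 h4] := key5 n1 n2.
have f5 := @topbd_not_interior 6 a isT T h1 h2.
exact: (@closure_Rint_lower 6 a isT T.1 (h3 f5) h4).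
Qed.

Lemma topbd_dual7 a : topbd (Rint 7) a -> dual_CRL [:: 7]%N (complexify a).
Proof.
move=> T; apply: NNPP => nd; have [h1 h2] := key6 nd.
have nk : ~ killed_by (7 - 7) a.
  move=> [q [q0 sq K]]; apply: h2; exists q; split=> //; first exact: leq_trans sq _.
  by have := @kills_mulr _ 0 1 a q 1 K; rewrite mulr1; apply; rewrite size_poly1.
have f6 := @topbd_not_interior 7 a isT T (fun _ => key7 a) nk.
exact: (@closure_Rint_lower 7 a isT T.1 (h1 f6) h2).
Qed.

End OpenConditions.

(** * Closedness of the dual varieties *)

Section Elimination.

Lemma polyfun_meval (P : {mpoly CC[8]}) : polyfun (fun z : 'I_8 -> CC => P.@[z]).
Proof.
apply: (polyfun_ext (F := fun z : 'I_8 -> CC =>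
  \sum_(m <- msupp P) P@_m * \prod_i z i ^+ m i)); first by move=> z; rewrite mevalE.
apply: polyfun_sum => m _; apply: polyfun_mul; first exact: polyfun_cst.
by apply: polyfun_prod => i _; apply: polyfun_exp; apply: polyfun_var.
Qed.

Lemma polyfun_mpoly (G : ('I_8 -> CC) -> CC) : polyfun G ->
  exists P : {mpoly CC[8]}, forall z, G z = P.@[z].
Proof.
elim=> [c|i|F1 F2 _ [P HP] _ [Q HQ]|F1 F2 _ [P HP] _ [Q HQ]|F1 F2 e _ [P HP]].
- by exists c%:MP => z; rewrite mevalC.
- by exists 'X_i => z; rewrite mevalXU.
- by exists (P + Q) => z; rewrite mevalD HP HQ.
- by exists (P * Q) => z; rewrite mevalM HP HQ.
by exists P => z; rewrite -e.
Qed.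

(* The Sylvester matrix of [Phi] and [Psi], read as forms of degrees [d] and [D]. *)
Definition sylv (K : comNzRingType) (d D : nat) (Phi Psi : {poly K}) : 'M[K]_(D + d) :=
  \matrix_(i, k) if split i is inl j then (Phi * 'X^j)`_k
                 else if split i is inr j then (Psi * 'X^j)`_k else 0.

(** The powers of a common zero form a null vector of the matrix; a common zero at infinity gives
    the last basis vector instead. *)
Lemma sylv_common (K : fieldType) d D (Phi Psi : {poly K}) : (0 < D + d)%N ->
  (size Phi <= d.+1)%N -> (size Psi <= D.+1)%N ->
  (exists x, Phi.[x] = 0 /\ Psi.[x] = 0) \/ (Phi`_d = 0 /\ Psi`_D = 0) ->
  \det (sylv d D Phi Psi) = 0.
Proof.
move=> pos sP sQ H; apply/eqP; rewrite -det_tr; apply/det0P.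
have small d' D' (f : {poly K}) (j : 'I_D') : (size f <= d'.+1)%N ->
    (size (f * 'X^j)%R <= D' + d')%N.
  move=> sf; apply: leq_trans (size_mul_leq3 sf (_ : size 'X^j <= j.+1)%N) _.
    by rewrite size_polyXn.
  by rewrite addSn addnS /= addnC -addSn leq_add2r.
case: H => [[x [h1 h2]]|[h1 h2]].
  exists (\row_k x ^+ k).
    apply/negP => /eqP/rowP/(_ (Ordinal pos)); rewrite !mxE expr0 => /eqP.
    by rewrite oner_eq0.
  apply/rowP => i; rewrite !mxE.
  have ev (f : {poly K}) : (size f <= D + d)%N -> \sum_(k < D + d) x ^+ k * f`_k = f.[x].
    move=> sf; rewrite (horner_coef_wide _ sf); apply: eq_bigr => k _; exact: mulrC.
  case: (split_ordP i) => j ->.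
    transitivity ((Phi * 'X^j).[x]); last by rewrite hornerM h1 mul0r.
    rewrite -ev ?small //; apply: eq_bigr => k _; rewrite !mxE.
    by rewrite (unsplitK (inl j : 'I_D + 'I_d)).
  transitivity ((Psi * 'X^j).[x]); last by rewrite hornerM h2 mul0r.
  rewrite -ev; last by rewrite addnC small.
  apply: eq_bigr => k _; rewrite !mxE.
  by rewrite (unsplitK (inr j : 'I_D + 'I_d)).
have lt : ((D + d).-1 < D + d)%N by rewrite ltn_predL.
exists (delta_mx 0 (Ordinal lt)).
  apply/negP => /eqP/rowP/(_ (Ordinal lt)); rewrite !mxE !eqxx => /eqP.
  by rewrite oner_eq0.
apply/rowP => i; rewrite -rowE !mxE.
have top d' (f : {poly K}) j : (size f <= d'.+1)%N -> f`_d' = 0 -> (j + d' <= (D + d).-1)%N ->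
    (f * 'X^j)`_(D + d).-1 = 0.
  move=> sf f0 le; rewrite coefMXn; case: ifP => // nlt.
  have [e|ne] := eqVneq ((D + d).-1 - j)%N d'; first by rewrite e.
  by rewrite nth_default // (leq_trans sf) // ltn_neqAle eq_sym ne; lia.
case: (split_ordP i) => j _ /=; [apply: (top d) => //|apply: (top D) => //].
  by have := ltn_ord j; lia.
by have := ltn_ord j; lia.
Qed.

(** A null row vector is a relation [A * Phi + B * Psi = 0] with [B] of smaller degree than [Phi];
    coprimality makes [Phi] divide [B], so both vanish. *)
Lemma sylv_coprime (K : fieldType) d D (Phi Psi : {poly K}) :
  size Phi = d.+1 -> (size Psi <= D.+1)%N -> coprimep Phi Psi ->
  \det (sylv d D Phi Psi) != 0.
Proof.
move=> sP sQ cop; apply/negP => /det0P[u u0 uS].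
pose A := \sum_(j < D) u 0 (lshift d j) *: 'X^j : {poly K}.
pose B := \sum_(j < d) u 0 (rshift D j) *: 'X^j : {poly K}.
have cX n (f : 'I_n -> K) (j : 'I_n) : (\sum_(i < n) f i *: 'X^i : {poly K})`_j = f j.
  rewrite coef_sum (bigD1 j) //= coefZ coefXn eqxx mulr1 big1 ?addr0 // => i.
  by rewrite -val_eqE eq_sym /= => /negbTE ne; rewrite coefZ coefXn ne mulr0.
have sX n (f : 'I_n -> K) : (size (\sum_(i < n) f i *: 'X^i : {poly K})%R <= n)%N.
  apply/leq_sizeP => j le; rewrite coef_sum big1 // => i _.
  by rewrite coefZ coefXn gtn_eqF ?mulr0 // (leq_trans (ltn_ord i)).
have E : A * Phi + B * Psi = 0.
  apply/polyP => k; rewrite coef0; have [lt|ge] := ltnP k (D + d); last first.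
    rewrite nth_default // (leq_trans _ ge) // (leq_trans (size_polyD _ _)) // geq_max.
    apply/andP; split.
      by apply: leq_trans (size_mul_leq3 (sX _ _) (eq_leq sP)) _; rewrite addnS.
    by apply: leq_trans (size_mul_leq3 (sX _ _) sQ) _; rewrite addnS addnC.
  have := congr1 (fun M : 'rV_(D + d) => M 0 (Ordinal lt)) uS; rewrite !mxE => E0.
  rewrite -[RHS]E0 big_split_ord coefD /=; congr (_ + _).
    rewrite /A mulr_suml coef_sum; apply: eq_bigr => j _.
    by rewrite -scalerAl coefZ mxE (unsplitK (inl j : 'I_D + 'I_d)) [_ * Phi]mulrC.
  rewrite /B mulr_suml coef_sum; apply: eq_bigr => j _.
  by rewrite -scalerAl coefZ mxE (unsplitK (inr j : 'I_D + 'I_d)) /= [_ * Psi]mulrC.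
have P0 : Phi != 0 by rewrite -size_poly_gt0 sP.
have B0 : B = 0.
  apply/eqP/negPn/negP => Bn0; have : Phi %| B.
    rewrite -(Gauss_dvdpl _ cop); apply/dvdpP; exists (- A).
    by rewrite mulNr; apply/eqP; rewrite -addr_eq0 addrC E.
  by move=> /(dvdp_leq Bn0); rewrite sP leqNgt ltnS sX.
have A0 : A = 0.
  by move/eqP: E; rewrite B0 mul0r addr0 mulf_eq0 (negbTE P0) orbF => /eqP.
case/negP: u0; apply/eqP/rowP => i; rewrite mxE; case: (split_ordP i) => j ->.
  by rewrite -(cX _ (fun j => u 0 (lshift d j))) -/A A0 coef0.
by rewrite -(cX _ (fun j => u 0 (rshift D j))) -/B B0 coef0.
Qed.

(** Elimination of one point of the projective line from several equations. One equation is kept,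
    all are combined with coefficients [c^i], and a suitable [c] avoids common zeros at [z]; the
    resultant of the two is the required function. *)
Lemma eliminate n (Fs : 'I_n -> ('I_8 -> CC) -> {poly CC}) (d : 'I_n -> nat) D z :
  (forall i, polyfun_coefs (Fs i)) -> (forall i w, (size (Fs i w) <= (d i).+1)%N) ->
  (forall i, (d i < D)%N) ->
  ~ ((exists x, forall i, (Fs i z).[x] = 0) \/ (forall i, (Fs i z)`_(d i) = 0)) ->
  exists2 G : ('I_8 -> CC) -> CC, polyfun G & G z != 0 /\
    forall w, (exists x, forall i, (Fs i w).[x] = 0) \/ (forall i, (Fs i w)`_(d i) = 0) -> G w = 0.
Proof.
move=> pF sF dD H.
have [i0 top0] : exists i0, (Fs i0 z)`_(d i0) != 0.
  apply: NNPP => h; apply: H; right => i; apply/eqP/negPn/negP => ne; apply: h.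
  by exists i.
pose Psi (c : CC) w : {poly CC} := \sum_(i < n) c ^+ i *: Fs i w.
have sPhi : size (Fs i0 z) = (d i0).+1.
  apply/eqP; rewrite eqn_leq sF ltnNge; apply/negP => /leq_sizeP/(_ _ (leqnn _)) E.
  by rewrite E eqxx in top0.
have sPsi c w : (size (Psi c w) <= D)%N.
  apply: (big_ind (fun q : {poly CC} => (size q <= D)%N)) => [|p q sp sq|i _].
  - by rewrite size_poly0.
  - by rewrite (leq_trans (size_polyD _ _)) // geq_max sp.
  by rewrite (leq_trans (size_scale_leq _ _)) // (leq_trans (sF _ _)).
have [r Er] := closed_field_poly_normal (Fs i0 z).
(* As a polynomial in [c], the product of the values of the combination at all zeros of
   [Fs i0 z]. *)
pose B := \prod_(x <- r) (\sum_(i < n) (Fs i z).[x] *: 'X^i) : {poly CC}.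
have B0 : B != 0.
  rewrite prodf_seq_neq0; apply/allP => x xr /=; apply/negP => /eqP E.
  apply: H; left; exists x => i; have := congr1 (fun p : {poly CC} => p`_i) E.
  rewrite coef0 coef_sum (bigD1 i) //= coefZ coefXn eqxx mulr1 big1 ?addr0 // => j.
  by rewrite -val_eqE eq_sym /= => /negbTE ne; rewrite coefZ coefXn ne mulr0.
have [c Bc] : exists c, B.[c] != 0.
  pose s := [seq k%:R : CC | k <- iota 0 (size B)].
  have us : uniq s.
    by rewrite map_inj_uniq ?iota_uniq // => i j /eqP; rewrite eqr_nat => /eqP.
  apply: NNPP => h; case/eqP: B0; apply: (@roots_geq_poly_eq0 _ _ s) => //; last first.
    by rewrite size_map size_iota.
  apply/allP => x _; apply/negPn/negP => nx; apply: h; by exists x.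
have cop : coprimep (Fs i0 z) (Psi c z).
  apply: Pdiv.ClosedField.root_coprimep => x; rewrite Er rootZ; last first.
    by rewrite lead_coef_eq0 -size_poly_gt0 sPhi.
  rewrite root_prod_XsubC => xr; apply: contraNneq Bc => E.
  rewrite /B (perm_big _ (perm_to_rem xr)) big_cons hornerM horner_sum.
  rewrite (_ : \sum_i _ = 0) ?mul0r // -[RHS]E /Psi horner_sum.
  by apply: eq_bigr => i _; rewrite !hornerZ hornerXn mulrC.
exists (fun w => \det (sylv (d i0) D (Fs i0 w) (Psi c w))).
  apply: polyfun_det => i k.
  have pX (Q : ('I_8 -> CC) -> {poly CC}) j : polyfun_coefs Q -> polyfun_coefs (fun w => Q w * 'X^j).
    by move=> pQ; apply: polyfun_coefs_mul => //; apply: polyfun_coefs_cst.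
  have pPsi : polyfun_coefs (Psi c).
    move=> m; apply: (polyfun_ext (F := fun w => \sum_(i < n) c ^+ i * (Fs i w)`_m)).
      by move=> w; rewrite coef_sum; apply: eq_bigr => j _; rewrite coefZ.
    by apply: polyfun_sum => j _; apply: polyfun_mul; [apply: polyfun_cst|apply: pF].
  case: (split_ordP i) => j ->.
    apply: polyfun_ext (pX _ j (pF i0) k) => w.
    by rewrite mxE (unsplitK (inl j : 'I_D + 'I__)).
  apply: polyfun_ext (pX _ j pPsi k) => w.
  by rewrite mxE (unsplitK (inr j : 'I_D + 'I__)).
split; first by apply: sylv_coprime => //; apply: leq_trans (sPsi _ _) _.
move=> w Hw; apply: sylv_common => //.
- by rewrite addn_gt0 (leq_ltn_trans (leq0n _) (dD i0)).
- exact: leq_trans (sPsi _ _) _.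
case: Hw => [[x Hx]|Ht]; [left; exists x|right]; split=> //.
  by rewrite /Psi horner_sum big1 // => i _; rewrite hornerZ Hx mulr0.
(* The combination has size at most [D], so as a form of degree [D] it always vanishes at
   infinity. *)
by rewrite nth_default.
Qed.

End Elimination.

(** * Homogeneous equations in the moments of a power *)

Section HomogeneousExpressions.

(* Reified polynomial expressions in [c_0, c_1, ...], to read off homogeneity. *)
Inductive hexpr := HV of nat | HAdd of hexpr & hexpr | HSub of hexpr & hexpr
  | HMul of hexpr & hexpr.

Fixpoint hev (K : comNzRingType) (c : nat -> K) e : K :=
  match e with
  | HV k => c k
  | HAdd a b => hev c a + hev c b
  | HSub a b => hev c a - hev c b
  | HMul a b => hev c a * hev c b
  end.

Fixpoint hdeg e : nat :=
  match e with HV _ => 1 | HAdd a _ | HSub a _ => hdeg a | HMul a b => hdeg a + hdeg b end.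

Fixpoint hwf e : bool :=
  match e with
  | HV _ => true
  | HAdd a b | HSub a b => [&& hwf a, hwf b & hdeg a == hdeg b]
  | HMul a b => hwf a && hwf b
  end.

Lemma eq_hev (K : comNzRingType) (c c' : nat -> K) e : c =1 c' -> hev c e = hev c' e.
Proof. by move=> E; elim: e => /= [k|a -> b ->|a -> b ->|a -> b ->]. Qed.

Lemma hev_scale (K : comNzRingType) (c : nat -> K) s e : hwf e ->
  hev (fun k => s * c k) e = s ^+ hdeg e * hev c e.
Proof.
elim: e => [k|a IHa b IHb|a IHa b IHb|a IHa b IHb] /=.
- by rewrite expr1.
- by case/and3P=> /IHa -> /IHb -> /eqP ->; rewrite mulrDr.
- by case/and3P=> /IHa -> /IHb -> /eqP ->; rewrite mulrBr.
by case/andP=> /IHa -> /IHb ->; rewrite exprD mulrACA.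
Qed.

Lemma hev_horner (K : comNzRingType) (c : nat -> {poly K}) x e :
  (hev c e).[x] = hev (fun k => (c k).[x]) e.
Proof.
by elim: e => //= [a <- b <-|a <- b <-|a <- b <-]; rewrite ?hornerD ?hornerN ?hornerM.
Qed.

Lemma hev_size (K : fieldType) (c : nat -> {poly K}) p e : hwf e ->
  (forall k, (size (c k) <= p.+1)%N) -> (size (hev c e) <= (p * hdeg e).+1)%N.
Proof.
move=> + sc; elim: e => [k|a IHa b IHb|a IHa b IHb|a IHa b IHb] /=.
- by rewrite muln1.
- case/and3P=> /IHa ha /IHb hb /eqP E; rewrite (leq_trans (size_polyD _ _)) // geq_max ha.
  by rewrite E.
- case/and3P=> /IHa ha /IHb hb /eqP E; rewrite (leq_trans (size_polyD _ _)) // geq_max ha.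
  by rewrite size_polyN E.
case/andP=> /IHa ha /IHb hb; apply: leq_trans (size_mul_leq3 ha hb) _.
by rewrite addnS /= addSn mulnDr.
Qed.

Lemma coef_top_mul (K : fieldType) (f g : {poly K}) m n : (size f <= m.+1)%N ->
  (size g <= n.+1)%N -> (f * g)`_(m + n) = f`_m * g`_n.
Proof.
move=> sf sg; have lt : (m < (m + n).+1)%N by rewrite ltnS leq_addr.
rewrite coefM (bigD1 (Ordinal lt)) //= addKn big1 ?addr0 // => i.
rewrite -val_eqE /= => ne; case: (ltngtP i m) ne => // h _.
  by rewrite (nth_default _ (_ : (size g <= m + n - i)%N)) ?mulr0 // (leq_trans sg) //; lia.
by rewrite (nth_default _ (_ : (size f <= i)%N)) ?mul0r // (leq_trans sf).
Qed.

Lemma hev_top (K : fieldType) (c : nat -> {poly K}) p e : hwf e ->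
  (forall k, (size (c k) <= p.+1)%N) ->
  (hev c e)`_(p * hdeg e) = hev (fun k => (c k)`_p) e.
Proof.
move=> + sc; elim: e => [k|a IHa b IHb|a IHa b IHb|a IHa b IHb] /=.
- by rewrite muln1.
- by case/and3P=> /IHa <- /IHb <- /eqP E; rewrite coefD E.
- by case/and3P=> /IHa <- /IHb <- /eqP E; rewrite coefB E.
case/andP=> wa wb; rewrite -IHa // -IHb // mulnDr coef_top_mul //; exact: hev_size.
Qed.

Lemma hev_polyfun (K : fieldType) I (c : nat -> (I -> K) -> {poly K}) e :
  (forall k, polyfun_coefs (c k)) -> polyfun_coefs (fun x => hev (c^~ x) e).
Proof.
move=> pc; elim: e => [k|a IHa b IHb|a IHa b IHb|a IHa b IHb] /=.
- exact: pc.
- exact: polyfun_coefs_add.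
- move=> k; apply: (polyfun_ext _ (polyfun_sub (IHa k) (IHb k))) => x.
  by rewrite coefB.
exact: polyfun_coefs_mul.
Qed.

(** The moment of [lf (1, x) ^+ p] as a polynomial in [x], by [cmom_horner]; its coefficient of
    degree [p] is the moment at the remaining point [(0, 1)]. *)
Definition cmom (p k : nat) (z : 'I_8 -> CC) : {poly CC} :=
  \sum_(i < p.+1) (Lf z 'X^(i + k) *+ 'C(p, i)) *: 'X^i.

Lemma size_cmom p k z : (size (cmom p k z) <= p.+1)%N.
Proof.
apply/leq_sizeP => j le; rewrite coef_sum big1 // => i _.
by rewrite coefZ coefXn gtn_eqF ?mulr0 // (leq_trans (ltn_ord i)).
Qed.

Lemma cmom_horner p k z x : (cmom p k z).[x] = Lf z (lf (1, x) ^+ p * 'X^k).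
Proof.
rewrite /cmom horner_sum /lf /= exprDn mulr_suml Lf_sum; apply: eq_bigr => i _.
rewrite hornerZ hornerXn expr1n mul1r exprZn.
have -> : (x ^+ i *: 'X^i) *+ 'C(p, i) * 'X^k = (x ^+ i *+ 'C(p, i)) *: 'X^(i + k).
  by rewrite scalerMnl -scalerAl exprD.
by rewrite LfZ mulrnAl mulrnAl mulrC.
Qed.

Lemma cmom_top p k z : (cmom p k z)`_p = Lf z (lf (0, 1) ^+ p * 'X^k).
Proof.
rewrite /lf /= scale1r add0r -exprD /cmom coef_sum big_ord_recr /= coefZ coefXn eqxx mulr1.
rewrite binn big1 ?add0r // => i _.
by rewrite coefZ coefXn gtn_eqF ?mulr0.
Qed.

Lemma polyfun_cmom p k : polyfun_coefs (cmom p k).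
Proof.
move=> j; apply: (polyfun_ext (F := fun z : 'I_8 -> CC =>
  \sum_(i < p.+1) Lf z ('X^(i + k) *+ 'C(p, i)) * ('X^i)`_j)) => [z|].
  rewrite coef_sum; apply: eq_bigr => i _; rewrite coefZ; congr (_ * _).
  by elim: 'C(p, i) => [|n IH]; rewrite ?mulr0n ?Lf0 // !mulrS LfD IH.
apply: polyfun_sum => i _; apply: polyfun_mul; last exact: polyfun_cst.
apply: (polyfun_Lf (A := fun i z => z i)) => [m|]; first exact: polyfun_var.
exact: polyfun_coefs_cst.
Qed.

Lemma In_nth es i : (i < size es)%N -> List.In (nth (HV 0) es i) es.
Proof.
elim: es i => // e es IH [|i] lt /=; [by left|right; exact: IH].
Qed.

Lemma nth_In es e : List.In e es -> exists2 i, (i < size es)%N & nth (HV 0) es i = e.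
Proof.
elim: es => //= e' es IH [->|/IH[i lt E]]; first by exists 0%N.
by exists i.+1.
Qed.

(** In the chart [l = (1, x)] each homogeneous equation becomes a polynomial in [x] of formal degree
    [p * hdeg e], and the point [(0, 1)] corresponds to the vanishing of all top coefficients. *)
Lemma eliminate_linear_form p (es : seq hexpr) z : all hwf es ->
  ~ (exists2 l : CC * CC, l != (0, 0) &
      forall e, List.In e es -> hev (fun k => Lf z (lf l ^+ p * 'X^k)) e = 0) ->
  exists2 G : ('I_8 -> CC) -> CC, polyfun G & G z != 0 /\
    forall w, (exists2 l : CC * CC, l != (0, 0) &
      forall e, List.In e es -> hev (fun k => Lf w (lf l ^+ p * 'X^k)) e = 0) -> G w = 0.
Proof.
move=> wfs H; pose E i := nth (HV 0) es i.
have wE (i : 'I_(size es)) : hwf (E i).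
  by have /(all_nthP (HV 0))/(_ i (ltn_ord i)) := wfs.
have mE (i : 'I_(size es)) : List.In (E i) es by apply: In_nth.
pose Fs (i : 'I_(size es)) w : {poly CC} := hev (cmom p ^~ w) (E i).
have equiv w : (exists2 l : CC * CC, l != (0, 0) &
      forall e, List.In e es -> hev (fun k => Lf w (lf l ^+ p * 'X^k)) e = 0) <->
    ((exists x, forall i, (Fs i w).[x] = 0) \/ (forall i, (Fs i w)`_(p * hdeg (E i)) = 0)).
  split=> [[[u v] l0 Hl]|[[x Hx]|Ht]].
  - have [u0|u0] := eqVneq u 0.
      right=> i; rewrite /Fs hev_top //; last by move=> k; apply: size_cmom.
      have v0 : v != 0 by move: l0; rewrite u0 xpair_eqE eqxx.
      have Ec k : v ^+ p * (cmom p k w)`_p = Lf w (lf (u, v) ^+ p * 'X^k).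
        rewrite cmom_top -LfZ scalerAl -exprZn u0; congr (Lf w (_ ^+ _ * _)).
        by rewrite /lf /= polyC0 !add0r scale1r.
      have := Hl _ (mE i); rewrite -(eq_hev _ Ec) hev_scale // => /eqP.
      by rewrite mulf_eq0 !expf_eq0 (negbTE v0) !andbF => /eqP.
    left; exists (v / u) => i; rewrite /Fs hev_horner.
    have Ec k : u ^+ p * (cmom p k w).[v / u] = Lf w (lf (u, v) ^+ p * 'X^k).
      rewrite cmom_horner -LfZ scalerAl -exprZn; congr (Lf w (_ ^+ _ * _)).
      by rewrite /lf /= scalerDr scalerA mulrCA divff // mulr1 -mul_polyC -polyCM mulr1.
    have := Hl _ (mE i); rewrite -(eq_hev _ Ec) hev_scale // => /eqP.
    by rewrite mulf_eq0 !expf_eq0 (negbTE u0) !andbF => /eqP.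
  - exists (1, x); first by rewrite xpair_eqE oner_eq0.
    move=> e /nth_In[i lt <-]; rewrite -[RHS](Hx (Ordinal lt)) /Fs hev_horner.
    by apply: eq_hev => k; rewrite cmom_horner.
  exists (0, 1); first by rewrite xpair_eqE oner_eq0 andbF.
  move=> e /nth_In[i lt <-]; rewrite -[RHS](Ht (Ordinal lt)) /Fs hev_top //.
    by apply: eq_hev => k; rewrite cmom_top.
  by move=> k; apply: size_cmom.
have [D HD] : exists D, forall i : 'I_(size es), (p * hdeg (E i) < D)%N.
  exists (\max_(i < size es) (p * hdeg (E i))).+1 => i; rewrite ltnS.
  exact: (leq_bigmax i).
have [| | |G pG [G0 GX]] := @eliminate _ Fs (fun i => p * hdeg (E i))%N D z _ _ HD.
- by move=> i; apply: hev_polyfun => k; apply: polyfun_cmom.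
- by move=> i w; apply: hev_size => // k; apply: size_cmom.
- by move=> h; apply: H; apply/equiv.
by exists G => //; split=> // w /equiv; apply: GX.
Qed.

End HomogeneousExpressions.

(** * Equations for each dual variety *)

Section Closed.
Implicit Types (z : 'I_8 -> CC) (l m : CC * CC).

Lemma killsE (F : fieldType) e (a : 'I_8 -> F) g :
  kills e a g <-> forall k, (k < 8 - e)%N -> Lf a (g * 'X^k) = 0.
Proof. by split=> [K k lt|H]; [apply: kills_Xn K lt|apply: kills_monomials]. Qed.

(** Zariski closedness, put pointwise so that a single resultant suffices at each outside point. *)
Definition closed_fun (D : ('I_8 -> CC) -> Prop) := forall z, ~ D z ->
  exists2 G : ('I_8 -> CC) -> CC, polyfun G & G z != 0 /\ forall w, D w -> G w = 0.

Lemma closed_funU D D' : closed_fun D -> closed_fun D' -> closed_fun (fun z => D z \/ D' z).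
Proof.
move=> h h' z nz; have [G pG [G0 Gv]] := h z (fun H => nz (or_introl H)).
have [G' pG' [G0' Gv']] := h' z (fun H => nz (or_intror H)).
exists (fun w => G w * G' w); first exact: polyfun_mul.
by split=> [|w [/Gv ->|/Gv' ->]]; rewrite ?mulf_neq0 ?mul0r ?mulr0.
Qed.

Lemma closed_linear_form p es (D : ('I_8 -> CC) -> Prop) : all hwf es ->
  (forall z, D z <-> exists2 l : CC * CC, l != (0, 0) &
    forall e, List.In e es -> hev (moments z (lf l ^+ p)) e = 0) -> closed_fun D.
Proof.
move=> wfs E z nz; have [|G pG [G0 GX]] := eliminate_linear_form (p := p) wfs (z := z).
  by move=> h; apply: nz; apply/E.
by exists G => //; split=> // w /E; apply: GX.
Qed.

Lemma dual7_closed : closed_fun (dual_CRL [:: 7]%N).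
Proof.
apply: (@closed_linear_form 6 [:: HV 0; HV 1]) => // z; rewrite dual7P.
split=> -[l l0]; [move=> /killsE K|move=> H]; exists l => //.
  by move=> e [<-|[<-|[]]] /=; apply: K.
by apply/killsE => -[|[|//]] _; [apply: (H (HV 0)); left|apply: (H (HV 1)); right; left].
Qed.

(** The hypothesis makes a Hankel matrix with two rows of rank at most one; a non-zero entry and its
    neighbour give the kernel. *)
Lemma pencil_root (K : fieldType) (c : nat -> K) n :
  (forall i j, (i < j)%N -> (j <= n)%N -> c i * c j.+1 = c i.+1 * c j) ->
  exists2 m : K * K, m != (0, 0) & forall k, (k <= n)%N -> m.1 * c k + m.2 * c k.+1 = 0.
Proof.
move=> H; case: (pickP (fun i : 'I_n.+2 => c i != 0)) => [i ci|c0]; last first.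
  exists (1, 0) => [|k le]; first by rewrite xpair_eqE oner_eq0.
  rewrite /= mul0r addr0 mul1r; apply/eqP/negPn.
  by have /negbT := c0 (inord k); rewrite inordK // ltnS (leq_trans le).
have cross k j : (k <= n)%N -> (j <= n)%N -> c k * c j.+1 = c k.+1 * c j.
  move=> hk hj; case: (ltngtP k j) => [lt|lt|->]; [exact: H| |exact: mulrC].
  by rewrite [RHS]mulrC (H j k) // mulrC.
case: i ci => -[|i] lt /= ci.
  exists (c 1, - c 0) => [|k le]; first by rewrite xpair_eqE oppr_eq0 (negbTE ci) andbF.
  by rewrite /= mulNr -cross // mulrC subrr.
exists (c i.+1, - c i) => [|k le]; first by rewrite xpair_eqE (negbTE ci).
by rewrite /= mulNr -cross // 1?mulrC ?subrr.
Qed.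

Lemma pencil_minor (K : fieldType) (c : nat -> K) (m : K * K) i j : m != (0, 0) ->
  m.1 * c i + m.2 * c i.+1 = 0 -> m.1 * c j + m.2 * c j.+1 = 0 ->
  c i * c j.+1 - c i.+1 * c j = 0.
Proof.
case: m => m1 m2 /= m0 hi hj.
have e1 : m1 * (c i * c j.+1 - c i.+1 * c j) =
    (m1 * c i + m2 * c i.+1) * c j.+1 - (m1 * c j + m2 * c j.+1) * c i.+1 by ring.
have e2 : m2 * (c i * c j.+1 - c i.+1 * c j) =
    (m1 * c j + m2 * c j.+1) * c i - (m1 * c i + m2 * c i.+1) * c j by ring.
move: e1 e2; rewrite hi hj !mul0r subrr => /eqP; rewrite mulf_eq0 => /orP[/eqP u0|/eqP -> //].
by move=> /eqP; rewrite mulf_eq0 => /orP[/eqP v0|/eqP -> //]; rewrite u0 v0 eqxx in m0.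
Qed.

Lemma dual52P z : dual_CRL [:: 5; 2]%N z <-> exists2 l, l != (0, 0) &
  exists2 m, m != (0, 0) & forall k, (k < 3)%N ->
    m.1 * moments z (lf l ^+ 4) k + m.2 * moments z (lf l ^+ 4) k.+1 = 0.
Proof.
rewrite (@dual2P z 4 1) //; split=> [[l [m [l0 m0 /killsE K]]]|[l l0 [m m0 H]]].
  exists l => //; exists m => // k lt; rewrite moments_lf mulrC -[lf m]expr1; exact: K.
exists l, m; split=> //; apply/killsE => k lt.
by have := H k lt; rewrite moments_lf mulrC expr1.
Qed.

(** Once [l] is a parameter, the existence of [m] is the vanishing of the two by two minors of the
    moments of [l^4]. *)
Lemma dual52_closed : closed_fun (dual_CRL [:: 5; 2]%N).
Proof.
pose mi i j := HSub (HMul (HV i) (HV j.+1)) (HMul (HV i.+1) (HV j)).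
apply: (@closed_linear_form 4 [:: mi 0 1; mi 0 2; mi 1 2]) => // z.
rewrite dual52P; split=> -[l l0 H]; exists l => //; set c := moments z _ in H *.
  case: H => m m0 H e.
  suff mi0 i j : (i < 3)%N -> (j < 3)%N -> hev c (mi i j) = 0.
    by move=> [<-|[<-|[<-|[]]]]; apply: mi0.
  by move=> hi hj; apply: (pencil_minor m0); apply: H.
have [i j ij j2|m m0 Hm] := @pencil_root _ c 2; last by exists m.
apply/eqP; rewrite -subr_eq0; apply/eqP; apply: (H (mi i j)).
by case: i j ij j2 => [|[|i]] [|[|[|j]]] // _ _ /=; tauto.
Qed.

Lemma moments_quadratic (F : fieldType) (a : 'I_8 -> F) (g q : {poly F}) k : (size q <= 3)%N ->
  Lf a (g * q * 'X^k) =
  q`_0 * moments a g k + q`_1 * moments a g k.+1 + q`_2 * moments a g k.+2.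
Proof.
move=> /poly_sumX ->; rewrite !big_ord_recl big_ord0 addr0 /= /moments.
rewrite !coefD !coefZ !coefXn /= ?mulr0 ?mulr1 ?addr0 ?add0r.
rewrite !mulrDr !mulrDl !LfD -!scalerAr -!scalerAl !LfZ -!mulrA -!exprD /bump /= !add0n.
by rewrite !addn0 !addn1 !add1n addrA.
Qed.

Lemma dual43P z : dual_CRL [:: 4; 3]%N z <-> exists2 l, l != (0, 0) &
  exists2 m, m != (0, 0) & forall k, (k < 3)%N -> let c := moments z (lf l ^+ 3) in
    m.1 ^+ 2 * c k + 2 * m.1 * m.2 * c k.+1 + m.2 ^+ 2 * c k.+2 = 0.
Proof.
have sq2 m : (size (lf m ^+ 2)%R <= 3)%N.
  by rewrite expr2; apply: (size_mul_leq3 (size_lf m) (size_lf m)).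
have E l m k : Lf z (lf l ^+ 3 * lf m ^+ 2 * 'X^k) =
    m.1 ^+ 2 * moments z (lf l ^+ 3) k + 2 * m.1 * m.2 * moments z (lf l ^+ 3) k.+1 +
    m.2 ^+ 2 * moments z (lf l ^+ 3) k.+2.
  rewrite moments_quadratic // expr2 !coefM !big_ord_recr big_ord0 /= !coef_lf.
  by rewrite /= !big_ord0 ?subSS ?subn0 /=; ring.
rewrite (@dual2P z 3 2) //; split=> [[l [m [l0 m0 /killsE K]]]|[l l0 [m m0 H]]].
  by exists l => //; exists m => // k lt; apply: etrans (K k lt); apply: esym; apply: E.
by exists l, m; split=> //; apply/killsE => k lt; apply: etrans (E l m k) _; apply: H.
Qed.

Lemma dual322Q z : dual_CRL [:: 3; 2; 2]%N z <-> exists2 l, l != (0, 0) &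
  exists2 q : {poly CC}, q != 0 /\ (size q <= 3)%N & forall k, (k < 4)%N ->
    let c := moments z (lf l ^+ 2) in q`_0 * c k + q`_1 * c k.+1 + q`_2 * c k.+2 = 0.
Proof.
rewrite dual322P'; split=> [[l [q [l0 q0 sq /killsE K]]]|[l l0 [q [q0 sq] H]]].
  by exists l => //; exists q => // k lt; apply: etrans (K k lt); apply/esym/moments_quadratic.
by exists l, q; split=> //; apply/killsE => k lt; apply: etrans (moments_quadratic _ _ _ sq) _; apply: H.
Qed.

(** The [b] are the cofactors of the three by three Hankel matrix of [c], and [disc] is the
    discriminant of a quadratic form. In rank two a non-zero row of the adjugate spans the kernel,
    and it is a square exactly when its discriminant vanishes; in rank at most one all cofactors
    vanish and [pencil_root] gives a linear form whose square lies in the kernel. *)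
Lemma hankel_square (K : fieldType) (c : nat -> K) (sqK : forall x : K, exists y, y ^+ 2 = x)
    (b0 := c 2 * c 4 - c 3 * c 3) (b1 := c 2 * c 3 - c 1 * c 4)
    (b2 := c 1 * c 3 - c 2 * c 2) (b3 := c 0 * c 4 - c 2 * c 2)
    (b4 := c 1 * c 2 - c 0 * c 3) (b5 := c 0 * c 2 - c 1 * c 1)
    (disc := fun x y w => y * y - (x * w + x * w + (x * w + x * w))) :
  (exists2 m : K * K, m != (0, 0) & forall k, (k < 3)%N ->
     m.1 ^+ 2 * c k + 2 * m.1 * m.2 * c k.+1 + m.2 ^+ 2 * c k.+2 = 0) <->
  c 0 * b0 + (c 1 * b1 + c 2 * b2) = 0 /\
    [/\ disc b0 b1 b2 = 0, disc b1 b3 b4 = 0 & disc b2 b4 b5 = 0].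
Proof.
split=> [[[m1 m2] m0 /= H]|[hdt [d0 d1 d2]]].
  have [h0 [h1 h2]] := (H 0 isT, (H 1 isT, H 2 isT)).
  have [m10|m1n] := eqVneq m1 0.
    have m2n : m2 ^+ 2 != 0.
      by rewrite expf_eq0 /=; move: m0; rewrite m10 xpair_eqE eqxx.
    have red x y w : m1 ^+ 2 * x + 2 * m1 * m2 * y + m2 ^+ 2 * w = 0 -> w = 0.
      rewrite m10 expr0n mul0r mulr0 !mul0r !add0r => /eqP.
      by rewrite mulf_eq0 (negbTE m2n) => /eqP.
    have [c2 [c3 c4]] := (red _ _ _ h0, (red _ _ _ h1, red _ _ _ h2)).
    by rewrite /disc /b0 /b1 /b2 /b3 /b4 /b5 c2 c3 c4; split; [|split]; ring.
  pose t := m2 / m1.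
  have red x y w : m1 ^+ 2 * x + 2 * m1 * m2 * y + m2 ^+ 2 * w = 0 ->
      x = - 2 * t * y - t ^+ 2 * w.
    move=> E; apply: (mulfI (_ : m1 ^+ 2 != 0)); first by rewrite expf_eq0.
    apply/eqP; rewrite -subr_eq0 -[X in _ == X]E; apply/eqP; rewrite /t; field.
    exact: m1n.
  move: (red _ _ _ h0) (red _ _ _ h1) (red _ _ _ h2) => c0 c1 c2.
  by rewrite /disc /b0 /b1 /b2 /b3 /b4 /b5 c0 c1 c2; split; [|split]; ring.
have root x y w : disc x y w = 0 -> (x, y, w) != (0, 0, 0) ->
    (forall k, (k < 3)%N -> x * c k + y * c k.+1 + w * c k.+2 = 0) ->
    exists2 m : K * K, m != (0, 0) & forall k, (k < 3)%N ->
      m.1 ^+ 2 * c k + 2 * m.1 * m.2 * c k.+1 + m.2 ^+ 2 * c k.+2 = 0.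
  move=> D nz H; have [s Es] := sqK x; have [t Et] := sqK w.
  have nst (s' t' : K) : s' ^+ 2 = x -> t' ^+ 2 = w -> y = 2 * s' * t' -> (s', t') != (0, 0).
    move=> ex ew ey; apply: contraNneq nz => -[e1 e2].
    by rewrite -ex -ew ey e1 e2 mulr0 expr0n.
  have /eqP : (y - 2 * s * t) * (y + 2 * s * t) = 0 by rewrite -[RHS]D -Es -Et /disc; ring.
  rewrite mulf_eq0 subr_eq0 addr_eq0 => /orP[] /eqP ey.
    by exists (s, t); [exact: nst|move=> k lt; rewrite /= Es Et -ey H].
  have ey' : y = 2 * s * (- t) by rewrite mulrN.
  by exists (s, - t); [apply: nst; rewrite ?sqrrN|move=> k lt; rewrite /= sqrrN Es Et -ey' H].
have [z0|nz0] := eqVneq (b0, b1, b2) (0, 0, 0); last first.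
  apply: (root _ _ _ d0 nz0).
  by case=> [|[|[|//]]] _ /=; [rewrite -[RHS]hdt| |]; rewrite /b0 /b1 /b2; ring.
have [z1|nz1] := eqVneq (b1, b3, b4) (0, 0, 0); last first.
  apply: (root _ _ _ d1 nz1).
  case=> [|[|[|//]]] _ /=; [|rewrite -[RHS]hdt|]; rewrite /b0 /b1 /b2 /b3 /b4; ring.
have [z2|nz2] := eqVneq (b2, b4, b5) (0, 0, 0); last first.
  apply: (root _ _ _ d2 nz2).
  case=> [|[|[|//]]] _ /=; [| |rewrite -[RHS]hdt]; rewrite /b0 /b1 /b2 /b4 /b5; ring.
case: z0 z1 z2 => e0 e1 e2 [_ e3 e4] [_ _ e5].
have [i j ij j3|m m0 Hm] := @pencil_root _ c 3; last first.
  exists m => // k lt.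
  have h1 := Hm k (ltnW lt); have h2 := Hm k.+1 lt.
  transitivity (m.1 * (m.1 * c k + m.2 * c k.+1) + m.2 * (m.1 * c k.+1 + m.2 * c k.+2)).
    by ring.
  by rewrite h1 h2 !mulr0 addr0.
apply/eqP; rewrite -subr_eq0; apply/eqP.
case: i j ij j3 => [|[|[|i]]] [|[|[|[|j]]]] // _ _.
- by have := congr1 -%R e4; rewrite oppr0 opprB.
- have := congr2 (fun x y => x - y) e3 e2; rewrite subrr => /(etrans _); apply.
  by rewrite /b2 /b3; ring.
by have := congr1 -%R e1; rewrite oppr0 opprB.
Qed.

Lemma dual43_closed : closed_fun (dual_CRL [:: 4; 3]%N).
Proof.
pose mi i j i' j' := HSub (HMul (HV i) (HV j)) (HMul (HV i') (HV j')).
pose b0 := mi 2 4 3 3. pose b1 := mi 2 3 1 4. pose b2 := mi 1 3 2 2.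
pose b3 := mi 0 4 2 2. pose b4 := mi 1 2 0 3. pose b5 := mi 0 2 1 1.
(* The factor 4 of the discriminant is written as a sum, expressions having no constants. *)
pose four e := HAdd (HAdd e e) (HAdd e e).
pose disc x y w := HSub (HMul y y) (four (HMul x w)).
pose dt := HAdd (HMul (HV 0) b0) (HAdd (HMul (HV 1) b1) (HMul (HV 2) b2)).
have sqC (x : CC) : exists y, y ^+ 2 = x by exists (sqrtC x); rewrite sqrtCK.
apply: (@closed_linear_form 3 [:: dt; disc b0 b1 b2; disc b1 b3 b4; disc b2 b4 b5]) => // z.
rewrite dual43P; split=> -[l l0 H]; exists l => //.
  case: (proj1 (hankel_square _ sqC) H) => h [h0 h1 h2] e.
  by move=> [<-|[<-|[<-|[<-|[]]]]]; [exact: h|exact: h0|exact: h1|exact: h2].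
apply/(hankel_square _ sqC).
by split; [|split]; [apply: (H dt)|apply: (H (disc b0 b1 b2))|
  apply: (H (disc b1 b3 b4))|apply: (H (disc b2 b4 b5))] => /=; tauto.
Qed.

(** The equations are the maximal minors of a Hankel matrix with three columns. Conversely a kernel
    vector is the cross product of two independent rows, or is orthogonal to the only row up to
    scalars, or is arbitrary. *)
Lemma hankel_kernel (K : fieldType) (c : nat -> K) :
  (exists2 q : {poly K}, q != 0 /\ (size q <= 3)%N &
    forall k, (k < 4)%N -> q`_0 * c k + q`_1 * c k.+1 + q`_2 * c k.+2 = 0) <->
  (forall i j k, (i < 4)%N -> (j < 4)%N -> (k < 4)%N ->
    c i * (c j.+1 * c k.+2 - c j.+2 * c k.+1) - c i.+1 * (c j * c k.+2 - c j.+2 * c k) +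
    c i.+2 * (c j * c k.+1 - c j.+1 * c k) = 0).
Proof.
split=> [[q [q0 sq] H] i j k hi hj hk|H].
  set D := (X in X = 0); apply/eqP/negPn/negP => D0; case/eqP: q0.
  have [h1 [h2 h3]] := (H i hi, (H j hj, H k hk)).
  have z0 : q`_0 = 0.
    apply: (mulIf D0); rewrite mul0r.
    transitivity ((q`_0 * c i + q`_1 * c i.+1 + q`_2 * c i.+2) * (c j.+1 * c k.+2 - c j.+2 * c k.+1)
     - (q`_0 * c j + q`_1 * c j.+1 + q`_2 * c j.+2) * (c i.+1 * c k.+2 - c i.+2 * c k.+1)
     + (q`_0 * c k + q`_1 * c k.+1 + q`_2 * c k.+2) * (c i.+1 * c j.+2 - c i.+2 * c j.+1)).
      by rewrite /D; ring.
    by rewrite h1 h2 h3 !mul0r subrr addr0.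
  have z1 : q`_1 = 0.
    apply: (mulIf D0); rewrite mul0r.
    transitivity (- (q`_0 * c i + q`_1 * c i.+1 + q`_2 * c i.+2) * (c j * c k.+2 - c j.+2 * c k)
     + (q`_0 * c j + q`_1 * c j.+1 + q`_2 * c j.+2) * (c i * c k.+2 - c i.+2 * c k)
     - (q`_0 * c k + q`_1 * c k.+1 + q`_2 * c k.+2) * (c i * c j.+2 - c i.+2 * c j)).
      by rewrite /D; ring.
    by rewrite h1 h2 h3 oppr0 !mul0r !addr0 subr0.
  have z2 : q`_2 = 0.
    apply: (mulIf D0); rewrite mul0r.
    transitivity ((q`_0 * c i + q`_1 * c i.+1 + q`_2 * c i.+2) * (c j * c k.+1 - c j.+1 * c k)
     - (q`_0 * c j + q`_1 * c j.+1 + q`_2 * c j.+2) * (c i * c k.+1 - c i.+1 * c k)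
     + (q`_0 * c k + q`_1 * c k.+1 + q`_2 * c k.+2) * (c i * c j.+1 - c i.+1 * c j)).
      by rewrite /D; ring.
    by rewrite h1 h2 h3 !mul0r subrr addr0.
  apply/polyP => -[|[|[|n]]]; rewrite coef0 //.
  by rewrite nth_default // (leq_trans sq).
have mk (v : K * K * K) : v != (0, 0, 0) ->
    (forall k, (k < 4)%N -> v.1.1 * c k + v.1.2 * c k.+1 + v.2 * c k.+2 = 0) ->
    exists2 q : {poly K}, q != 0 /\ (size q <= 3)%N &
    forall k, (k < 4)%N -> q`_0 * c k + q`_1 * c k.+1 + q`_2 * c k.+2 = 0.
  case: v => -[v0 v1] v2 nz Kv; exists (Poly [:: v0; v1; v2]); last first.
    by move=> k lt; rewrite !coef_Poly; apply: Kv.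
  split; last exact: size_Poly.
  apply: contraNneq nz => /polyP E.
  by move: (E 0) (E 1) (E 2); rewrite !coef_Poly !coef0 /= => -> -> ->.
pose w (i : 'I_4 * 'I_4) := (c i.1.+1 * c i.2.+2 - c i.1.+2 * c i.2.+1,
  c i.1.+2 * c i.2 - c i.1 * c i.2.+2, c i.1 * c i.2.+1 - c i.1.+1 * c i.2).
case: (pickP (fun i => w i != (0, 0, 0))) => [i nz|w0].
  apply: (mk _ nz) => k lt; rewrite -[RHS](H k i.1 i.2) //=; ring.
have E (i j : nat) : (i < 4)%N -> (j < 4)%N -> c i * c j.+1 = c i.+1 * c j.
  move=> hi hj; have /negbFE := w0 (Ordinal hi, Ordinal hj).
  by rewrite /w /= !xpair_eqE !subr_eq0 => /andP[_ /eqP].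
case: (pickP (fun i : 'I_4 => (c i, c i.+1) != (0, 0))) => [i nz|c0].
  apply: (mk (c i.+1, - c i, 0)) => [|k lt].
    by move: nz; rewrite !xpair_eqE oppr_eq0 eqxx andbT andbC.
  by rewrite /= mul0r addr0 mulNr E // subrr.
apply: (mk (1, 0, 0)) => [|k lt]; first by rewrite !xpair_eqE oner_eq0.
have /negbFE := c0 (Ordinal lt); rewrite xpair_eqE => /andP[/eqP ck _].
by rewrite /= ck !mul0r mulr0 !addr0.
Qed.

Lemma dual322_closed : closed_fun (dual_CRL [:: 3; 2; 2]%N).
Proof.
pose mi i j i' j' := HSub (HMul (HV i) (HV j)) (HMul (HV i') (HV j')).
pose d3 i j k := HAdd (HSub (HMul (HV i) (mi j.+1 k.+2 j.+2 k.+1))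
  (HMul (HV i.+1) (mi j k.+2 j.+2 k))) (HMul (HV i.+2) (mi j k.+1 j.+1 k)).
apply: (@closed_linear_form 2 (List.flat_map (fun i => List.flat_map (fun j =>
  List.map (d3 i j) (iota 0 4)) (iota 0 4)) (iota 0 4))) => // z.
rewrite dual322Q; split=> -[l l0 H]; exists l => //.
  move/hankel_kernel: H => H e.
  move=> /List.in_flat_map[i [hi /List.in_flat_map[j [hj /List.in_map_iff[k [<- hk]]]]]].
  have lt4 n : List.In n (iota 0 4) -> (n < 4)%N by move=> /= [<-|[<-|[<-|[<-|[]]]]].
  by apply: (H i j k); apply: lt4.
apply/hankel_kernel => i j k hi hj hk; apply: (H (d3 i j k)).
have in4 n : (n < 4)%N -> List.In n (iota 0 4) by case: n => [|[|[|[|]]]] //=; tauto.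
apply/List.in_flat_map; exists i; split; first exact: in4.
apply/List.in_flat_map; exists j; split; first exact: in4.
by apply/List.in_map_iff; exists k; split; [|exact: in4].
Qed.

End Closed.

(** * Density *)

Section Density.

Lemma polyfun_path (F : fieldType) I (G : (I -> F) -> F) (A : I -> {poly F}) : polyfun G ->
  exists p : {poly F}, forall s, G (fun i => (A i).[s]) = p.[s].
Proof.
elim=> [c|i|G1 G2 _ [p Hp] _ [q Hq]|G1 G2 _ [p Hp] _ [q Hq]|G1 G2 e _ [p Hp]].
- by exists c%:P => s; rewrite hornerC.
- by exists (A i).
- by exists (p + q) => s; rewrite hornerD Hp Hq.
- by exists (p * q) => s; rewrite hornerM Hp Hq.
by exists p => s; rewrite -e.
Qed.

Lemma poly_many_roots (F : idomainType) (u : nat -> F) (p : {poly F}) :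
  injective u -> (forall n, p.[u n] = 0) -> p = 0.
Proof.
move=> inj H; apply: (@roots_geq_poly_eq0 _ _ [seq u n | n <- iota 0 (size p)]).
- by apply/allP => x /mapP[n _ ->]; apply/rootP.
- by rewrite map_inj_uniq ?iota_uniq.
by rewrite size_map size_iota.
Qed.

Lemma poly_zero_off (F : numFieldType) (p bad : {poly F}) : bad != 0 ->
  (forall s, bad.[s] != 0 -> p.[s] = 0) -> p = 0.
Proof.
move=> b0 H; have : p * bad = 0.
  apply: (@poly_many_roots _ (fun n => n%:R)) => [i j /eqP|n].
    by rewrite eqr_nat => /eqP.
  by rewrite hornerM; have [->|/H ->] := eqVneq bad.[n%:R] 0; rewrite ?mulr0 ?mul0r.
by move=> /eqP; rewrite mulf_eq0 (negbTE b0) orbF => /eqP.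
Qed.

(** Each pair is a linear form with the velocity at which it moves. *)
Definition shift (F : fieldType) (s : F) (t : seq ((F * F) * (F * F))) :=
  [seq (p.1.1 + s * p.2.1, p.1.2 + s * p.2.2) | p <- t].

(** The linear factors move along lines and [kills_path] makes the functional follow polynomially;
    [G] vanishes along the path off the zeros of [bad], hence at its origin. *)
Lemma path_limit (F : numFieldType) (G : ('I_8 -> F) -> F) t (bad : {poly F}) z :
  polyfun G -> (size t <= 7)%N -> bad != 0 -> {in t, forall p, p.1 != (0, 0)} ->
  kills (size t) z (prodf [seq p.1 | p <- t]) ->
  (forall s, bad.[s] != 0 -> forall a, kills (size t) a (prodf (shift s t)) -> G a = 0) ->
  G z = 0.
Proof.
move=> pG t7 b0 nz K H.
pose L (p : (F * F) * (F * F)) : {poly {poly F}} :=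
  (p.1.1%:P + p.2.1 *: 'X)%:P + (p.1.2%:P + p.2.2 *: 'X)%:P * 'X.
pose g := \prod_(p <- t) L p.
have gE s : at_eps s g = prodf (shift s t).
  rewrite /at_eps /g rmorph_prod /prodf /shift big_map; apply: eq_bigr => p _.
  rewrite /L rmorphD rmorphM /= !map_polyC map_polyX /= /horner_eval.
  by rewrite !hornerD !hornerZ !hornerC !hornerX ![_ * s]mulrC /lf mul_polyC.
have g0 : at_eps 0 g = prodf [seq p.1 | p <- t].
  rewrite gE; congr prodf; apply: eq_map => -[[u v] w] /=.
  by rewrite !mul0r !addr0.
have [|||A [A0 KA]] := @kills_path _ g (size t) z t7.
- rewrite g0; apply: prodf_nonzero => l /mapP[p pt ->]; exact: nz.
- by move=> s; rewrite gE (leq_trans (size_prodf _)) // size_map.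
- by rewrite g0.
have [p Hp] := polyfun_path A pG.
have p0 : p = 0.
  by apply: (poly_zero_off b0) => s bs; rewrite -Hp; apply: (H s bs); rewrite -gE.
have -> : z = fun i => (A i).[0] by apply: functional_extensionality => i; rewrite A0.
by rewrite Hp p0 horner0.
Qed.

Lemma small_scale (I : finType) (x : I -> RR) (d : RR) : 0 < d ->
  exists2 e : RR, 0 < e & forall s : RR, `|s| < e -> forall i, `|s * x i| < d.
Proof.
move=> d0; pose B := 1 + \sum_i `|x i|.
have B0 : 0 < B by rewrite ltr_pwDl // sumr_ge0.
exists (d / B) => [|s hs i]; first exact: divr_gt0.
rewrite normrM; apply: le_lt_trans (_ : `|s| * B < d); last by rewrite -ltr_pdivlMr.
rewrite ler_wpM2l // /B (bigD1 i) //=.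
have h : 0 <= \sum_(j | j != i) `|x j| by apply: sumr_ge0.
by rewrite addrCA lerDl addr_ge0.
Qed.

(** Real lines through [x0] extend the vanishing from the box to all real points. The line from the
    real part of [w] in the direction of its imaginary part then reaches [w] at the parameter
    [i]. *)
Lemma polyfun_near_zero (I : finType) (G : (I -> CC) -> CC) (x0 : I -> RR) (d : RR) :
  polyfun G -> 0 < d ->
  (forall x : I -> RR, (forall i, `|x i - x0 i| < d) -> G (fun i => (x i)%:C%C) = 0) ->
  forall w, G w = 0.
Proof.
move=> pG d0 H.
have real x : G (fun i => (x i)%:C%C) = 0.
  have [e e0 He] := small_scale (fun i => x i - x0 i) d0.
  have [p Hp] := polyfun_line pG (fun i => (x0 i)%:C%C) (fun i => (x i - x0 i)%:C%C).
  have p0 : p = 0.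
    apply: (@poly_many_roots _ (fun n => (e / n.+2%:R)%:C%C)) => [i j|n].
      move=> /(fmorph_inj (real_complex RR))/(mulfI (lt0r_neq0 e0))/invr_inj/eqP.
      by rewrite eqr_nat => /eqP [].
    rewrite -Hp -[RHS](H (fun i => x0 i + e / n.+2%:R * (x i - x0 i))).
      by congr (G _); apply: functional_extensionality => i; rewrite -rmorphM -rmorphD.
    move=> i; rewrite addrC addKr; apply: He.
    rewrite ger0_norm ?divr_ge0 ?ler0n ?(ltW e0) //.
    by rewrite ltr_pdivrMr ?ltr0n // ltr_pMr // ltr1n.
  have := Hp 1; rewrite p0 horner0 => E; rewrite -[RHS]E; congr (G _).
  by apply: functional_extensionality => i; rewrite mul1r -rmorphD /= addrC subrK.
move=> w; have [p Hp] := polyfun_line pG (fun i => (complex.Re (w i))%:C%C) (fun i => (complex.Im (w i))%:C%C).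
have p0 : p = 0.
  apply: (@poly_many_roots _ (fun n => (n%:R)%:C%C)) => [i j|n].
    by move=> /(fmorph_inj (real_complex RR))/eqP; rewrite eqr_nat => /eqP.
  rewrite -Hp -[RHS](real (fun i => complex.Re (w i) + n%:R * complex.Im (w i))).
  by congr (G _); apply: functional_extensionality => i; rewrite -rmorphM -rmorphD.
have := Hp 'i%C; rewrite p0 horner0 => E; rewrite -[RHS]E; congr (G _).
by apply: functional_extensionality => i; rewrite [LHS]complexE.
Qed.

End Density.

(** * Normal forms under linear changes of variables *)

Section NormalForms.

Definition nf (F : fieldType) (s : seq (option nat)) (y : 'I_8 -> F) : 'I_8 -> F :=
  fun i => if nth None s i is Some j then y (inord j) else 0.

Lemma act_complexify m1 m2 (a : 'I_8 -> RR) :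
  act (lC m1) (lC m2) (complexify a) = complexify (act m1 m2 a).
Proof.
apply: functional_extensionality => k; rewrite /act /complexify -Lf_complexify; congr (Lf _ _).
by rewrite /toC rmorphM !rmorphXn /= -!/(toC _) !toC_lf.
Qed.

(** The normal form and the matrix vary together: among the twelve complex parameters, a real box
    around [b] and the identity matrix parametrises points of [S]. *)
Lemma chart_density (G : ('I_8 -> CC) -> CC) (S : ('I_8 -> RR) -> Prop) s (b : 'I_8 -> RR) (d : RR) :
  polyfun G -> (forall a, S a -> G (complexify a) = 0) ->
  (forall m1 m2 a, det2 m1 m2 != 0 -> S a -> S (act m1 m2 a)) ->
  0 < d -> (forall y : 'I_8 -> RR, (forall i, `|y i - b i| < d) -> S (nf s y)) ->
  forall m1 m2 y, G (act m1 m2 (nf s y)) = 0.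
Proof.
move=> pG GS Sact d0 Sb m1 m2 y.
pose I : finType := ('I_8 + bool * bool)%type.
pose Th (x : I -> CC) : CC := G (act (x (inr (true, true)), x (inr (true, false)))
  (x (inr (false, true)), x (inr (false, false))) (nf s (fun i => x (inl i)))).
have pTh : polyfun Th.
  apply: (polyfun_comp pG) => k; apply: (polyfun_Lf (A := fun i (x : I -> CC) =>
      nf s (fun i => x (inl i)) i)) => [i|].
    by rewrite /nf; case: (nth None s i) => [j|]; [exact: polyfun_var|exact: polyfun_cst].
  have pX (f g : (I -> CC) -> CC) n : polyfun f -> polyfun g ->
      polyfun_coefs (fun x => lf (f x, g x) ^+ n).
    move=> pf pg; elim: n => [|n IH] j.
      apply: (polyfun_ext (F := fun=> (1 : {poly CC})`_j)) => [x|]; first by rewrite expr0.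
      exact: polyfun_cst.
    apply: (polyfun_ext _ (polyfun_coefs_mul (polyfun_coefs_lf pf pg) IH j)) => x.
    by rewrite exprS.
  by apply: polyfun_coefs_mul; apply: pX; apply: polyfun_var.
pose x0 (i : I) : RR := match i with inl i => b i | inr p => (p.1 == p.2)%:R end.
(* Entries within [1/3] of those of the identity keep the determinant positive, as [4/9 > 1/9]. *)
have d'0 : 0 < Num.min d (1 / 3) by rewrite lt_min d0 /=; lra.
have H (x : I -> RR) : (forall i, `|x i - x0 i| < Num.min d (1 / 3)) ->
    Th (fun i => (x i)%:C%C) = 0.
  move=> hx; pose n1 := (x (inr (true, true)), x (inr (true, false))).
  pose n2 := (x (inr (false, true)), x (inr (false, false))).
  have Dn : det2 n1 n2 != 0.
    rewrite /det2 /=.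
    have := hx (inr (true, true)); have := hx (inr (true, false)).
    have := hx (inr (false, true)); have := hx (inr (false, false)).
    rewrite /x0 /= !lt_min !ltr_norml !subr0.
    move=> /andP[_ /andP[a1 a2]] /andP[_ /andP[b1 b2]] /andP[_ /andP[c1 c2]] /andP[_ /andP[e1 e2]].
    apply: lt0r_neq0; nra.
  pose yy (i : 'I_8) := x (inl i).
  have Sy : S (nf s yy).
    by apply: Sb => i; have := hx (inl i); rewrite lt_min => /andP[].
  rewrite -[RHS](GS _ (Sact _ _ _ Dn Sy)) -act_complexify /Th; congr (G (act _ _ _)).
  apply: functional_extensionality => i; rewrite /nf /complexify.
  by case: (nth None s i) => [j|]; rewrite ?rmorph0.
have := polyfun_near_zero pTh d'0 H (fun i => match i with inl i => y i
  | inr (true, c) => if c then m1.1 else m1.2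
  | inr (false, c) => if c then m2.1 else m2.2 end).
by rewrite /Th /= -!surjective_pairing.
Qed.

End NormalForms.

Section DualDensity.
Variable F : numFieldType.
Implicit Types (l m w : F * F) (z : 'I_8 -> F).

Lemma transverse l : l != (0, 0) -> exists w, det2 l w != 0.
Proof.
case: l => u v; rewrite xpair_eqE negb_and => /orP[u0|v0].
  by exists (0, 1); rewrite /det2 /= mulr1 mulr0 subr0.
by exists (1, 0); rewrite /det2 /= mulr0 mulr1 sub0r oppr_eq0.
Qed.

Definition along l w (s : F) : F * F := (l.1 + s * w.1, l.2 + s * w.2).

Lemma det2_along l w m w' (s : F) : det2 (along l w s) (along m w' s) =
  ((det2 w w') *: 'X^2 + (det2 l w' + det2 w m) *: 'X + (det2 l m)%:P).[s].
Proof.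
by rewrite !hornerD !hornerZ hornerX hornerXn hornerC /det2 /along /=; ring.
Qed.

Lemma along_neq0 l w m w' : (det2 w w' != 0) || (det2 l w' + det2 w m != 0) ->
  (det2 w w') *: 'X^2 + (det2 l w' + det2 w m) *: 'X + (det2 l m)%:P != 0.
Proof.
move=> H; apply: contraTneq H => E.
have := congr1 (fun p : {poly F} => p`_1) E; have := congr1 (fun p : {poly F} => p`_2) E.
rewrite !coef0 !coefD !coefZ !coefXn !coefX !coefC /= !mulr0 !mulr1 !addr0 add0r => -> ->.
by rewrite eqxx.
Qed.

Lemma kills_frame e s z m1 m2 (g : {poly F}) : (e <= 7)%N -> (size g <= e.+1)%N -> det2 m1 m2 != 0 ->
  kills e z (subst e m1 m2 g) ->
  (forall y, kills e y g -> y = nf s y) -> exists n1 n2 y, z = act n1 n2 (nf s y).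
Proof.
move=> e7 sg D K H; have [n1 [n2 [_ E1 E2]]] := act_inv D.
exists n1, n2, (act m1 m2 z); rewrite -H; last exact: kills_act.
by apply: functional_extensionality => k; rewrite E2.
Qed.

(* Entry [i] is the index of the coordinate copied to place [i]; these lists describe the
   functionals killed by [X^2 (X^2 - 1)], [X^3], [X^4] and [X^6]. *)
Definition nf322 := [:: Some 0; Some 1; Some 2; Some 3; Some 2; Some 3; Some 2; Some 3]%N.
Definition nf43 := [:: Some 0; Some 1; Some 2; None; None; None; Some 6; Some 7]%N.
Definition nf52 := [:: Some 0; Some 1; Some 2; Some 3; None; None; None; Some 7]%N.
Definition nf7 := [:: Some 0; Some 1; Some 2; Some 3; Some 4; Some 5; None; None]%N.

Lemma subst_two m1 m2 p q : subst (p + q) m1 m2 ('X^q : {poly F}) = lf m1 ^+ p * lf m2 ^+ q.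
Proof. by rewrite substXn ?leq_addl // addnK. Qed.

Lemma nf_pure s z p q : (p + q <= 7)%N -> size s = 8%N ->
  (forall i, (i < 8)%N -> nth None s i = if (q <= i)%N && (i <= 7 - p)%N then None else Some i) ->
  kills (p + q) z 'X^q -> z = nf s z.
Proof.
move=> le ss Hs /killsE K; apply: functional_extensionality => i; rewrite /nf Hs //.
case: ifP => [/andP[h1 h2]|_]; last by rewrite inord_val.
have lt : (i - q < 8 - (p + q))%N by have := ltn_ord i; lia.
by have := K _ lt; rewrite -exprD subnKC // Lf_Xn.
Qed.

Lemma nf_322 z : kills 4 z ('X^2 * ('X^2 - 1)) -> z = nf nf322 z.
Proof.
move=> /killsE K.
have E k : (k < 4)%N -> z (inord (k + 4)) = z (inord (k + 2)).
  move=> lt; have /K : (k < 8 - 4)%N by [].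
  rewrite mulrBr mulr1 -exprD mulrBl -!exprD LfB => /eqP; rewrite subr_eq0.
  rewrite addnC [(2 + k)%N]addnC -(Lf_Xn z (inord (k + 4))) -(Lf_Xn z (inord (k + 2))).
  by rewrite !inordK; [move=> /eqP|lia|lia].
apply: functional_extensionality => i; rewrite -{1}(inord_val i) /nf.
case: i => -[|[|[|[|[|[|[|[|//]]]]]]]] lt //=.
- exact: (E 0).
- exact: (E 1).
- by rewrite (E 2) // (E 0).
by rewrite (E 3) // (E 1).
Qed.

End DualDensity.

Section Dense.
Variable F : numFieldType.
Implicit Types (l m w : F * F) (z : 'I_8 -> F).
Variables (s : seq (option nat)) (G : ('I_8 -> F) -> F).
Hypotheses (pG : polyfun G) (Gs : forall n1 n2 y, G (act n1 n2 (nf s y)) = 0).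

Lemma det2C l m : det2 l m = - det2 m l.
Proof. by rewrite /det2; ring. Qed.

Lemma shift_cons (p : (F * F) * (F * F)) t x :
  prodf (shift x (p :: t)) = lf (along p.1 p.2 x) * prodf (shift x t).
Proof. exact: prodf_cons. Qed.

(** The factor [m] moves in a direction transverse to [l]. Off finitely many parameters the two
    factors are independent, and a change of variables takes the killing form to [X^q]. *)
Lemma dense_two p q z l m : (p + q <= 7)%N -> size s = 8%N ->
  (forall i, (i < 8)%N -> nth None s i = if (q <= i)%N && (i <= 7 - p)%N then None else Some i) ->
  l != (0, 0) -> m != (0, 0) -> kills (p + q) z (lf m ^+ p * lf l ^+ q) -> G z = 0.
Proof.
move=> le ss Hs l0 m0 K; have [w lw] := transverse l0.
pose t := nseq p (m, w) ++ nseq q (l, (0, 0)).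
have st : size t = (p + q)%N by rewrite size_cat !size_nseq.
apply: (@path_limit _ G t ((det2 (0, 0) w) *: 'X^2 + (det2 l w + det2 (0, 0) m) *: 'X +
    (det2 l m)%:P)); rewrite ?st //.
- by apply: along_neq0; rewrite orbC [det2 (0, 0) m]/det2 !mul0r subrr addr0 lw.
- by move=> x; rewrite mem_cat => /orP[] /nseqP[-> _].
- by rewrite map_cat !map_nseq prodf_cat !prodf_nseq.
move=> x; rewrite -det2_along => D a.
rewrite /shift map_cat !map_nseq prodf_cat !prodf_nseq -subst_two => K'.
have [|||n1 [n2 [y ->]]] := kills_frame (s := s) le _ _ K'; last exact: Gs.
- by rewrite size_polyXn ltnS leq_addl.
- by rewrite det2C oppr_eq0.
by move=> y; apply: nf_pure.
Qed.

(** Three distinct points of the projective line can be moved to [0], [1], [-1], the zeros of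
    [X^2 (X^2 - 1)]. To make them distinct, [m] and [n] move in two independent directions, both
    transverse to [l]. *)
Lemma dense_322 z l m n : s = nf322 -> l != (0, 0) -> m != (0, 0) -> n != (0, 0) ->
  kills 4 z (lf l ^+ 2 * (lf m * lf n)) -> G z = 0.
Proof.
move=> Es l0 m0 n0 K; have [w lw] := transverse l0.
pose w' := (w.1 + l.1, w.2 + l.2).
have lw' : det2 l w' != 0 by rewrite (_ : det2 l w' = det2 l w) // /det2 /w' /=; ring.
have ww' : det2 w w' != 0.
  by rewrite (_ : det2 w w' = - det2 l w) ?oppr_eq0 // /det2 /w' /=; ring.
pose t : seq ((F * F) * (F * F)) := [:: (l, (0, 0)); (l, (0, 0)); (m, w); (n, w')].
pose bad k l w m w' : {poly F} := (det2 w w') *: 'X^2 + (det2 l w' + k * det2 w m) *: 'X + (det2 l m)%:P.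
apply: (@path_limit _ G t (bad 1 l (0, 0) m w * bad 1 l (0, 0) n w' * bad 1 m w n w')) => //.
- rewrite !mulf_neq0 // /bad mul1r; apply: along_neq0; rewrite ?ww' //.
    by rewrite orbC [det2 (0, 0) m]/det2 !mul0r subrr addr0 lw.
  by rewrite orbC [det2 (0, 0) n]/det2 !mul0r subrr addr0 lw'.
- by move=> x; rewrite !inE => /or4P[] /eqP ->.
- by rewrite /= !prodf_cons prodf_nil mulr1 expr2 !mulrA in K *.
move=> x; rewrite !hornerM /bad !mul1r -!det2_along; set L := along l _ x.
set M := along m w x; set N := along n w' x.
rewrite !mulf_eq0 !negb_or => /andP[/andP[LM LN] MN] a.
rewrite !shift_cons -/L -/M -/N /shift prodf_nil mulr1 => K'.
(* The three vectors satisfy [u M + v N = c L]. Half the difference and half the sum of [v N] and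
   [u M] are the images [m1], [m2] of the two coordinates. *)
pose u := - det2 L N; pose v := det2 L M.
have uv (i : bool) : let f (p : F * F) := if i then p.1 else p.2 in
    u * f M + v * f N = - det2 M N * f L.
  by rewrite /u /v /det2; case: i; ring.
have MN0 : - det2 M N != 0 by rewrite oppr_eq0.
have u0 : u != 0 by rewrite oppr_eq0.
pose c := - det2 M N.
pose m2 := (c / 2 * L.1, c / 2 * L.2).
pose m1 := ((v * N.1 - u * M.1) / 2, (v * N.2 - u * M.2) / 2).
have two0 : (2 : F) != 0 by rewrite pnatr_eq0.
have e1 : tr m1 m2 (1, 1) = (v * N.1, v * N.2).
  have h1 := uv true; have h2 := uv false; rewrite /= -/c in h1 h2.
  rewrite /tr /m1 /m2 /= !mul1r; congr pair.
    by rewrite [c / 2 * _]mulrAC -h1; field.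
  by rewrite [c / 2 * _]mulrAC -h2; field.
have e2 : tr m1 m2 (-1, 1) = (u * M.1, u * M.2).
  have h1 := uv true; have h2 := uv false; rewrite /= -/c in h1 h2.
  rewrite /tr /m1 /m2 /= !mul1r; congr pair.
    by rewrite [c / 2 * _]mulrAC -h1; field.
  by rewrite [c / 2 * _]mulrAC -h2; field.
have D : det2 m1 m2 != 0.
  have -> : det2 m1 m2 = u * v / 2 * det2 N M.
    have h1 := uv true; have h2 := uv false; rewrite /= -/c in h1 h2.
    rewrite /m1 /m2 ![c / 2 * _]mulrAC -h1 -h2 /det2 /=; field; by [].
  rewrite !mulf_neq0 ?invr_neq0 //.
  by rewrite det2C oppr_eq0.
have lfZ k (p : F * F) : lf (k * p.1, k * p.2) = k *: lf p.
  by rewrite /lf /= scalerDr scalerA -mul_polyC polyCM mul_polyC.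
have sE : subst 4 m1 m2 ('X^2 * ('X^2 - 1)) =
    ((c / 2) ^+ 2 * (u * v)) *: (lf L * (lf L * (lf M * lf N))).
  have -> : 'X^2 * ('X^2 - 1) = prodf [:: (0, 1); (0, 1); (-1, 1); (1, 1)] :> {poly F}.
    by rewrite !prodf_cons prodf_nil /lf /= !scale1r; ring.
  rewrite (subst_prodf m1 m2 [:: (0, 1); (0, 1); (-1, 1); (1, 1)]) /= e1 e2.
  have -> : tr m1 m2 (0, 1) = (c / 2 * L.1, c / 2 * L.2).
    by rewrite /tr /= !mul0r !add0r !mul1r.
  rewrite !prodf_cons prodf_nil !lfZ -!scalerAl -!scalerAr !scalerA mulr1; congr (_ *: _).
  by ring.
have [||||n1 [n2 [y ->]]] := @kills_frame _ 4 s a m1 m2 ('X^2 * ('X^2 - 1)) _ _ D.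
- by [].
- apply: leq_trans (size_polyMleq _ _) _; rewrite size_polyXn -[1]/(1%:P) size_XnsubC //.
- by rewrite sE; apply: killsZ.
- by rewrite Es; apply: nf_322.
exact: Gs.
Qed.

End Dense.

(** * Points adherent to two rank regions *)

Section Boundary.
Implicit Types (a b : 'I_8 -> RR) (S : ('I_8 -> RR) -> Prop).

Definition act_invariant S := forall m1 m2 a, det2 m1 m2 != 0 -> S a -> S (act m1 m2 a).

Lemma act_inv_eq (m1 m2 : RR * RR) : det2 m1 m2 != 0 -> exists n1 n2,
  [/\ det2 n1 n2 != 0, forall a, act m1 m2 (act n1 n2 a) = a & forall a, act n1 n2 (act m1 m2 a) = a].
Proof.
move=> /act_inv[n1 [n2 [D E1 E2]]]; exists n1, n2; split=> // a;
by apply: functional_extensionality => k; rewrite ?E1 ?E2.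
Qed.

Lemma interior_act S : act_invariant S -> act_invariant (interior S).
Proof.
move=> inv m1 m2 a D I; have [n1 [n2 [_ E1 E2]]] := act_inv_eq D.
apply: interior_seq => A cA; have := cvgs_act n1 n2 cA; rewrite E2 => /(interior_cvg I)[N HN].
by exists N; rewrite -[A N]E1; apply: inv => //; apply: HN.
Qed.

Lemma closure_act S : act_invariant S -> act_invariant (closure S).
Proof.
move=> inv m1 m2 a D /closureP[A [SA cA]]; apply/closureP.
by exists (fun n => act m1 m2 (A n)); split=> [n|]; [apply: inv|apply: cvgs_act].
Qed.

Lemma Omega_act r : act_invariant (Omega r).
Proof.
move=> m1 m2 a D [h1 h2]; split=> [|s]; first exact: rank_act.
have [n1 [n2 [_ _ E2]]] := act_inv_eq D.
by move=> /(rank_act n1 n2); rewrite E2; apply: h2.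
Qed.

Lemma Rint_act r : act_invariant (Rint r).
Proof. exact: interior_act (@Omega_act r). Qed.

Lemma topbd_act r : act_invariant (topbd (Rint r)).
Proof.
move=> m1 m2 a D [cl nI]; split; first exact: closure_act (@Rint_act r) _ _ _ D cl.
have [n1 [n2 [Dn _ E2]]] := act_inv_eq D.
by move=> /(interior_act (closure_act (@Rint_act r)) Dn); rewrite E2.
Qed.

Lemma Rint_disjoint r r' a : Rint r a -> Rint r' a -> r = r'.
Proof.
by move=> /interior_sub[h1 h2] /interior_sub[h3 h4]; apply/eqP; rewrite eqn_leq h2 ?h4.
Qed.

(** The regions are open and disjoint: a neighbourhood of [a] inside the closure of the first would
    contain a point of the second, near which the first has points. *)
Lemma topbd_two r r' a : r != r' -> closure (Rint r) a -> closure (Rint r') a -> topbd (Rint r) a.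
Proof.
move=> ne cl cl'; split=> // I; case/eqP: ne.
have [B [HB cB]] := proj1 (closureP _ _) cl'.
have [N HN] := interior_cvg I cB; have [C [HC cC]] := proj1 (closureP _ _) (HN N (leqnn _)).
have [M HM] := interior_cvg (interior_open (HB N)) cC.
exact: Rint_disjoint (HC M) (HM M (leqnn _)).
Qed.

Lemma boundary_eq r (D : ('I_8 -> CC) -> Prop) : closed_fun D ->
  (forall a, topbd (Rint r) a -> D (complexify a)) ->
  (forall G : ('I_8 -> CC) -> CC, polyfun G ->
    (forall a, topbd (Rint r) a -> G (complexify a) = 0) -> forall z, D z -> G z = 0) ->
  forall z, real_rank_boundary r z <-> D z.
Proof.
move=> cD sub dense z; split=> [H|Dz P HP].
  apply: NNPP => nD; have [G pG [G0 GD]] := cD z nD; have [P EP] := polyfun_mpoly pG.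
  case/eqP: G0; rewrite EP; apply: H => w [a [Ta ->]].
  by rewrite -EP; apply: GD; apply: sub.
apply: (dense (fun z => P.@[z]) (polyfun_meval P)) Dz => a Ta.
by apply: HP; exists a.
Qed.

(** Points adherent to two regions are boundary points of both, by [topbd_two], so that one box
    serves two of the four equalities. *)
Definition good s r r' := exists (b : 'I_8 -> RR) (d : RR), 0 < d /\
  forall y : 'I_8 -> RR, (forall i, `|y i - b i| < d) ->
    closure (Rint r) (nf s y) /\ closure (Rint r') (nf s y).

Lemma good_sym s r r' : good s r r' -> good s r' r.
Proof. by move=> [b [d [d0 H]]]; exists b, d; split=> // y /H[]. Qed.

Lemma good_vanish s r r' (G : ('I_8 -> CC) -> CC) : r != r' -> good s r r' -> polyfun G ->
  (forall a, topbd (Rint r) a -> G (complexify a) = 0) ->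
  forall m1 m2 y, G (act m1 m2 (nf s y)) = 0.
Proof.
move=> ne [b [d [d0 H]]] pG GT.
apply: (chart_density pG GT) d0 _; first exact: topbd_act.
by move=> y /H[h h']; apply: topbd_two ne h h'.
Qed.

End Boundary.

(** * Polar derivatives *)

Section Polar.
Variable R : rcfType.
Implicit Types (l m : R * R) (f g : {poly R}) (c : nat -> R).

Lemma rolle_path f x t : path <%R x t -> all (root f) (x :: t) -> exists t' : seq R,
  [/\ size t' = size t, path <%R x t' & all (root f^`()) t'].
Proof.
elim: t x => [|y t IH] x; first by exists [::].
move=> /= /andP[xy pt] /and3P[/rootP fx ry rt].
have [|t' [st' pt' rt']] := IH y pt; first by rewrite /= ry.
have [|z] := poly_rolle (p := f) xy; first by rewrite fx (rootP ry).
rewrite in_itv /= => /andP[xz zy] dz; exists (z :: t'); split.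
- by rewrite /= st'.
- by rewrite /= xz (path_le lt_trans zy pt').
by rewrite /= rt' andbT; apply/rootP.
Qed.

(* [f], read as a form of degree [n], has [n] distinct zeros on the real projective line. *)
Definition simple_zeros n f := exists (s : seq (R * R)) (k : R),
  [/\ size s = n, {in s, forall l, l != (0, 0)}, pairwise (@indep R) s, k != 0 & f = k *: prodf s].

Lemma simple_zeros_rootsp n (t : seq R) k : uniq t -> k != 0 ->
  (size t = n \/ size t = n.-1 /\ (0 < n)%N) -> simple_zeros n (k *: rootsp t).
Proof.
move=> ut k0 st; pose s := [seq (- x, 1) | x <- t] : seq (R * R).
have E : rootsp t = prodf s.
  by rewrite /rootsp /prodf big_map; apply: eq_bigr => x _; rewrite /lf /= scale1r polyCN addrC.
have nz : {in s, forall l, l != (0, 0)}.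
  by move=> _ /mapP[x _ ->]; rewrite xpair_eqE oner_eq0 andbF.
have pw : pairwise (@indep R) s.
  rewrite pairwise_map; move: ut; rewrite uniq_pairwise; apply: sub_pairwise => x y.
  by rewrite /indep /det2 /= mulr1 mul1r opprK addrC subr_eq0 eq_sym.
case: st => [st|[st n0]]; first by exists s, k; rewrite size_map E.
exists ((1, 0) :: s), k; rewrite /= size_map st prednK // pw andbT; split=> //.
- by move=> l; rewrite inE => /orP[/eqP ->|/nz //]; rewrite xpair_eqE oner_eq0.
- by apply/allP => _ /mapP[x _ ->]; rewrite /indep /det2 /= mul0r subr0 mulr1 oner_eq0.
by rewrite E prodf_cons /lf /= scale0r addr0 mul1r.
Qed.

Lemma rootsp_simple_zeros n f : simple_zeros n f -> exists (t : seq R) k,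
  [/\ uniq t, k != 0, f = k *: rootsp t & size t = n \/ size t = n.-1 /\ (0 < n)%N].
Proof.
move=> [s [k [sz nz pw k0 ->]]].
have [/allP fin|] := boolP (all (fun l => l.2 != 0) s).
  have [c c0 ->] := prodf_rootsp fin; exists (map (@root_of R) s), (k * c).
  by rewrite uniq_root_of // mulf_neq0 // scalerA size_map; split=> //; left.
rewrite -has_predC => /hasP[l ls /=]; rewrite negbK => /eqP l2.
have l1 : l.1 != 0.
  by have := nz l ls; case: l l2 {ls} => u v /= ->; rewrite xpair_eqE eqxx andbT.
case/splitPr: ls nz pw sz => s1 s2 nz; rewrite pairwise_cat allrel_consr /=.
case/and3P=> /andP[a1 a12] p1 /andP[a2 p2] sz.
have pw : pairwise (@indep R) (s1 ++ s2) by rewrite pairwise_cat a12 p1.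
have fin : {in s1 ++ s2, forall m, m.2 != 0}.
  move=> m; rewrite mem_cat => /orP[/(allP a1)|/(allP a2)]; rewrite /indep /det2 l2;
  by apply: contraNneq => ->; rewrite ?mulr0 ?mul0r subrr.
have [c c0 E'] := prodf_rootsp fin; exists (map (@root_of R) (s1 ++ s2)), (k * (l.1 * c)).
rewrite uniq_root_of ?mulf_neq0 //; split=> //; last first.
  by right; rewrite size_map -sz !size_cat /= addnS.
rewrite prodf_cat prodf_cons mulrCA -prodf_cat E' /lf l2 scale0r addr0 mul_polyC -!scalerA.
by congr (_ *: _); rewrite scalerA.
Qed.

Lemma simple_zeros_subst n m1 m2 f : det2 m1 m2 != 0 -> simple_zeros n f ->
  simple_zeros n (subst n m1 m2 f).
Proof.
move=> D [s [k [sz nz pw k0 ->]]]; exists (map (tr m1 m2) s), k.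
split; rewrite ?size_map ?substZ -?sz ?subst_prodf //.
  by move=> _ /mapP[l /nz l0 ->]; rewrite tr_eq0.
by rewrite pairwise_map; apply: sub_pairwise pw => l m; rewrite /= indep_tr.
Qed.

(** Rolle puts a zero of the derivative between consecutive zeros. If infinity is a zero of [f], it
    remains one of the derivative, read in degree one less. *)
Lemma simple_zeros_deriv n f : simple_zeros n.+2 f -> simple_zeros n.+1 f^`().
Proof.
move=> /rootsp_simple_zeros[t0 [k [ut0 k0 -> st0]]].
have [t [pt st srt]] : exists t, [/\ perm_eq t0 t, size t = size t0 & sorted <%R t].
  exists (sort <=%R t0); split; [by rewrite perm_sym perm_sort|by rewrite size_sort|].
  by rewrite sort_lt_sorted.
rewrite /rootsp (perm_big _ pt) /= -/(rootsp t); rewrite -{}st in st0.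
case: t {pt} srt st0 => [|x t] srt st0; first by case: st0 => [|[]].
have rt : all (root (rootsp (x :: t))) (x :: t).
  by apply/allP => y yt; apply/rootP/eqP; rewrite rootsp_eq0.
have [t' [st' pt' rt']] := rolle_path srt rt.
have ut' : uniq t'.
  by have := path_sorted pt'; rewrite lt_sorted_uniq_le => /andP[].
have sd : size (rootsp (x :: t))^`() = (size t').+1.
  by rewrite size_deriv size_rootsp /= st'.
have Ed : (rootsp (x :: t))^`() = lead_coef (rootsp (x :: t))^`() *: rootsp t'.
  by apply: all_roots_prod_XsubC => //; rewrite uniq_rootsE.
rewrite derivZ Ed scalerA; apply: simple_zeros_rootsp => //.
  by rewrite mulf_neq0 // lead_coef_eq0 -size_poly_gt0 sd.
by rewrite st'; case: st0 => /= [[->]|[[->] _]]; [left|right].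
Qed.

(** Sending [c0] to infinity turns the polar derivative at [c0] into the ordinary derivative. *)
Lemma polar_chart n (c0 : R) f : (size f <= n.+2)%N ->
  n.+1%:R *: subst n.+1 (- c0, 1) (1, 0) f - ('X - c0%:P) * (subst n.+1 (- c0, 1) (1, 0) f)^`() =
  subst n (- c0, 1) (1, 0) f^`().
Proof.
have E e g : subst e (- c0, 1) (1, 0) g = \sum_(i < e.+1) g`_i *: ('X - c0%:P) ^+ (e - i).
  apply: eq_bigr => i _; rewrite /lf /= scale1r scale0r addr0 expr1n mulr1 polyCN addrC.
  by [].
move=> sf; rewrite !E [deriv _]raddf_sum mulr_sumr scaler_sumr -sumrB /= big_ord_recl.
have T i : (i <= n.+1)%N -> n.+1%:R *: (f`_i *: ('X - c0%:P) ^+ (n.+1 - i)) -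
    ('X - c0%:P) * (f`_i *: ('X - c0%:P) ^+ (n.+1 - i))^`() =
    (f`_i *+ i) *: ('X - c0%:P) ^+ (n.+1 - i).
  move=> le; rewrite derivZ deriv_exp derivXsubC mul1r.
  rewrite -scalerAr mulrnAr -exprS.
  have -> : ('X - c0%:P) ^+ (n.+1 - i).-1.+1 *+ (n.+1 - i) = ('X - c0%:P) ^+ (n.+1 - i) *+ (n.+1 - i).
    by case: (n.+1 - i)%N => [|k]; rewrite ?mulr0n.
  rewrite -[_ *+ (n.+1 - i)]scaler_nat !scalerA -scalerBl natrB //; congr (_ *: _).
  by rewrite -mulr_natr; ring.
rewrite T // mulr0n scale0r add0r; apply: eq_bigr => i _; rewrite T ?ltn_ord //.
by rewrite coef_deriv.
Qed.

(** The expression is the polar derivative of [f] at a point of the projective line: infinity when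
    [l.1 = 0], and otherwise a point moved there by [polar_chart]. *)
Lemma simple_zeros_polar n l f : l != (0, 0) -> simple_zeros n.+2 f ->
  simple_zeros n.+1 ((n.+2%:R * l.1) *: f + (l.2%:P - l.1 *: 'X) * f^`()).
Proof.
case: l => u v l0 H; have n0 : (n.+2%:R : R) != 0 by rewrite pnatr_eq0.
have sZ k g (c : R) : c != 0 -> simple_zeros k g -> simple_zeros k (c *: g).
  move=> c0 [s [c' [sz nz pw c'0 ->]]]; exists s, (c * c').
  by rewrite scalerA mulf_neq0.
have [u0|u0] := eqVneq u 0.
  have v0 : v != 0 by move: l0; rewrite u0 xpair_eqE eqxx.
  rewrite /= u0 mulr0 !scale0r add0r subr0 mul_polyC; apply: (sZ _ _ _ v0).
  exact: simple_zeros_deriv.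
pose c0 := v / u.
have sf : (size f <= n.+3)%N.
  have [s [k [sz _ _ _ ->]]] := H.
  by rewrite (leq_trans (size_scale_leq _ _)) // -sz size_prodf.
have D : det2 (- c0, 1) (1, 0) != 0 :> R by rewrite /det2 /= mulr0 mul1r sub0r oppr_eq0 oner_eq0.
have [n1 [n2 [Dn e1 e2 e3 e4]]] := tr_inv D.
have Ef : subst n.+2 (- c0, 1) (1, 0) (subst n.+2 n1 n2 f) = f.
  by rewrite subst_subst e1 e2 subst_id.
have := polar_chart c0 (size_subst n.+2 n1 n2 f); rewrite Ef.
have -> : (n.+2%:R * u) *: f + (v%:P - u *: 'X) * f^`() =
    u *: (n.+2%:R *: f - ('X - c0%:P) * f^`()).
  rewrite scalerBr scalerA [u * _]mulrC scalerAl; congr (_ + _).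
  rewrite -mulNr; congr (_ * _).
  by rewrite scalerBr opprB -[u *: c0%:P]mul_polyC -polyCM /c0 mulrCA divff ?mulr1.
move=> ->; apply: (sZ _ _ _ u0); apply: simple_zeros_subst => //.
by apply: simple_zeros_deriv; apply: simple_zeros_subst.
Qed.

Definition binpoly n c : {poly R} := \poly_(k < n.+1) (('C(n, k))%:R * c k).

Lemma coef_binpoly n c k : (binpoly n c)`_k = ('C(n, k))%:R * c k.
Proof. by rewrite coef_poly ltnS; case: leqP => // lt; rewrite bin_small // mul0r. Qed.

(** Contracting the coefficients with [l], which is how a linear factor of a killing form acts,
    amounts to a polar derivative. *)
Lemma binpoly_polar n l c :
  n.+1%:R *: binpoly n (fun k => l.1 * c k + l.2 * c k.+1) =
  (n.+1%:R * l.1) *: binpoly n.+1 c + (l.2%:P - l.1 *: 'X) * (binpoly n.+1 c)^`().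
Proof.
case: l => u v /=; apply/polyP => k.
rewrite mulrBl !(coefD, coefN, coefZ) coefCM -scalerAl coefZ coefXM !coef_deriv !coef_binpoly.
have T : n.+1%:R * ('C(n, k))%:R = k.+1%:R * ('C(n.+1, k.+1))%:R :> R.
  by rewrite -!natrM mul_bin_diag.
have T' : n.+1%:R * ('C(n, k))%:R = n.+1%:R * ('C(n.+1, k))%:R - k%:R * ('C(n.+1, k))%:R :> R.
  apply/eqP; rewrite eq_sym subr_eq eq_sym -!natrM -natrD mul_bin_down -mulnDl; apply/eqP.
  by case: (leqP k n.+1) => [/subnK ->//|lt]; rewrite !bin_small ?muln0.
transitivity (n.+1%:R * ('C(n, k))%:R * (u * c k) + n.+1%:R * ('C(n, k))%:R * (v * c k.+1)).
  by ring.
rewrite {1}T' T.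
have -> : (if k == 0%N then 0 else ('C(n.+1, k.-1.+1)%:R * c k.-1.+1) *+ k.-1.+1) =
    k%:R * ('C(n.+1, k)%:R * c k).
  clear T T'; case: k => [|k]; first by rewrite eqxx mul0r.
  exact: esym (mulr_natl _ _).
by rewrite -mulr_natl; ring.
Qed.

(** Each linear factor acts as a polar derivative, which preserves simple real zeros; six of them
    leave a form of degree one that still has a simple zero, hence is not zero. *)
Lemma simple_zeros_not_killed (a : 'I_8 -> R) s : simple_zeros 7 (binpoly 7 (moments a 1)) ->
  {in s, forall l, l != (0, 0)} -> size s = 6%N -> ~ kills 6 a (prodf s).
Proof.
move=> H0 nz sz /killsE K.
have step t : (size t <= 6)%N -> {in t, forall l, l != (0, 0)} ->
    simple_zeros (7 - size t) (binpoly (7 - size t) (moments a (prodf t))).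
  elim: t => [|l t IH] st nzt /=; first by rewrite prodf_nil.
  have /IH : (size t <= 6)%N by apply: ltnW.
  move=> /(_ (fun m mt => nzt m (mem_behead (s := l :: t) mt))).
  have -> : (7 - size t = (7 - (size t).+1).-1.+2)%N by move: st => /=; lia.
  have -> : (7 - (size t).+1 = (7 - (size t).+1).-1.+1)%N by move: st => /=; lia.
  set n := (7 - (size t).+1).-1; move=> /(simple_zeros_polar (nzt l (mem_head _ _))).
  rewrite -binpoly_polar => -[s' [k [sz' nz' pw' k0 E]]].
  have n0 : (n.+2%:R : R) != 0 by rewrite pnatr_eq0.
  exists s', (n.+2%:R^-1 * k); rewrite mulf_neq0 ?invr_eq0 //; split=> //.
  rewrite -scalerA -E scalerA mulVf // scale1r prodf_cons.
  by apply/polyP => i; rewrite !coef_binpoly moments_lf.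
have := step s; rewrite sz => /(_ isT nz)[s' [k [sz' nz' _ k0 E]]].
have : k *: prodf s' == 0.
  rewrite -E; apply/eqP/polyP => i; rewrite coef_binpoly coef0.
  case: i => [|[|i]]; last by rewrite bin_small ?mul0r.
    by rewrite /moments K ?mulr0.
  by rewrite /moments K ?mulr0.
by rewrite scaler_eq0 (negbTE k0) (negbTE (prodf_nonzero nz')).
Qed.

End Polar.

(** * Forms with only real zeros *)

Section RealRooted.
Variable R : realFieldType.
Implicit Types (s : seq (R * R)) (h : {poly R}).

(* [h(t) h(-t) = \sum_k (-1)^k (alt h k) t^(2k)]. *)
Definition alt h k : R := \sum_(i < k.*2.+1) (-1) ^+ (k + i) * h`_i * h`_(k.*2 - i).

(** From [(u + v t) (u - v t) = u^2 - v^2 t^2]: the product [h(t) h(-t)] is this polynomial at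
    [- t^2], and its coefficients are visibly non-negative. *)
Definition sqform s : {poly R} := \prod_(l <- s) lf (l.1 ^+ 2, l.2 ^+ 2).

Lemma alt_prodf s k : alt (prodf s) k = (sqform s)`_k.
Proof.
have E : sqform s \Po (- 'X^2) = prodf s * (prodf s \Po (- 'X)).
  elim: s => [|l s IH]; first by rewrite /sqform prodf_nil big_nil !comp_polyC mul1r.
  rewrite /sqform big_cons prodf_cons !comp_polyM -/(sqform s) IH mulrACA; congr (_ * _).
  rewrite /lf /= !comp_polyD !comp_polyC !comp_polyZ !comp_polyX !polyCM.
  by rewrite -!mul_polyC !polyCM; ring.
have cXm m h i : (0 < m)%N -> (h \Po (- 'X^m))`_(m * i) = (-1) ^+ i * h`_i.
  move=> m0; have T j : (h`_j *: (- 'X^m) ^+ j)`_(m * i) = (j == i)%:R * ((-1) ^+ j * h`_j).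
    rewrite -scaleN1r exprZn -exprM scalerA coefZ coefXn eqn_pmul2l // [i == j]eq_sym.
    by rewrite mulrC [h`_j * _]mulrC.
  rewrite comp_polyE coef_sum; have [lt|ge] := ltnP i (size h); last first.
    rewrite [h`_i]nth_default // mulr0 big1 // => j _; rewrite T ltn_eqF ?mul0r //.
    exact: leq_trans (ltn_ord j) ge.
  rewrite (bigD1 (Ordinal lt)) //= T eqxx mul1r big1 ?addr0 // => j.
  by rewrite -val_eqE T => /negbTE /= ->; rewrite mul0r.
have cX h i : (h \Po (- 'X))`_i = (-1) ^+ i * h`_i by have := @cXm 1%N h i isT; rewrite mul1n.
have := congr1 (fun p : {poly R} => p`_k.*2) E; rewrite -{1}mul2n cXm // coefM => Ek.
have -> : (sqform s)`_k = (-1) ^+ k * ((-1) ^+ k * (sqform s)`_k).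
  by rewrite mulrA -expr2 sqrr_sign mul1r.
rewrite Ek mulr_sumr; apply: eq_bigr => -[i lt] _ /=; rewrite cX exprD.
have -> : (-1) ^+ (k.*2 - i) = (-1) ^+ i :> R.
  by rewrite -signr_odd -[in RHS]signr_odd (oddB (lt : (i <= k.*2)%N)) odd_double addFb.
by ring.
Qed.

Lemma sqform_cons l s k : (sqform (l :: s))`_k =
  l.1 ^+ 2 * (sqform s)`_k + l.2 ^+ 2 * (if k is k'.+1 then (sqform s)`_k' else 0).
Proof.
rewrite /sqform big_cons /lf /= mulrDl mul_polyC coefD coefZ -scalerAl coefZ coefXM.
by case: k.
Qed.

Lemma sqform_ge0 s k : 0 <= (sqform s)`_k.
Proof.
elim: s k => [|l s IH] k; first by rewrite /sqform big_nil coefC; case: ifP; rewrite ?ler01.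
rewrite sqform_cons addr_ge0 // mulr_ge0 ?sqr_ge0 //.
by case: k.
Qed.

(** Stated for all [i < j] and not for neighbours alone, the inequality passes through
    multiplication by [p + q t] with [p, q >= 0], even when coefficients vanish. *)
Lemma sqform_log_concave s i j : (i < j)%N ->
  (sqform s)`_i * (sqform s)`_j.+1 <= (sqform s)`_i.+1 * (sqform s)`_j.
Proof.
elim: s i j => [|l s IH] i j lt.
  by rewrite /sqform big_nil !coefC /= mul0r mulr0.
rewrite !sqform_cons; set A := sqform s in IH *.
have A0 k : 0 <= A`_k by apply: sqform_ge0.
set p := l.1 ^+ 2; set q := l.2 ^+ 2.
have p0 : 0 <= p by apply: sqr_ge0.
have q0 : 0 <= q by apply: sqr_ge0.
rewrite -subr_ge0; case: j lt => // j; case: i => [|i] lt.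
  have := IH 0%N j.+1 isT; rewrite -subr_ge0 => h.
  have -> : (p * A`_1 + q * A`_0) * (p * A`_j.+1 + q * A`_j) -
      (p * A`_0 + q * 0) * (p * A`_j.+2 + q * A`_j.+1) =
      p ^+ 2 * (A`_1 * A`_j.+1 - A`_0 * A`_j.+2) + p * q * (A`_1 * A`_j) + q ^+ 2 * (A`_0 * A`_j).
    by ring.
  apply: addr_ge0; [apply: addr_ge0|].
  - by apply: mulr_ge0 h; apply: exprn_ge0.
  - by apply: mulr_ge0; apply: mulr_ge0.
  by apply: mulr_ge0; [apply: exprn_ge0|apply: mulr_ge0].
have h1 := IH i.+1 j.+1 lt; have h2 := IH i j lt; rewrite -subr_ge0 in h1; rewrite -subr_ge0 in h2.
have h3 : 0 <= A`_i.+2 * A`_j - A`_i * A`_j.+2.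
  have h4 := IH i j.+1 (ltnW lt); rewrite subr_ge0; apply: le_trans h4 _.
  move: lt; rewrite ltnS leq_eqVlt => /orP[/eqP <-|lt]; first by rewrite mulrC.
  exact: IH.
have -> : (p * A`_i.+2 + q * A`_i.+1) * (p * A`_j.+1 + q * A`_j) -
    (p * A`_i.+1 + q * A`_i) * (p * A`_j.+2 + q * A`_j.+1) =
    p ^+ 2 * (A`_i.+2 * A`_j.+1 - A`_i.+1 * A`_j.+2) + p * q * (A`_i.+2 * A`_j - A`_i * A`_j.+2) +
    q ^+ 2 * (A`_i.+1 * A`_j - A`_i * A`_j.+1).
  by ring.
apply: addr_ge0; [apply: addr_ge0|].
- by apply: mulr_ge0 h1; apply: exprn_ge0.
- by apply: mulr_ge0 h3; apply: mulr_ge0.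
by apply: mulr_ge0 h2; apply: exprn_ge0.
Qed.

Lemma altZ c h k : alt (c *: h) k = c ^+ 2 * alt h k.
Proof. by rewrite /alt mulr_sumr; apply: eq_bigr => i _; rewrite !coefZ; ring. Qed.

(** A factor [u + v t] without positive zero has [u v >= 0], so after changing the signs of some
    factors all coefficients are non-negative. *)
Lemma prodf_same_sign s : (forall t, 0 < t -> (prodf s).[t] != 0) ->
  forall i j, 0 <= (prodf s)`_i * (prodf s)`_j.
Proof.
move=> H; have : {in s, forall l, 0 <= l.1 * l.2}.
  move=> l ls; rewrite leNgt; apply/negP => neg.
  have l2 : l.2 != 0 by apply: contraTneq neg => ->; rewrite mulr0 ltxx.
  have t0 : 0 < - (l.1 / l.2).
    have -> : - (l.1 / l.2) = - (l.1 * l.2) / l.2 ^+ 2 by field.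
    by rewrite divr_gt0 ?oppr_gt0 ?exprn_even_gt0.
  case/negP: (H _ t0); rewrite (perm_prodf (perm_to_rem ls)) prodf_cons hornerM.
  rewrite /lf hornerD hornerC hornerZ hornerX mulrN mulrCA divff // mulr1 subrr mul0r.
  exact: eqxx.
elim: s {H} => [|l s IH] nn i j.
  by rewrite prodf_nil !coefC; case: ifP => _; case: ifP => _; rewrite ?mulr1 ?mulr0.
have {}IH := IH (fun m ms => nn m (mem_behead (s := l :: s) ms)).
have l0 := nn l (mem_head _ _).
have E k : (prodf (l :: s))`_k = l.1 * (prodf s)`_k + l.2 * (if k is k'.+1 then (prodf s)`_k' else 0).
  by rewrite prodf_cons /lf mulrDl mul_polyC coefD coefZ -scalerAl coefZ coefXM; case: k.
rewrite !E; set p := prodf s in IH *.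
set pi := (if i is _.+1 then _ else _); set pj := (if j is _.+1 then _ else _).
have h1 : 0 <= p`_i * pj by rewrite /pj; case: (j); rewrite ?mulr0.
have h2 : 0 <= pi * p`_j by rewrite /pi; case: (i); rewrite ?mul0r.
have h3 : 0 <= pi * pj by rewrite /pi /pj; case: (i) => [|i']; case: (j) => [|j']; rewrite ?mul0r ?mulr0.
have -> : (l.1 * p`_i + l.2 * pi) * (l.1 * p`_j + l.2 * pj) = l.1 ^+ 2 * (p`_i * p`_j) +
  (l.1 * l.2) * (p`_i * pj + pi * p`_j) + l.2 ^+ 2 * (pi * pj) by ring.
apply: addr_ge0; [apply: addr_ge0|].
- by apply: mulr_ge0 (IH i j); apply: sqr_ge0.
- by apply: mulr_ge0 => //; apply: addr_ge0.
by apply: mulr_ge0 => //; apply: sqr_ge0.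
Qed.

Lemma alt_explicit h : [/\ alt h 0 = h`_0 ^+ 2, alt h 1 = h`_1 ^+ 2 - 2 * h`_0 * h`_2,
  alt h 2 = h`_2 ^+ 2 - 2 * h`_1 * h`_3 + 2 * h`_0 * h`_4 &
  alt h 3 = h`_3 ^+ 2 - 2 * h`_2 * h`_4 + 2 * h`_1 * h`_5 - 2 * h`_0 * h`_6].
Proof.
rewrite /alt /= !big_ord_recr !big_ord0 /= !addn0 ?add0r; split; ring.
Qed.

Lemma alt_quintic h : (size h <= 6)%N ->
  alt h 4 = h`_4 ^+ 2 - 2 * h`_3 * h`_5 /\ alt h 5 = h`_5 ^+ 2.
Proof.
move=> sh; have z k : (5 < k)%N -> h`_k = 0 by move=> lt; rewrite nth_default // (leq_trans sh).
rewrite /alt /= !big_ord_recr !big_ord0 /= !(z 6, z 7, z 8, z 9, z 10) //; split; ring.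
Qed.

End RealRooted.

(** * Boundary points in the normal forms *)

Section InteriorTools.
Implicit Types (S : ('I_8 -> RR) -> Prop) (b y : 'I_8 -> RR).

Lemma interior_box S b : interior S b ->
  exists2 d : RR, 0 < d & forall y, (forall i, `|y i - b i| < d) -> S y.
Proof.
move=> [e [e0 H]]; exists (Num.min 1 (e / 16)); first by rewrite lt_min ltr01 divr_gt0.
move=> y hy; apply: H; rewrite /dist2.
apply: le_lt_trans (_ : \sum_(i < 8) e / 16 < e); last first.
  by rewrite sumr_const card_ord -mulr_natl; lra.
apply: ler_sum => i _; have := hy i; rewrite lt_min !ltr_norml => /andP[/andP[h1 h2] /andP[h3 h4]].
by nra.
Qed.

Lemma interiorI S T b : interior S b -> interior T b -> interior (fun y => S y /\ T y) b.
Proof.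
move=> [e [e0 He]] [f [f0 Hf]]; exists (Num.min e f); split; first by rewrite lt_min e0.
by move=> y; rewrite lt_min => /andP[/He h1 /Hf h2].
Qed.

Lemma interior_imp S T b : (forall y, S y -> T y) -> interior S b -> interior T b.
Proof. by move=> H [e [e0 He]]; exists e; split=> // y /He/H. Qed.

Lemma interior_pos (G : ('I_8 -> RR) -> RR) b : polyfun G -> 0 < G b ->
  interior (fun y => 0 < G y) b.
Proof.
move=> pG Gb; apply: interior_seq => A cA; have [N HN] := cvgto_gt (cvg_polyfun pG cA) Gb.
by exists N; apply: HN.
Qed.

Lemma cvgs_nf s A b : cvgs A b -> cvgs (fun n => nf s (A n)) (nf s b).
Proof.
by move=> cA i; rewrite /nf; case: (nth None s i) => [j|]; [exact: cA|exact: cvgto_cst].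
Qed.

Lemma interior_not_closed (Q : ('I_8 -> RR) -> Prop) s b :
  (forall A a, cvgs A a -> (forall n, Q (A n)) -> Q a) -> ~ Q (nf s b) ->
  interior (fun y => ~ Q (nf s y)) b.
Proof.
move=> cQ nQ; apply: interior_seq => A cA; apply: NNPP => H; apply: nQ.
apply: (cQ (fun n => nf s (A n))) => [|n]; first exact: cvgs_nf.
by apply: NNPP => h; apply: H; exists n.
Qed.

Lemma good_interior s r r' b :
  interior (fun y => closure (Rint r) (nf s y) /\ closure (Rint r') (nf s y)) b -> good s r r'.
Proof. by move=> /interior_box[d d0 H]; exists b, d. Qed.

Lemma nf_inord (F : fieldType) s (y : 'I_8 -> F) j : (j < 8)%N ->
  nf s y (inord j) = if nth None s j is Some m then y (inord m) else 0.
Proof. by move=> lt; rewrite /nf inordK. Qed.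

Lemma Lf_shift (F : fieldType) (a : 'I_8 -> F) (g : {poly F}) n k : (size g <= n)%N -> (n + k <= 8)%N ->
  Lf a (g * 'X^k) = \sum_(i < n) g`_i * a (inord (i + k)).
Proof.
move=> /poly_sumX {1}-> le; rewrite mulr_suml Lf_sum; apply: eq_bigr => i _.
rewrite -scalerAl LfZ -exprD -(Lf_Xn a (inord _)) inordK //.
by apply: leq_trans le; rewrite -addSn leq_add2r.
Qed.

(* [h] is a quintic killing [a], with inequalities that hold if all its zeros are real. *)
Definition quintic_kernel (a : 'I_8 -> RR) (h : {poly RR}) :=
  [/\ (size h <= 6)%N,
      forall k, (k < 3)%N -> h`_0 * a (inord k) + h`_1 * a (inord k.+1) +
        h`_2 * a (inord k.+2) + h`_3 * a (inord k.+3) + h`_4 * a (inord k.+4) +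
        h`_5 * a (inord k.+4.+1) = 0,
      forall k, 0 <= alt h k,
      forall i j, (i < j)%N -> alt h i * alt h j.+1 <= alt h i.+1 * alt h j &
      (forall t : RR, 0 < t -> h.[t] != 0) -> forall i j, 0 <= h`_i * h`_j].

Lemma quintic_prodf a s : size s = 5%N -> kills 5 a (prodf s) -> quintic_kernel a (prodf s).
Proof.
move=> sz /killsE K; have sh : (size (prodf s) <= 6)%N by have := size_prodf s; rewrite sz.
split=> // [k lt|k|i j lt|].
- rewrite -[RHS](K k lt) (Lf_shift a sh) ?leq_add2l; last by lia.
  by rewrite !big_ord_recr big_ord0 /= add0r.
- by rewrite alt_prodf sqform_ge0.
- by rewrite !alt_prodf sqform_log_concave.
exact: prodf_same_sign.
Qed.

Lemma quintic_forms a : RR_forms 5 a -> exists2 h : {poly RR}, h != 0 & quintic_kernel a h.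
Proof.
move=> [s [sz nz K]]; exists (prodf s); first exact: prodf_nonzero.
exact: quintic_prodf.
Qed.

Lemma quintic_eq0 (h : {poly RR}) : (size h <= 6)%N -> h`_0 = 0 -> h`_1 = 0 -> h`_2 = 0 ->
  h`_3 = 0 -> h`_4 = 0 -> h`_5 = 0 -> h = 0.
Proof.
move=> sh h0 h1 h2 h3 h4 h5; apply/polyP => -[|[|[|[|[|[|i]]]]]]; rewrite coef0 //.
by rewrite nth_default // (leq_trans sh).
Qed.

End InteriorTools.

(** * The wall between ranks six and seven *)

Section Good7.

(** With the binomial weights [7], [35], [21] this is [21 X (X^2 - 1) (X^2 - 4)]: five simple real
    zeros, and a double zero at infinity in degree seven. *)
Definition base7 : 'I_8 -> RR := fun i => [:: 0; 12; 0; -3; 0; 1; 0; 0]`_i.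

(** On the three-dimensional space of quintics satisfying the equations, a positive combination of
    [alt h 1], [alt h 2], [alt h 3] is negative definite. *)
Lemma base7_not5 : ~ RR_forms 5 (nf nf7 base7).
Proof.
move=> /quintic_forms[h h0 [sh K pos _ _]].
have := (K 0 isT, K 1 isT, K 2 isT); rewrite !nf_inord //= /base7 !inordK //= => -[[k0 k1] k2].
have [_ e1 e2 e3] := alt_explicit h.
have h6 : h`_6 = 0 by rewrite nth_default.
have p1 := pos 1; have p2 := pos 2; have p3 := pos 3; rewrite e1 in p1; rewrite e2 in p2.
rewrite e3 h6 in p3.
have x3 : h`_3 = 3 * h`_1 by lra.
have x4 : h`_4 = 3 * h`_2 - 12 * h`_0 by lra.
have x5 : h`_5 = - 3 * h`_1 by lra.
rewrite x3 x4 in p2; rewrite x3 x4 x5 in p3.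
(* The left side is the opposite of [528 * alt h 1 + 100 * alt h 2 + 19 * alt h 3]. *)
have q : 15 * h`_1 ^+ 2 + 14 * h`_2 ^+ 2 + 2400 * h`_0 ^+ 2 <= 0 by nra.
have z0 : h`_0 = 0 by clear -q; nra.
have z1 : h`_1 = 0 by clear -q; nra.
have z2 : h`_2 = 0 by clear -q; nra.
by case/eqP: h0; apply: quintic_eq0; rewrite // ?x3 ?x4 ?x5 ?z0 ?z1 ?z2 ?mulr0 ?subrr.
Qed.

(** A polynomial of degree at most five: the two missing top coefficients of the septic are its
    double zero at infinity. *)
Definition sextic (y : 'I_8 -> RR) : {poly RR} := \poly_(k < 6) (('C(7, k))%:R * y (inord k)).

(* At [e], the septic [sextic y] is multiplied by [1 - e^2 X^2]: its double zero at infinity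
   becomes a pair of simple zeros. *)
Definition bend (y : 'I_8 -> RR) (i : 'I_8) : {poly RR} :=
  (('C(7, i))%:R^-1)%:P * (((sextic y)`_i)%:P -
    (if i is Ordinal k.+2 _ then (sextic y)`_k else 0) *: 'X^2).

Lemma bend0 y i : (bend y i).[0] = nf nf7 y i.
Proof.
rewrite /bend hornerM hornerC hornerD hornerN hornerZ hornerXn expr0n mulr0 subr0 hornerC.
rewrite /sextic coef_poly /nf; have c0 : ('C(7, i))%:R != 0 :> RR.
  by rewrite pnatr_eq0 -lt0n bin_gt0 -ltnS.
case: ltnP => lt; last by rewrite mulr0; case: i lt {c0} => -[|[|[|[|[|[|[|[|]]]]]]]].
rewrite mulKf //; case: i lt {c0} => -[|[|[|[|[|[|]]]]]] //.
Qed.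

Lemma binpoly_bend y e : binpoly 7 (moments (fun i => (bend y i).[e]) 1) =
  sextic y * (1 - e ^+ 2 *: 'X^2).
Proof.
apply/polyP => k; rewrite coef_binpoly mulrBr mulr1 coefB -scalerAr coefZ coefMXn.
have [lt|ge] := ltnP k 8; last first.
  have z j : (6 <= j)%N -> (sextic y)`_j = 0 by rewrite leqNgt coef_poly; case: ifP.
  rewrite bin_small // mul0r !z ?(leq_trans _ ge) //; last by lia.
  by case: ifP => _; rewrite mulr0 subr0.
have c0 : ('C(7, k))%:R != 0 :> RR by rewrite pnatr_eq0 -lt0n bin_gt0 -ltnS.
rewrite /moments mul1r (Lf_Xn _ (Ordinal lt)) /bend hornerM hornerC mulrA divff // mul1r.
rewrite hornerD hornerN hornerC hornerZ hornerXn /= [_ * e ^+ 2]mulrC.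
by case: k lt {c0} => [|[|k]] lt //=; rewrite subn2.
Qed.

(** The zeros of [sextic y] lie in [(-3, 3)] while those of [1 - e^2 X^2] have absolute value above
    3, so the bent septic has seven simple real zeros. *)
Lemma bend_Rint7 y (t : seq RR) c e : uniq t -> size t = 5%N -> c != 0 ->
  sextic y = c *: rootsp t -> {in t, forall x : RR, `|x| < 3} -> 0 < e < 1 / 3 ->
  Rint 7 (fun i => (bend y i).[e]).
Proof.
move=> ut st c0 E t3 /andP[e0 e3].
pose s : seq (RR * RR) := [:: (1, e), (1, - e) & [seq (- x, 1) | x <- t]].
have sz : simple_zeros 7 (binpoly 7 (moments (fun i => (bend y i).[e]) 1)).
  rewrite binpoly_bend E; exists s, c; split=> //.
  - by rewrite /= size_map st.
  - move=> l; rewrite !inE => /or3P[/eqP ->|/eqP ->|/mapP[x _ ->]]; rewrite xpair_eqE oner_eq0 ?andbF //.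
  - rewrite /= pairwise_map; apply/and3P; split.
    + rewrite /indep /det2 /= mulr1 !mul1r; apply/andP; split.
        by apply/negP => /eqP; lra.
      apply/allP => _ /mapP[x /t3 hx ->]; rewrite /indep /det2 /= mulr1 mulrN opprK.
      move: hx; rewrite ltr_norml => /andP[h1 h2]; apply: lt0r_neq0; nra.
    + apply/allP => _ /mapP[x /t3 hx ->]; rewrite /indep /det2 /= mulr1 mulrNN.
      move: hx; rewrite ltr_norml => /andP[h1 h2]; apply: lt0r_neq0; nra.
    move: ut; rewrite uniq_pairwise; apply: sub_pairwise => x x'.
    by rewrite /indep /det2 /= mulr1 mul1r opprK addrC subr_eq0 eq_sym.
  rewrite /s !prodf_cons /lf /= -scalerAl; congr (_ *: _).
  have -> : rootsp t = prodf [seq (- x, 1) | x <- t].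
    rewrite /rootsp /prodf big_map; apply: eq_bigr => x _.
    by rewrite /lf /= scale1r polyCN addrC.
  rewrite mulrA [LHS]mulrC; congr (_ * _).
  by rewrite -!mul_polyC !polyCN !polyC_exp; ring.
have n6 : ~ RR_forms 6 (fun i => (bend y i).[e]).
  by move=> [r [sr nr Kr]]; apply: (simple_zeros_not_killed sz nr sr Kr).
apply: Rint_intro => //; first exact: key7.
move=> [q [q0 sq K]]; apply: n6; exists (nseq 6 (1, 0)); split; rewrite ?size_nseq //.
  by move=> l /nseqP[-> _]; rewrite xpair_eqE oner_eq0.
have [k k0 Eq] : exists2 k, k != 0 & q = k%:P.
  by move: sq => /size1_polyC Eq; exists q`_0; rewrite // -polyC_eq0 -Eq.
rewrite prodf_nseq /lf /= scale0r addr0 expr1n => p sp.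
have -> : 1 * p = k^-1 *: (q * p) by rewrite mul1r Eq mul_polyC scalerA mulVf // scale1r.
rewrite LfZ K ?mulr0 //.
by apply: leq_trans sp _.
Qed.

(** The test points separate [-2, -1, 0, 1, 2], the zeros at [base7]; five sign changes exhaust the
    degree. *)
Lemma sextic_roots (y : 'I_8 -> RR) : 0 < y (inord 5) -> (sextic y).[-3] < 0 ->
  0 < (sextic y).[- (3 / 2)] -> (sextic y).[- (1 / 2)] < 0 -> 0 < (sextic y).[1 / 2] ->
  (sextic y).[3 / 2] < 0 -> 0 < (sextic y).[3] ->
  exists (t : seq RR) c, [/\ uniq t, size t = 5%N, c != 0, sextic y = c *: rootsp t &
    {in t, forall x : RR, `|x| < 3}].
Proof.
move=> y5 v0 v1 v2 v3 v4 v5; set f := sextic y in v0 v1 v2 v3 v4 v5 *.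
have R (a b : RR) : a <= b -> f.[a] * f.[b] < 0 -> {x : RR | a < x < b & f.[x] = 0}.
  by move=> ab h; have [x] := poly_ivtoo ab h; rewrite in_itv /= => h1 /rootP h2; exists x.
have [||x1 /andP[a1 b1] r1] := R (-3) (- (3 / 2)); [lra|nra|].
have [||x2 /andP[a2 b2] r2] := R (- (3 / 2)) (- (1 / 2)); [lra|nra|].
have [||x3 /andP[a3 b3] r3] := R (- (1 / 2)) (1 / 2); [lra|nra|].
have [||x4 /andP[a4 b4] r4] := R (1 / 2) (3 / 2); [lra|nra|].
have [||x5 /andP[a5 b5] r5] := R (3 / 2) 3; [lra|nra|].
pose t : seq RR := [:: x1; x2; x3; x4; x5].
have ut : uniq t.
  apply: (@lt_sorted_uniq _ RR); rewrite /= andbT.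
  by clear -a1 b1 a2 b2 a3 b3 a4 b4 a5 b5; apply/and4P; split; lra.
have f5 : f`_5 != 0.
  by rewrite /f /sextic coef_poly /= mulf_neq0 ?pnatr_eq0 // lt0r_neq0.
have sf : size f = 6%N.
  apply/eqP; rewrite eqn_leq size_poly ltnNge; apply: contra f5 => /leq_sizeP/(_ 5 isT) ->.
  by rewrite eqxx.
exists t, (lead_coef f); split=> //.
- by rewrite lead_coef_eq0 -size_poly_gt0 sf.
- apply: all_roots_prod_XsubC; [by rewrite sf| |by rewrite uniq_rootsE].
  by rewrite /= /root r1 r2 r3 r4 r5 eqxx.
by clear -a1 b1 a2 b2 a3 b3 a4 b4 a5 b5 => x; rewrite !inE ltr_norml => /or4P[/eqP ->|/eqP ->|/eqP ->|/orP[]/eqP ->]; apply/andP; split; lra.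
Qed.

Lemma interior_sextic b c x : 0 < c * (sextic b).[x] -> interior (fun y => 0 < c * (sextic y).[x]) b.
Proof.
apply: (interior_pos (G := fun y => c * (sextic y).[x])).
apply: polyfun_mul; first exact: polyfun_cst.
apply: (polyfun_ext (F := fun y : 'I_8 -> RR => \sum_(i < 6) ('C(7, i))%:R * y (inord i) * x ^+ i)).
  by move=> y; rewrite horner_poly.
apply: polyfun_sum => i _; apply: polyfun_mul; last exact: polyfun_cst.
by apply: polyfun_mul; [exact: polyfun_cst|exact: polyfun_var].
Qed.

(** Functionals in this normal form are killed by [X^6], and a non-zero coordinate 5 followed by
    zeros excludes a killing linear form. *)
Lemma closure_Rint6 y : ~ RR_forms 5 (nf nf7 y) -> 0 < y (inord 5) -> closure (Rint 6) (nf nf7 y).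
Proof.
move=> n5 y5; apply: closure_Rint => //.
  exists (nseq 6 (0, 1)); split; rewrite ?size_nseq //.
    by move=> l /nseqP[-> _]; rewrite xpair_eqE oner_eq0 andbF.
  rewrite prodf_nseq /lf /= scale1r add0r; apply/killsE => k lt; rewrite -exprD.
  have lt8 : (6 + k < 8)%N by lia.
  by rewrite (Lf_Xn _ (Ordinal lt8)) /nf /=; case: k lt {lt8} => [|[|]].
move=> [q [q0 sq /killsE K]]; case/eqP: q0.
have q2 k : (k < 7)%N -> q`_0 * nf nf7 y (inord k) + q`_1 * nf nf7 y (inord k.+1) = 0.
  by move=> lt; rewrite -[RHS](K k lt) (Lf_shift _ sq) // !big_ord_recl big_ord0 /= addr0 add0n.
have := q2 5 isT; rewrite !nf_inord //= mulr0 addr0 => /eqP.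
rewrite mulf_eq0 (gt_eqF y5) orbF => /eqP z0.
have := q2 4 isT; rewrite !nf_inord //= z0 mul0r add0r => /eqP.
rewrite mulf_eq0 (gt_eqF y5) orbF => /eqP z1.
by apply/polyP => -[|[|k]]; rewrite coef0 // nth_default // (leq_trans sq).
Qed.

Lemma good7 : good nf7 6 7.
Proof.
apply: (@good_interior _ _ _ base7).
have sb x : (sextic base7).[x] = 84 * x - 105 * x ^+ 3 + 21 * x ^+ 5.
  rewrite horner_poly !big_ord_recl big_ord0 /= /bump /= /base7 !inordK //= !binS ?bin0 ?bin0n /=; ring.
have n5 := interior_not_closed (@RR_forms_closed 5) base7_not5.
have i5 : interior (fun y => 0 < y (inord 5)) base7.
  apply: interior_pos; first exact: polyfun_var.
  by rewrite /base7 inordK.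
have [v0 [v1 [v2 [v3 [v4 v5]]]]] : interior (fun y => 0 < -1 * (sextic y).[-3]) base7 /\
  interior (fun y => 0 < 1 * (sextic y).[- (3 / 2)]) base7 /\
  interior (fun y => 0 < -1 * (sextic y).[- (1 / 2)]) base7 /\
  interior (fun y => 0 < 1 * (sextic y).[1 / 2]) base7 /\
  interior (fun y => 0 < -1 * (sextic y).[3 / 2]) base7 /\
  interior (fun y => 0 < 1 * (sextic y).[3]) base7.
  by do ![split]; apply: interior_sextic; rewrite sb; lra.
have := interiorI n5 (interiorI i5 (interiorI v0 (interiorI v1 (interiorI v2
  (interiorI v3 (interiorI v4 v5)))))).
apply: interior_imp => y [m5 [y5 [w0 [w1 [w2 [w3 [w4 w5]]]]]]].
split; first exact: closure_Rint6.
have [||||||t [c [ut st c0 E t3]]] := sextic_roots y5; try lra.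
rewrite (_ : nf nf7 y = fun i => (bend y i).[0]); last first.
  by apply: functional_extensionality => i; rewrite bend0.
apply: closure_path; exists (1 / 3); first lra.
by move=> e he; apply: bend_Rint7 E t3 he.
Qed.

End Good7.

Section PathInterior.

Lemma near0_interior (A : 'I_8 -> {poly RR}) (S : ('I_8 -> RR) -> Prop) :
  interior S (fun i => (A i).[0]) -> near0 (fun e : RR => S (fun i => (A i).[e])).
Proof.
move=> /interior_box[d d0 H].
have : near0 (fun e : RR => {in enum 'I_8, forall i, 0 < d ^+ 2 - ((A i).[e] - (A i).[0]) ^+ 2}).
  apply: near0_all => i _.
  have := @near0_poly _ ((d ^+ 2)%:P - (A i - ((A i).[0])%:P) ^+ 2).
  rewrite !hornerE subrr expr0n subr0 exprn_gt0 // => /(_ isT).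
  by apply: near0_imp => e _; rewrite !hornerE.
apply: near0_imp => e _ h; apply: H => i; rewrite -ltr_sqr ?nnegrE ?(ltW d0) //.
by rewrite real_normK ?num_real // -subr_gt0; apply: h; rewrite mem_enum.
Qed.

End PathInterior.

(** * The wall between ranks four and five *)

Section Good322.
Implicit Types (y a : 'I_8 -> RR).

Definition base322 : 'I_8 -> RR := fun i => [:: 0; 1; 1; 0; 0; 0; 0; 0]`_i.

Lemma killed_by_in k a : (k <= 3)%N -> killed_by k a -> killed_in 4 3 a.
Proof.
move=> k3 [q [q0 sq K]]; exists q; split=> //; first exact: leq_trans sq _.
by move=> p sp; apply: K; apply: leq_trans sp _; lia.
Qed.

(** A two-dimensional space of killing quartics would contain one without leading term; excluding
    these leaves only the multiples of [X^2 (X^2 - 1)]. *)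
Lemma base322_rigid : ~ killed_in 4 3 (nf nf322 base322).
Proof.
move=> [q [q0 sq /killsE K]]; case/eqP: q0.
have E k : (k < 4)%N -> q`_0 * nf nf322 base322 (inord k) + q`_1 * nf nf322 base322 (inord k.+1) +
    q`_2 * nf nf322 base322 (inord k.+2) + q`_3 * nf nf322 base322 (inord k.+3) = 0.
  move=> lt; rewrite -[RHS](K k lt) (Lf_shift _ sq); last by lia.
  by rewrite !big_ord_recr big_ord0 /= add0r.
have := (E 0 isT, E 1 isT, (E 2 isT, E 3 isT)).
rewrite !nf_inord //= /base322 !inordK //= => -[[e0 e1] [e2 e3]].
by apply/polyP => -[|[|[|[|k]]]]; rewrite coef0; [lra|lra|lra|lra|rewrite nth_default // (leq_trans sq)].
Qed.

(* At [e], the killing form [X^2 (X^2 - 1)] is replaced by [(X^2 + e) (X^2 - 1)], which has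
   non-real zeros. *)
Definition bent4 (y : 'I_8 -> RR) : 'I_8 -> {poly RR} :=
  let a k := (y (inord k))%:P in
  let b4 := (1%:P - 'X) * a 2%N + 'X * a 0%N in
  let b5 := (1%:P - 'X) * a 3%N + 'X * a 1%N in
  fun i => [:: a 0%N; a 1%N; a 2%N; a 3%N; b4; b5; (1%:P - 'X) * b4 + 'X * a 2%N; (1%:P - 'X) * b5 + 'X * a 3%N]`_i.

Lemma bent4_0 y : (fun i => (bent4 y i).[0]) = nf nf322 y.
Proof.
apply: functional_extensionality => -[i lt]; rewrite /nf /bent4 /=.
case: i lt => [|[|[|[|[|[|[|[|//]]]]]]]] lt /=;
by rewrite !(hornerD, hornerN, hornerM, hornerC, hornerX) ?(subr0, mul1r, mul0r, addr0).
Qed.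

Lemma kills_bent4 y e : kills 4 (fun i => (bent4 y i).[e]) (('X^2 + e%:P) * ('X^2 - 1)).
Proof.
have -> : ('X^2 + e%:P) * ('X^2 - 1) = Poly [:: - e; 0; - (1 - e); 0; 1].
  apply/polyP => i; rewrite coef_Poly mulrDl mulrBr mulr1 -exprD mulrBr mulr1.
  rewrite !(coefD, coefN, coefXn, coefC, coefCM).
  by case: i => [|[|[|[|[|i]]]]] /=; rewrite ?nth_nil; ring.
apply/killsE => k lt; rewrite (@Lf_shift _ _ _ 5); [|exact: size_Poly|lia].
rewrite !big_ord_recr big_ord0 !coef_Poly /= /bent4.
by case: k lt => [|[|[|[|//]]]] _; rewrite !inordK //= !(hornerD, hornerN, hornerM, hornerC, hornerX); ring.
Qed.

(** The quartic [X^2 (X^2 - 1)], completed by a zero at infinity, has one double zero; an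
    obstruction to splitting it is a killing cubic, which is excluded. *)
Lemma rank5_322 y : ~ killed_in 4 3 (nf nf322 y) -> rank_le (nf nf322 y) 5.
Proof.
move=> nk; pose D : seq ((RR * RR) * nat) :=
  [:: ((0, 1), 2%N); ((-1, 1), 1%N); ((1, 1), 1%N); ((1, 0), 1%N)].
have K4 : kills 4 (nf nf322 y) ('X^2 * ('X^2 - 1)).
  by have := kills_bent4 y 0; rewrite bent4_0 addr0.
have E : 'X^2 * ('X^2 - 1) = lf (0, 1) ^+ 2 * (lf (-1, 1) * lf (1, 1)) :> {poly RR}.
  by rewrite /lf /= !scale1r; ring.
apply: (@split_forms 5 _ D) => //.
- rewrite /D /wf /= !xpair_eqE !oner_eq0 !andbF /= /indep /det2 /= !andbT.
  by do ![apply/andP; split]; apply/negP => /eqP; lra.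
- rewrite /D !prodm_cons /prodm big_nil /= !expr1 mulr1.
  have -> : lf (1, 0) = 1 :> {poly RR} by rewrite /lf /= scale0r addr0.
  by rewrite mulr1 -E => p sp; apply: K4; apply: leq_trans sp _.
move=> q sq; rewrite /D !prodm_cons /prodm big_nil /= !expr0 !mulr1 expr1 => Kq.
apply/eqP/negPn/negP => q0; apply: nk; apply: (@killed_by_in 3) => //; exists (lf (0, 1) * q).
split=> //; last by apply: leq_trans (size_mul_leq3 (size_lf _) sq) _.
by rewrite mulf_neq0 // -lf_neq0 xpair_eqE oner_eq0 andbF.
Qed.

(** Rigidity makes every killing quartic a multiple of [(X^2 + e) (X^2 - 1)], for which [alt h 1] is
    negative when [0 < e < 1]. *)
Lemma bent4_not4 y e : 0 < e < 1 -> ~ killed_in 4 3 (fun i => (bent4 y i).[e]) ->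
  ~ RR_forms 4 (fun i => (bent4 y i).[e]).
Proof.
move=> /andP[e0 e1] nk [s [sz nz K]]; set h := prodf s in K.
have h0 : h != 0 by apply: prodf_nonzero.
have sh : (size h <= 5)%N by rewrite -sz size_prodf.
set g := ('X^2 + e%:P) * ('X^2 - 1) : {poly RR}.
have Kg : kills 4 (fun i => (bent4 y i).[e]) g by apply: kills_bent4.
have gE : g = Poly [:: - e; 0; - (1 - e); 0; 1].
  apply/polyP => i; rewrite coef_Poly /g mulrDl mulrBr mulr1 -exprD mulrBr mulr1.
  rewrite !(coefD, coefN, coefXn, coefC, coefCM).
  by case: i => [|[|[|[|[|i]]]]] /=; rewrite ?nth_nil; ring.
have E : h = h`_4 *: g.
  apply/eqP; rewrite -subr_eq0; apply/negPn/negP => ne; apply: nk.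
  exists (h - h`_4 *: g); split=> //.
    apply/leq_sizeP => j le; rewrite coefB coefZ gE coef_Poly.
    case: (ltngtP j 4) le => // [lt _|-> _]; last by rewrite /= mulr1 subrr.
    by rewrite [h`_j]nth_default ?(leq_trans sh) // [_`_j]nth_default // mulr0 subr0.
  by move=> p sp; rewrite mulrBl -scalerAl LfB LfZ K // Kg // mulr0 subrr.
have h4 : h`_4 != 0 by apply: contraNneq h0 => z; rewrite E z scale0r.
have : 0 <= alt h 1 by rewrite alt_prodf sqform_ge0.
have [_ -> _ _] := alt_explicit h; rewrite E !coefZ gE !coef_Poly /=.
have : 0 < h`_4 ^+ 2 by rewrite exprn_even_gt0.
have : 0 < e * (1 - e) by rewrite mulr_gt0 // subr_gt0.
move: (h`_4) => c p c0 n; have : 0 < c ^+ 2 * (e * (1 - e)) by rewrite mulr_gt0.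
by nra.
Qed.

Lemma good322 : good nf322 4 5.
Proof.
apply: (@good_interior _ _ _ base322).
apply: interior_imp (interior_not_closed (@killed_in_closed 4 3) base322_rigid) => y nk.
split.
  apply: closure_Rint => //.
  - exists [:: (0, 1); (0, 1); (-1, 1); (1, 1)]; split=> //.
      by move=> l; rewrite !inE => /or4P[]/eqP ->; rewrite xpair_eqE oner_eq0 ?andbF.
    have := kills_bent4 y 0; rewrite bent4_0 addr0; congr (kills _ _ _).
    by rewrite !prodf_cons prodf_nil /lf /= !scale1r; ring.
  - by move=> /RR_forms_killed/(@killed_by_in 3 _ isT).
  by move=> /(@killed_by_in 3 _ isT).
(* Rank at most five is open at the normal form, so it holds along the beginning of the path
   [bent4], where rank four fails. *)
rewrite -bent4_0; apply: closure_path.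
have n2 : ~ killed_by (7 - 5) (nf nf322 y) by move=> /(@killed_by_in 2 _ isT).
have I := @rank_le_open 5 _ isT (rank5_322 nk) n2.
have J : interior (fun a => ~ killed_in 4 3 a) (nf nf322 y).
  apply: interior_seq => A cA; apply: NNPP => H; apply: nk; apply: (killed_in_closed cA) => n.
  by apply: NNPP => h; apply: H; exists n.
have := near0_interior (A := bent4 y) (S := fun a => rank_le a 5 /\ ~ killed_in 4 3 a).
rewrite bent4_0 => /(_ (interiorI I J)) h.
have h1 : near0 (fun e : RR => e < 1) by exists 1 => // e /andP[].
apply: near0_imp (near0_and h h1) => e e0 [[r5 nk'] e1].
apply: Rint_intro => //; first by move=> /(@killed_by_in 2 _ isT).
by apply: bent4_not4; rewrite ?e0.
Qed.

End Good322.

(** * Quintics with real zeros near a monomial *)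

Section QuinticLimit.
Implicit Types (a b : 'I_8 -> RR) (h : {poly RR}).

Definition eventually (P : nat -> Prop) := exists N, forall n, (N <= n)%N -> P n.

Lemma eventually_all (T : finType) (P : T -> nat -> Prop) :
  (forall i, eventually (P i)) -> eventually (fun n => forall i, P i n).
Proof.
move=> H; have [N HN] := ClassicalEpsilon.choice _ H.
exists (\max_i N i) => n le i; apply: HN; exact: leq_trans (leq_bigmax i) le.
Qed.

Lemma quintic_kernelZ a h c : quintic_kernel a h -> quintic_kernel a (c *: h).
Proof.
move=> [sh K pos lc sg]; have [->|c0] := eqVneq c 0.
  have z k : alt (0 *: h) k = 0 by rewrite altZ expr0n mul0r.
  split=> // [|k lt|k|i j lt|_ i j]; rewrite ?z ?mulr0 ?scale0r ?size_poly0 ?coef0 ?mulr0 //.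
  by rewrite !mul0r !addr0.
split=> [|k lt|k|i j lt|H i j].
- exact: leq_trans (size_scale_leq _ _) sh.
- rewrite !coefZ; apply: etrans (_ : c * (h`_0 * a (inord k) + h`_1 * a (inord k.+1) +
      h`_2 * a (inord k.+2) + h`_3 * a (inord k.+3) + h`_4 * a (inord k.+4) +
      h`_5 * a (inord k.+4.+1)) = 0); first by ring.
  by rewrite K // mulr0.
- by rewrite altZ mulr_ge0 ?sqr_ge0.
- rewrite !altZ ![_ ^+ 2 * alt h _ * _]mulrACA ler_wpM2l ?lc //.
  by rewrite -expr2 exprn_even_ge0.
rewrite !coefZ mulrACA mulr_ge0 // ?sg //; first by rewrite -expr2 sqr_ge0.
by move=> t t0; have := H t t0; rewrite hornerZ; apply: contraNneq => ->; rewrite mulr0.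
Qed.

(* If the only quintic with real zeros killing [b] is a monomial, quintics with real zeros
   killing nearby functionals are close to that monomial. *)
Lemma quintic_limit b A (p : nat) (eta : RR) : cvgs A b -> (forall n, RR_forms 5 (A n)) -> 0 < eta ->
  (forall h, quintic_kernel b h -> forall i, (i < 6)%N -> i != p -> h`_i = 0) ->
  exists n h, [/\ forall i, `|A n i - b i| < eta, quintic_kernel (A n) h, h`_p = 1 &
    forall i, (i < 6)%N -> i != p -> `|h`_i| <= eta].
Proof.
move=> cA /(forms_compact cA)[phi [X [x [ephi cX K Kx [nzX nzx]]]]] eta0 H.
set hx := prodf (forms_of x) in Kx.
have qx : quintic_kernel b hx by apply: quintic_prodf; rewrite ?size_forms_of.
have hx0 : hx != 0 by apply: prodf_nonzero.
have hp : hx`_p != 0.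
  apply: contraNneq hx0 => hp; apply/eqP/polyP => i; rewrite coef0.
  have [lt|ge] := ltnP i 6; last by rewrite nth_default // (leq_trans _ ge) //; case: qx.
  by have [->//|ne] := eqVneq i p; apply: H qx i lt ne.
pose h n := prodf (forms_of (X n)).
have ch i : cvgto (fun n => (h n)`_i) hx`_i by apply: (cvg_polyfun (@polyfun_prodf 5 i) cX).
have ev1 : eventually (fun n => forall i : 'I_8, `|A (phi n) i - b i| < eta).
  apply: eventually_all => i; have [N HN] := cA i eta eta0.
  by exists N => n le; apply: HN; apply: leq_trans le (ephi n).
have ev2 : eventually (fun n => forall i : 'I_6, i != p :> nat -> `|(h n)`_i| < eta * `|(h n)`_p|).
  apply: eventually_all => i; have [->|ne] := eqVneq (i : nat) p; first by exists 0%N.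
  have c1 : cvgto (fun n => eta * `|(h n)`_p| + -1 * `|(h n)`_i|) (eta * `|hx`_p| + -1 * `|hx`_i|).
    by apply: cvgtoD; apply: cvgtoM; try exact: cvgto_cst; apply: cvgto_abs.
  have pos : 0 < eta * `|hx`_p| + -1 * `|hx`_i|.
    by rewrite (H _ qx i) // normr0 mulr0 addr0 mulr_gt0 // normr_gt0.
  have [N HN] := cvgto_gt c1 pos; exists N => n le _.
  by have := HN n le; rewrite mulN1r subr_gt0.
have [N1 H1] := ev1; have [N2 H2] := ev2; set n := maxn N1 N2.
have {}H1 := H1 n (leq_maxl _ _); have {}H2 := H2 n (leq_maxr _ _).
have lt6 : (5 < 6)%N by [].
have hn0 : (h n)`_p != 0.
  apply/negP => /eqP z; have [i ne] : exists i : 'I_6, i != p :> nat.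
    by have [e|ne] := eqVneq p 0%N; [exists (Ordinal lt6); rewrite e|exists ord0; rewrite eq_sym].
  by have := H2 i ne; rewrite z normr0 mulr0 normr_lt0.
exists (phi n), (((h n)`_p)^-1 *: h n); split=> //.
- by apply: quintic_kernelZ; apply: quintic_prodf; rewrite ?size_forms_of.
- by rewrite coefZ mulVf.
move=> i lt ne; rewrite coefZ normrM normfV mulrC ler_pdivrMr ?normr_gt0 //.
exact: ltW (H2 (Ordinal lt) ne).
Qed.

End QuinticLimit.

(** * The wall of [l^3 m^2] between ranks five and six *)

Section Good43.
Implicit Types (y a w : 'I_8 -> RR).

Definition base43 : 'I_8 -> RR := fun i => [:: 0; 0; 1; 0; 0; 0; 1; 0]`_i.

(** The killing quartics are the multiples of [1 - X^4], for which [alt h 2] is negative. *)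
Lemma base43_not4 : ~ RR_forms 4 (nf nf43 base43).
Proof.
move=> [s [sz nz /killsE K]]; have h0 := prodf_nonzero nz.
have sh : (size (prodf s) <= 5)%N by have := size_prodf s; rewrite sz.
have := sqform_ge0 s 2; rewrite -alt_prodf.
set h := prodf s in K h0 sh *; have [_ _ -> _] := alt_explicit h.
have E k : (k < 4)%N -> h`_0 * nf nf43 base43 (inord k) + h`_1 * nf nf43 base43 (inord k.+1) +
    h`_2 * nf nf43 base43 (inord k.+2) + h`_3 * nf nf43 base43 (inord k.+3) +
    h`_4 * nf nf43 base43 (inord k.+4) = 0.
  move=> lt; rewrite -[RHS](K k lt) (Lf_shift _ sh); last by lia.
  by rewrite !big_ord_recr big_ord0 /= add0r.
have := (E 0 isT, E 1 isT, (E 2 isT, E 3 isT)).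
rewrite !nf_inord //= /base43 !inordK //= => -[[e0 e1] [e2 e3]] A2.
have x1 : h`_1 = 0 by lra.
have x2 : h`_2 = 0 by lra.
have x3 : h`_3 = 0 by lra.
have x4 : h`_4 = - h`_0 by lra.
rewrite x1 x2 x3 x4 in A2.
have x0 : h`_0 = 0 by nra.
case/eqP: h0; apply: quintic_eq0; rewrite // ?x4 ?x0 ?oppr0 //; first exact: leq_trans sh _.
by rewrite nth_default.
Qed.

(** Adding [alt h 2] and [alt h 4] leaves the opposite of the square of the constant term; then the
    coefficients 1 and 3 have product zero and [alt h 3] settles the rest. What survives is [X^3],
    that is [l^3 m^2] with [m] at infinity. *)
Lemma base43_quintic h : quintic_kernel (nf nf43 base43) h ->
  forall i, (i < 6)%N -> i != 3%N -> h`_i = 0.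
Proof.
move=> [sh K pos _ _].
have := (K 0 isT, K 1 isT, K 2 isT); rewrite !nf_inord //= /base43 !inordK //= => -[[k0 k1] k2].
have [_ _ e2 e3] := alt_explicit h; have [e4 _] := alt_quintic sh.
have h6 : h`_6 = 0 by rewrite nth_default.
have p2 := pos 2; have p3 := pos 3; have p4 := pos 4.
rewrite e2 in p2; rewrite e3 h6 in p3; rewrite e4 in p4.
have x2 : h`_2 = 0 by lra.
have x5 : h`_5 = - h`_1 by lra.
have x4 : h`_4 = - h`_0 by lra.
rewrite x2 x4 in p2; rewrite x2 x4 x5 in p3; rewrite x4 x5 in p4.
have x0 : h`_0 = 0.
  have : h`_0 ^+ 2 <= 0 by lra.
  by rewrite le_eqVlt ltNge sqr_ge0 orbF sqrf_eq0 => /eqP.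
rewrite x0 in p2 p3 p4.
have x13 : h`_1 * h`_3 = 0 by lra.
have x1 : h`_1 = 0.
  move/eqP: x13; rewrite mulf_eq0 => /orP[/eqP //|/eqP x3]; rewrite x3 in p3.
  have : h`_1 ^+ 2 <= 0 by lra.
  by rewrite le_eqVlt ltNge sqr_ge0 orbF sqrf_eq0 => /eqP.
by case=> [|[|[|[|[|[|]]]]]] // _ _; rewrite ?x4 ?x5 ?x0 ?x1 ?oppr0.
Qed.

Lemma mul_small (e x z : RR) : `|z| <= e -> - (e * `|x|) <= x * z <= e * `|x|.
Proof. by move=> h; rewrite -ler_norml normrM mulrC ler_wpM2r. Qed.

Lemma norm_range (x : RR) : - `|x| <= x <= `|x|.
Proof. by rewrite -ler_norml. Qed.

(* Adding up the equations, [A2 + A4 + 2 d] is at most a small multiple of itself. *)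
Lemma local43 (a0 a1 a2 a6 a7 d h0 h1 h2 h4 h5 : RR)
    (A0 := h0 ^+ 2) (A1 := h1 ^+ 2 - 2 * h0 * h2) (A2 := h2 ^+ 2 - 2 * h1 + 2 * h0 * h4)
    (A3 := 1 - 2 * h2 * h4 + 2 * h1 * h5) (A4 := h4 ^+ 2 - 2 * h5) (e := 1 / 100 : RR) :
  `|a0| <= e -> `|a1| <= e -> `|a2 - 1| <= e -> `|a6 - 1| <= e -> `|a7| <= e -> 0 < d <= e ->
  `|h0| <= e -> `|h1| <= e -> `|h2| <= e -> `|h4| <= e -> `|h5| <= e ->
  h0 * a0 + h1 * a1 + h2 * a2 - d * h4 = 0 -> h0 * a1 + h1 * a2 - d + h5 * a6 = 0 ->
  h0 * a2 - d * h2 + h4 * a6 + h5 * a7 = 0 ->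
  0 <= A2 -> 0 <= A4 -> A0 * A3 <= A1 * A2 -> A1 * A3 <= A2 * A2 -> False.
Proof.
move=> s0 s1 s2 s6 s7 /andP[d0 de] t0 t1 t2 t4 t5 E0 E1 E2 p2 p4 c1 c2.
have A3l : 9 / 10 <= A3.
  by have := mul_small h2 t4; have := mul_small h1 t5; rewrite /A3 /e in t1 t2 *; lra.
have A2u : A2 <= 3 / 100.
  have := mul_small h2 t2; have := mul_small h0 t4; have := norm_range h1.
  by rewrite /A2 /e in t0 t1 t2 *; lra.
(* Log-concavity twice: [A0 A3^2 <= A1 A2 A3 <= A2^3], with [A3] close to one. Hence [h0] is small
   against [A2]. *)
have h0A : 81 * h0 ^+ 2 <= 100 * A2 ^+ 3.
  have A3p : 0 <= A3 by lra.
  have c3 : A0 * A3 * A3 <= A2 ^+ 3.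
    apply: le_trans (ler_wpM2r A3p c1) _; rewrite mulrAC.
    by apply: le_trans (ler_wpM2r p2 c2) _; rewrite le_eqVlt; apply/orP; left; apply/eqP; ring.
  have c4 : 81 / 100 <= A3 * A3 by nra.
  have c5 : 0 <= A0 by apply: sqr_ge0.
  have : A0 * (81 / 100) <= A0 * (A3 * A3) by apply: ler_wpM2l.
  by rewrite /A0 in c3 *; lra.
have x0 : `|h0| <= A2 / 4.
  have : `|h0| ^+ 2 <= (A2 / 4) ^+ 2.
    rewrite real_normK ?num_real //.
    have : A2 ^+ 3 <= 3 / 100 * A2 ^+ 2 by rewrite exprS ler_wpM2r // sqr_ge0.
    by have := sqr_ge0 A2; lra.
  by rewrite ler_sqr ?nnegrE ?divr_ge0.
have := mul_small h0 s0; have := mul_small h1 s1; have := mul_small h2 s2.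
have := mul_small d t4; have := mul_small h2 t2; have := mul_small h0 t4.
have := mul_small h0 s2; have := mul_small d t2; have := mul_small h4 s6.
have := mul_small h5 s7; have := mul_small h4 t4; have := mul_small h0 s1.
have := mul_small h1 s2; have := mul_small h5 s6.
rewrite (gtr0_norm d0).
have eA2 : A2 = h2 * h2 - 2 * h1 + 2 * (h0 * h4) by rewrite /A2; ring.
have eA4 : A4 = h4 * h4 - 2 * h5 by rewrite /A4; ring.
move: (A2) (A4) eA2 eA4 p2 p4 x0 => B2 B4 eA2 eA4 p2 p4 x0; rewrite /e.
move=> m1 m2 m3 m4 m5 m6 m7 m8 m9 m10 m11 m12 m13 m14.
have y2 : `|h2| <= 1 / 100 * (`|h0| + `|h1| + `|h2| + d).
  by clear -E0 d0 m14 m13 m12 m11; rewrite ler_norml; apply/andP; split; lra.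
have y1 : `|h1| <= (1 / 100 * `|h2| + 2 / 100 * `|h0| + B2) / 2.
  by clear -eA2 p2 m10 m9; rewrite ler_norml; apply/andP; split; lra.
have y4 : `|h4| <= `|h0| + 1 / 100 * (`|h0| + d + `|h4| + `|h5|).
  by have := norm_range h0; clear -E2 d0 m8 m7 m6 m5; rewrite ler_norml => z; apply/andP; split; lra.
have y5 : `|h5| <= (1 / 100 * `|h4| + B4) / 2.
  by clear -eA4 p4 m4; rewrite ler_norml; apply/andP; split; lra.
by clear -E1 eA2 eA4 y1 y2 y4 y5 x0 p2 p4 d0 m10 m9 m4 m3 m2 m1; lra.
Qed.

End Good43.

(** * Functionals killed by a quintic with two zeros *)

Section TwoRoots.
Implicit Types (a y : 'I_8 -> RR).

Lemma pow_kernel (a : 'I_8 -> RR) p : (p + 3 <= 8)%N -> a (inord p) = 0 -> a (inord p.+1) = 0 ->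
  a (inord p.+2) = 0 -> kills 5 a 'X^p.
Proof.
move=> le h0 h1 h2; apply/killsE => k lt; rewrite -exprD.
have E j : (j < 8)%N -> Lf a 'X^j = a (inord j) by move=> lj; rewrite -(Lf_Xn a (inord j)) inordK.
rewrite E; last by lia.
by case: k lt => [|[|[|//]]] _; rewrite ?addn0 ?addn1 ?addn2.
Qed.

Lemma linear_kernel a (g q : {poly RR}) i k : g = 'X^i -> (size q <= 2)%N -> (i + k < 7)%N ->
  Lf a (g * q * 'X^k) = q`_0 * a (inord (i + k)) + q`_1 * a (inord (i + k).+1).
Proof.
move=> -> sq lt; rewrite mulrAC mulrC mulrC -exprD mulrC (Lf_shift a sq); last by lia.
by rewrite !big_ord_recr big_ord0 /= add0r add0n add1n.
Qed.

(** Three vanishing coordinates flanked by non-zero ones: the functional is killed by [X^p]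
    completed by a zero of order [5 - p] at infinity; [p = 3] and [p = 4] are the two quintic
    walls. *)
Variables (a : 'I_8 -> RR) (p : nat).
Hypotheses (p34 : (2 < p < 5)%N) (apred : a (inord p.-1) != 0) (ap : a (inord p) = 0)
  (ap1 : a (inord p.+1) = 0) (ap2 : a (inord p.+2) = 0) (ap3 : a (inord p.+3) != 0).

Lemma two_roots_not_killed : ~ killed_by 1 a.
Proof.
move=> [q [q0 sq /killsE K]]; case/eqP: q0.
have E k : (k < 7)%N -> q`_0 * a (inord k) + q`_1 * a (inord k.+1) = 0.
  by move=> lt; rewrite -[RHS](K k lt) -(@linear_kernel a 1 q 0 k) ?expr0 ?mul1r.
have /eqP := E p.-1 ltac:(lia); rewrite prednK ?ap ?mulr0 ?addr0 ?mulf_eq0 ?(negbTE apred) ?orbF; last by lia.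
move=> /eqP z0; have /eqP := E p.+2 ltac:(lia).
rewrite z0 mul0r add0r mulf_eq0 (negbTE ap3) orbF => /eqP z1.
by apply/polyP => -[|[|k]]; rewrite coef0 // nth_default // (leq_trans sq).
Qed.

Lemma two_roots_forms : RR_forms 5 a.
Proof.
exists (nseq p (0, 1) ++ nseq (5 - p) (1, 0)); split.
- by rewrite size_cat !size_nseq; lia.
- by move=> l; rewrite mem_cat => /orP[]/nseqP[-> _]; rewrite xpair_eqE oner_eq0 ?andbF.
rewrite prodf_cat !prodf_nseq /lf /= scale1r scale0r add0r addr0 expr1n mulr1.
by apply: pow_kernel => //; lia.
Qed.

(** One simple zero is added to the quintic. An obstruction would be a non-zero linear [q] such that
    [X^(p-1) q], read in degree four, kills; the two flanking coordinates force [q = 0]. *)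
Lemma two_roots_rank6 : rank_le a 6.
Proof.
pose D : seq ((RR * RR) * nat) := [:: ((0, 1), p); ((1, 0), (5 - p)%N); ((-1, 1), 1%N)].
have wD : wf D.
  rewrite /D /wf /= !xpair_eqE !oner_eq0 !andbF /= /indep /det2 /= !andbT.
  by do ![apply/andP; split]; try by []; try (by lia); apply/negP => /eqP; lra.
apply: (@split_forms 6 a D) => //.
- by rewrite /=; lia.
- rewrite /D !prodm_cons /prodm big_nil /= expr1 mulr1.
  have -> : lf (1, 0) = 1 :> {poly RR} by rewrite /lf /= scale0r addr0.
  have -> : lf (0, 1) = 'X :> {poly RR} by rewrite /lf /= scale1r add0r.
  rewrite expr1n mul1r; apply: (@kills_mulr _ 5 1) (size_lf _).
  by apply: pow_kernel => //; lia.
move=> q sq; rewrite /D !prodm_cons /prodm big_nil /= expr0 !mulr1.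
have -> : lf (1, 0) = 1 :> {poly RR} by rewrite /lf /= scale0r addr0.
have -> : lf (0, 1) = 'X :> {poly RR} by rewrite /lf /= scale1r add0r.
rewrite expr1n mulr1 => /killsE K.
have E k : (k < 4)%N -> q`_0 * a (inord (p.-1 + k)) + q`_1 * a (inord (p.-1 + k).+1) = 0.
  by move=> lt; rewrite -(@linear_kernel a 'X^(p.-1) q) ?K //; lia.
have /eqP := E 0%N isT; rewrite addn0 prednK ?ap ?mulr0 ?addr0 ?mulf_eq0 ?(negbTE apred) ?orbF; last by lia.
move=> /eqP z0; have := E 3 isT; have -> : (p.-1 + 3 = p.+2)%N by lia.
move=> /eqP; rewrite z0 mul0r add0r mulf_eq0 (negbTE ap3) orbF => /eqP z1.
by apply/polyP => -[|[|k]]; rewrite coef0 // nth_default // (leq_trans sq).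
Qed.

End TwoRoots.

Section ClosureSix.

(** The first two hypotheses persist along the beginning of the path, and the third makes the rank
    there exactly six. *)
Lemma closure_Rint6_path (A : 'I_8 -> {poly RR}) (a := fun i => (A i).[0]) :
  rank_le a 6 -> ~ killed_by 1 a -> near0 (fun e : RR => ~ RR_forms 5 (fun i => (A i).[e])) ->
  closure (Rint 6) a.
Proof.
move=> r6 nk n5; apply: closure_path.
have J : interior (fun b => ~ killed_by 1 b) a.
  apply: interior_seq => B cB; apply: NNPP => H; apply: nk; apply: (killed_by_closed cB) => n.
  by apply: NNPP => h; apply: H; exists n.
have I := interiorI (@rank_le_open 6 _ isT r6 nk) J.
apply: near0_imp (near0_and n5 (near0_interior I)) => e e0 [h5 [h6 h1]].
exact: Rint_intro.
Qed.

End ClosureSix.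

Section Good43End.

(** Place 4, the middle of the three vanishing places of [nf43], is opened: a small negative value
    there leaves rank five. *)
Definition nfd43 := [:: Some 0; Some 1; Some 2; None; Some 4; None; Some 6; Some 7]%N.

(** A sequence of counterexamples would, by [quintic_limit], carry killing quintics with real zeros
    close to [X^3]; [local43] rules them out, with [d] the opposite of coordinate 4. *)
Lemma dented43_not5 :
  interior (fun w => w (inord 4) < 0 -> ~ RR_forms 5 (nf nfd43 w)) base43.
Proof.
apply: interior_seq => A cA; apply: NNPP => H.
have HA n : A n (inord 4) < 0 /\ RR_forms 5 (nf nfd43 (A n)).
  by apply: NNPP => h; apply: H; exists n => lt F; apply: h.
have E : nf nfd43 base43 = nf nf43 base43.
  apply: functional_extensionality => -[i lt]; rewrite /nf /=.
  by case: i lt => [|[|[|[|[|[|[|[|//]]]]]]]] lt //=; rewrite /base43 inordK.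
have c : cvgs (fun n => nf nfd43 (A n)) (nf nf43 base43) by rewrite -E; apply: cvgs_nf.
have eta0 : 0 < 1 / 100 :> RR by lra.
have [n [h [near [sh K pos lc _] h3 small]]] :=
  quintic_limit (p := 3) c (fun n => proj2 (HA n)) eta0 base43_quintic.
have d0 := proj1 (HA n).
have nr j : (j < 8)%N -> `|nf nfd43 (A n) (inord j) - nf nf43 base43 (inord j)| <= 1 / 100.
  by move=> lt; apply: ltW; apply: near.
have := (nr 0 isT, nr 1 isT, nr 2 isT, (nr 4 isT, nr 6 isT, nr 7 isT)).
have := (K 0 isT, K 1 isT, K 2 isT).
rewrite !nf_inord //= /base43 !inordK //= h3 !mul1r !mulr0 !subr0 !addr0.
move=> [[k0 k1] k2] [[[n0 n1] n2] [[n4 n6] n7]].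
have [e0 e1 e2 e3] := alt_explicit h; have [e4 _] := alt_quintic sh.
have h6 : h`_6 = 0 by rewrite nth_default.
have p2 := pos 2; have p4 := pos 4; have c02 := lc 0 2 isT; have c12 := lc 1 2 isT.
rewrite e0 e1 e2 e3 h3 h6 mulr0 subr0 expr1n !mulr1 in c02.
rewrite e1 e2 e3 h3 h6 mulr0 subr0 expr1n !mulr1 in c12.
rewrite e2 h3 mulr1 in p2; rewrite e4 h3 mulr1 in p4.
have s0 := small 0%N isT isT; have s1 := small 1%N isT isT; have s2 := small 2%N isT isT.
have s4 := small 4%N isT isT; have s5 := small 5%N isT isT.
apply: (@local43 (A n (inord 0)) (A n (inord 1)) (A n (inord 2)) (A n (inord 6)) (A n (inord 7))
  (- A n (inord 4)) h`_0 h`_1 h`_2 h`_4 h`_5) => //; rewrite ?div1r //.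
- by rewrite oppr_gt0 d0 /= lerNl; move: n4; rewrite ler_norml => /andP[].
- by rewrite mulNr opprK [A n _ * _]mulrC.
- by rewrite opprK.
by rewrite mulNr opprK [A n _ * h`_2]mulrC.
Qed.

Lemma good43 : good nf43 5 6.
Proof.
apply: (@good_interior _ _ _ base43).
have n4 := interior_not_closed (@RR_forms_closed 4) base43_not4.
have base43_rigid : ~ killed_by 2 (nf nf43 base43).
  move=> [q [q0 sq /killsE K]]; case/eqP: q0.
  have E k : (k < 6)%N -> q`_0 * nf nf43 base43 (inord k) + q`_1 * nf nf43 base43 (inord k.+1) +
      q`_2 * nf nf43 base43 (inord k.+2) = 0.
    move=> lt; rewrite -[RHS](K k lt) (Lf_shift _ sq); last by lia.
    by rewrite !big_ord_recr big_ord0 /= add0r.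
  have := (E 0 isT, E 1 isT, E 2 isT); rewrite !nf_inord //= /base43 !inordK //= => -[[e0 e1] e2].
  by apply/polyP => -[|[|[|k]]]; rewrite coef0; [lra|lra|lra|rewrite nth_default // (leq_trans sq)].
have nk := interior_not_closed (@killed_by_closed 2) base43_rigid.
have i2 : interior (fun y => 0 < y (inord 2)) base43.
  by apply: interior_pos; [exact: polyfun_var|rewrite /base43 inordK].
have i6 : interior (fun y => 0 < y (inord 6)) base43.
  by apply: interior_pos; [exact: polyfun_var|rewrite /base43 inordK].
have [e e0 He] := interior_box dented43_not5.
have near : interior (fun y => forall i, `|y i - base43 i| < e) base43.
  apply: interior_seq => A cA.
  have [N HN] := eventually_all (fun i => cA i e e0); by exists N; apply: HN.
apply: interior_imp (interiorI near (interiorI (interiorI i2 i6) (interiorI n4 nk))).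
move=> y [hy [[y2 y6] [m4 mk]]].
have facts := (@two_roots_forms (nf nf43 y) 3, @two_roots_rank6 (nf nf43 y) 3,
  @two_roots_not_killed (nf nf43 y) 3).
rewrite !nf_inord //= (gt_eqF y2) (gt_eqF y6) in facts.
case: facts => [[F R6] nk1]; split.
  by apply: closure_Rint => //; apply: F.
pose A (i : 'I_8) : {poly RR} := if i == 4 :> nat then - 'X else (nf nf43 y i)%:P.
have A0 : (fun i => (A i).[0]) = nf nf43 y.
  apply: functional_extensionality => i; rewrite /A; case: eqP => [i4|_]; last exact: hornerC.
  by rewrite hornerN hornerX oppr0 /nf i4.
rewrite -A0; apply: closure_Rint6_path; rewrite ?A0; [exact: R6|exact: nk1|].
exists e => // x /andP[x0 xe].
pose w (i : 'I_8) : RR := if i == 4 :> nat then - x else y i.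
have -> : (fun i => (A i).[x]) = nf nfd43 w.
  apply: functional_extensionality => -[i lt]; rewrite /A /nf /w /=.
  by case: i lt => [|[|[|[|[|[|[|[|//]]]]]]]] lt //=;
    rewrite ?hornerN ?hornerX ?hornerC ?inordK.
apply: He; last by rewrite /w inordK //= oppr_lt0.
move=> i; rewrite /w; case: eqP => [i4|_]; last exact: hy.
by rewrite /base43 i4 /= subr0 normrN gtr0_norm.
Qed.

End Good43End.

(** * The wall of [l^4 m] between ranks five and six *)

Section Good52.

Definition base52 : 'I_8 -> RR := fun i => [:: 0; 0; 1; 1; 0; 0; 0; -1]`_i.

(** The killing quartics are the multiples of [1 - X + X^2 - X^3 + X^4], for which [alt h 1] is
    negative. *)
Lemma base52_not4 : ~ RR_forms 4 (nf nf52 base52).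
Proof.
move=> [s [sz nz /killsE K]]; have h0 := prodf_nonzero nz.
have sh : (size (prodf s) <= 5)%N by have := size_prodf s; rewrite sz.
have := sqform_ge0 s 1; rewrite -alt_prodf.
set h := prodf s in K h0 sh *; have [_ -> _ _] := alt_explicit h.
have E k : (k < 4)%N -> h`_0 * nf nf52 base52 (inord k) + h`_1 * nf nf52 base52 (inord k.+1) +
    h`_2 * nf nf52 base52 (inord k.+2) + h`_3 * nf nf52 base52 (inord k.+3) +
    h`_4 * nf nf52 base52 (inord k.+4) = 0.
  move=> lt; rewrite -[RHS](K k lt) (Lf_shift _ sh); last by lia.
  by rewrite !big_ord_recr big_ord0 /= add0r.
have := (E 0 isT, E 1 isT, (E 2 isT, E 3 isT)).
rewrite !nf_inord //= /base52 !inordK //= => -[[e0 e1] [e2 e3]] A1.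
have x1 : h`_1 = - h`_0 by lra.
have x2 : h`_2 = h`_0 by lra.
have x3 : h`_3 = - h`_0 by lra.
have x4 : h`_4 = h`_0 by lra.
rewrite x1 x2 in A1.
have x0 : h`_0 = 0 by nra.
case/eqP: h0; apply: quintic_eq0; rewrite // ?x1 ?x2 ?x3 ?x4 ?x0 ?oppr0 //.
  exact: leq_trans sh _.
by rewrite nth_default.
Qed.

(** If coefficient 2 is not zero, the argument splits on the sign of [u], the product of
    coefficients 0 and 2. For [u > 0] the inequalities from [alt] are tight and log-concavity fails;
    for [u < 0] there is no positive zero, although coefficients 1 and 2 have opposite signs. What
    survives is [X^4], that is [l^4 m] with [m] at infinity. *)
Lemma base52_quintic h : quintic_kernel (nf nf52 base52) h ->
  forall i, (i < 6)%N -> i != 4%N -> h`_i = 0.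
Proof.
move=> [sh K pos lc sg].
have := (K 0 isT, K 1 isT, K 2 isT); rewrite !nf_inord //= /base52 !inordK //= => -[[k0 k1] k2].
have [e0 e1 e2 e3] := alt_explicit h; have [e4 e5] := alt_quintic sh.
have h6 : h`_6 = 0 by rewrite nth_default.
have p1 := pos 1; have p2 := pos 2; have p3 := pos 3; have c04 := lc 0 4 isT.
rewrite e1 in p1; rewrite e2 in p2; rewrite e3 h6 in p3; rewrite e0 e1 e4 e5 in c04.
have x1 : h`_1 = - h`_2 by lra.
have x3 : h`_3 = - h`_2 by lra.
have x5 : h`_5 = h`_0 - h`_2 by lra.
rewrite x1 in p1; rewrite x1 x3 in p2; rewrite x1 x3 x5 in p3; rewrite x1 x3 x5 in c04.
have x2 : h`_2 = 0.
  apply/eqP/negPn/negP => s0; have S0 : 0 < h`_2 ^+ 2 by rewrite exprn_even_gt0.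
  pose u := h`_0 * h`_2; pose w := h`_4 * h`_2.
  have q1 : 2 * u <= h`_2 ^+ 2 by rewrite /u; clear -p1; lra.
  have q2 : h`_2 ^+ 2 * h`_2 ^+ 2 <= 2 * (u * w).
    have -> : 2 * (u * w) = 2 * h`_0 * h`_4 * h`_2 ^+ 2 by rewrite /u /w; ring.
    by apply: ler_wpM2r; [apply: sqr_ge0|clear -p2; lra].
  have q3 : 2 * (u + w) <= 3 * h`_2 ^+ 2 by rewrite /u /w; clear -p3; lra.
  have [upos|uneg] := ltrP 0 u.
    have q4 : u * w <= u * (3 / 2 * h`_2 ^+ 2 - u) by rewrite ler_wpM2l ?(ltW upos) //; clear -q3; lra.
    (* The three inequalities give [(2 u - S) (u - S) <= 0] together with [2 u <= S], hence
       equality. *)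
    have ueq : 2 * u = h`_2 ^+ 2.
      move: (h`_2 ^+ 2) S0 q1 q2 q4 => S S0 q1 q2 q4; clear -S0 q1 q2 q4.
      have q5 : (2 * u - S) * (u - S) <= 0 by lra.
      apply/eqP; rewrite eq_le q1 leNgt; apply/negP => lt.
      have : 0 < (S - 2 * u) * (S - u) by rewrite mulr_gt0 //; lra.
      lra.
    have x0 : h`_0 = h`_2 / 2.
      by apply: (mulIf s0); rewrite -/u; have := ueq; rewrite expr2; clear; lra.
    (* Now [alt h 1 = 0] while [alt h 0] and [alt h 5] are positive, against log-concavity. *)
    have := c04; rewrite x0.
    have -> : ((- h`_2) ^+ 2 - 2 * (h`_2 / 2) * h`_2) = 0 by field.
    have -> : (h`_2 / 2) ^+ 2 * (h`_2 / 2 - h`_2) ^+ 2 = (h`_2 ^+ 2) ^+ 2 / 16 by field.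
    have p16 : 0 < (h`_2 ^+ 2) ^+ 2 / 16 by apply: divr_gt0; [apply: exprn_gt0|].
    by rewrite mul0r leNgt p16.
  have un : u < 0.
    rewrite lt_neqAle uneg andbT; apply/negP => /eqP u0; move: q2; rewrite u0 mul0r mulr0.
    by apply/negP; rewrite -ltNge mulr_gt0.
  have wn : w < 0.
    have SS : 0 < h`_2 ^+ 2 * h`_2 ^+ 2 by apply: mulr_gt0.
    have : 0 < u * w by clear -SS q2; lra.
    by rewrite nmulr_rgt0.
  (* With [u] and [w] negative, the terms group into positive quantities for [t > 0], the factor
     [1 - t + t^2] being positive. *)
  have np t : 0 < t -> h.[t] != 0.
    move=> t0; suff : 0 < - (h`_2 * h.[t]).
      by apply: contraTneq => ->; rewrite mulr0 oppr0 ltxx.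
    rewrite (horner_coef_wide _ sh) !big_ord_recr big_ord0 /= x1 x3 x5.
    have -> : - (h`_2 * (0 + h`_0 * t ^+ 0 + - h`_2 * t ^+ 1 + h`_2 * t ^+ 2 + - h`_2 * t ^+ 3 +
        h`_4 * t ^+ 4 + (h`_0 - h`_2) * t ^+ 5)) =
      - u + h`_2 ^+ 2 * (t * (1 - t + t ^+ 2)) + - w * t ^+ 4 + (h`_2 ^+ 2 - u) * t ^+ 5.
      by rewrite /u /w; ring.
    have t3 : 0 < 1 - t + t ^+ 2 by clear; nra.
    have z1 : 0 < h`_2 ^+ 2 * (t * (1 - t + t ^+ 2)) by rewrite mulr_gt0 // mulr_gt0.
    have z2 : 0 < - w * t ^+ 4 by rewrite mulr_gt0 ?oppr_gt0 ?exprn_gt0.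
    have z3 : 0 < (h`_2 ^+ 2 - u) * t ^+ 5 by rewrite mulr_gt0 ?exprn_gt0 //; clear -un S0; lra.
    by clear -z1 z2 z3 un; lra.
  by have := sg np 1%N 2%N; rewrite x1 mulNr -expr2 oppr_ge0 leNgt S0.
have x0 : h`_0 = 0.
  move: c04; rewrite x2 subr0 oppr0 expr0n mulr0 subr0 mul0r -exprD.
  by rewrite le_eqVlt ltNge exprn_even_ge0 // orbF expf_eq0 => /eqP.
by case=> [|[|[|[|[|[|]]]]]] // _ _; rewrite ?x1 ?x3 ?x5 ?x2 ?x0 ?oppr0 ?addr0.
Qed.

(* With [A3 = h3^2 - 2 h2 + ...] small, log-concavity forces [h0] and [h1] to be much smaller
   than [A3], and the equations then give [d ~ h2 ~ - A3 / 2]. *)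
Lemma local52 (a0 a1 a2 a3 a7 d h0 h1 h2 h3 h5 : RR)
    (A0 := h0 ^+ 2) (A1 := h1 ^+ 2 - 2 * h0 * h2) (A2 := h2 ^+ 2 - 2 * h1 * h3 + 2 * h0)
    (A3 := h3 ^+ 2 - 2 * h2 + 2 * h1 * h5) (A4 := 1 - 2 * h3 * h5) (e := 1 / 1000 : RR) :
  `|a0| <= e -> `|a1| <= e -> `|a2 - 1| <= e -> `|a3 - 1| <= e -> `|a7 + 1| <= e -> 0 < d <= e ->
  `|h0| <= e -> `|h1| <= e -> `|h2| <= e -> `|h3| <= e -> `|h5| <= e ->
  h0 * a0 + h1 * a1 + h2 * a2 + h3 * a3 - h5 * d = 0 -> h0 * a1 + h1 * a2 + h2 * a3 - d = 0 ->
  h0 * a2 + h1 * a3 - h3 * d + h5 * a7 = 0 ->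
  0 <= A1 -> 0 <= A2 -> 0 <= A3 -> A2 * A4 <= A3 * A3 -> A1 * A4 <= A2 * A3 -> A0 * A4 <= A1 * A3 ->
  False.
Proof.
move=> s0 s1 s2 s3 s7 /andP[d0 de] t0 t1 t2 t3 t5 E0 E1 E2 p1 p2 p3 c2 c1 c0.
have dn : `|d| <= e by rewrite gtr0_norm.
have A4l : 9 / 10 <= A4.
  by have := mul_small h3 t5; rewrite /A4 /e in t3 * => m; clear -m t3; lra.
have A3u : A3 <= 3 / 1000.
  have := mul_small h3 t3; have := mul_small h1 t5; have := norm_range h2.
  by rewrite /A3 /e in t1 t2 t3 * => m1 m2 m3; clear -m1 m2 m3 t1 t2 t3; lra.
have p0 : 0 <= A0 by apply: sqr_ge0.
(* With [A4] at least [9/10], successive log-concavity bounds [A2], [A1], [A0] by constants times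
   [A3^2], [A3^3], [A3^4]. *)
have b2 : 9 * A2 <= 10 * (A3 * A3).
  have m : A2 * (9 / 10) <= A2 * A4 by apply: ler_wpM2l.
  by clear -m c2; lra.
have b1 : 81 * A1 <= 100 * (A3 * A3 * A3).
  have m : A1 * (9 / 10) <= A1 * A4 by apply: ler_wpM2l.
  have m' : 9 * A2 * A3 <= 10 * (A3 * A3) * A3 by apply: ler_wpM2r.
  by clear -m m' c1; lra.
have b0 : 729 * A0 <= 1000 * (A3 * A3 * A3 * A3).
  have m : A0 * (9 / 10) <= A0 * A4 by apply: ler_wpM2l.
  have m' : 81 * A1 * A3 <= 100 * (A3 * A3 * A3) * A3 by apply: ler_wpM2r.
  by clear -m m' c0; lra.
have eA3 : A3 = h3 * h3 - 2 * h2 + 2 * (h1 * h5) by rewrite /A3; ring.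
have h1E : h1 ^+ 2 = A1 + 2 * (h0 * h2) by rewrite /A1; ring.
have A3p := p3; move: (A3) eA3 A3u b1 b0 A3p => T eT Tu b1 b0 Tp.
have T2 : 0 <= T * T by apply: mulr_ge0.
have x0 : `|h0| <= 12 / 10 * (T * T).
  have nn : 0 <= 12 / 10 * (T * T) by apply: mulr_ge0 T2; rewrite divr_ge0.
  suff : `|h0| ^+ 2 <= (12 / 10 * (T * T)) ^+ 2 by rewrite ler_sqr ?nnegrE.
  rewrite real_normK ?num_real //.
  by have T4 := mulr_ge0 T2 T2; rewrite /A0 in b0; clear -b0 T4; lra.
have T3 : T * T * T <= T * T * (3 / 1000) by apply: ler_wpM2l.
have x1 : `|h1| <= T / 10.
  have nn : 0 <= T / 10 by rewrite divr_ge0.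
  suff : `|h1| ^+ 2 <= (T / 10) ^+ 2 by rewrite ler_sqr ?nnegrE.
  rewrite real_normK ?num_real // h1E.
  by have m := mul_small h0 t2; rewrite /e in m; clear -m b1 T3 x0 T2; lra.
have x0' : `|h0| <= T / 10.
  have m : T * T <= T * (3 / 1000) by apply: ler_wpM2l.
  by clear -m x0 Tp; lra.
have := mul_small h3 t3; have := mul_small h1 t5.
have := mul_small h0 s2; have := mul_small h1 s3; have := mul_small h3 dn; have := mul_small h5 s7.
have := mul_small h0 s0; have := mul_small h1 s1; have := mul_small h2 s2.
have := mul_small h3 s3; have := mul_small h5 dn.
have := mul_small h0 s1; have := mul_small h1 s2; have := mul_small h2 s3; rewrite /e.
move=> m1 m2 m3 m4 m5 m6 m7 m8 m9 m10 m11 m12 m13 m14.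
have r0 := norm_range h0; have r1 := norm_range h1; have r2 := norm_range h2.
have y5 : `|h5| <= `|h0| + `|h1| + 1 / 1000 * (`|h0| + `|h1| + `|h3| + `|h5|).
  by clear -E2 r0 r1 m12 m11 m10 m9; rewrite ler_norml; apply/andP; split; lra.
have y3 : `|h3| <= `|h2| + 1 / 1000 * (`|h0| + `|h1| + `|h2| + `|h3| + `|h5|).
  by clear -E0 r2 m8 m7 m6 m5 m4; rewrite ler_norml; apply/andP; split; lra.
have y2 : `|h2| <= (T + 1 / 1000 * `|h3| + 2 / 1000 * `|h1|) / 2.
  by clear -eT Tp m14 m13; rewrite ler_norml; apply/andP; split; lra.
by clear -E1 eT Tp d0 x0' x1 y5 y3 y2 r0 r1 m1 m2 m3 m13 m14; lra.
Qed.

(** Place 5, the middle of the vanishing places of [nf52], is opened, as in [nfd43]. *)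
Definition nfd52 := [:: Some 0; Some 1; Some 2; Some 3; None; Some 5; None; Some 7]%N.

Lemma dented52_not5 :
  interior (fun w => w (inord 5) < 0 -> ~ RR_forms 5 (nf nfd52 w)) base52.
Proof.
apply: interior_seq => A cA; apply: NNPP => H.
have HA n : A n (inord 5) < 0 /\ RR_forms 5 (nf nfd52 (A n)).
  by apply: NNPP => h; apply: H; exists n => lt F; apply: h.
have E : nf nfd52 base52 = nf nf52 base52.
  apply: functional_extensionality => -[i lt]; rewrite /nf /=.
  by case: i lt => [|[|[|[|[|[|[|[|//]]]]]]]] lt //=; rewrite /base52 inordK.
have c : cvgs (fun n => nf nfd52 (A n)) (nf nf52 base52) by rewrite -E; apply: cvgs_nf.
have eta0 : 0 < 1 / 1000 :> RR by lra.
have [n [h [near [sh K pos lc _] h4 small]]] :=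
  quintic_limit (p := 4) c (fun n => proj2 (HA n)) eta0 base52_quintic.
have d0 := proj1 (HA n).
have nr j : (j < 8)%N -> `|nf nfd52 (A n) (inord j) - nf nf52 base52 (inord j)| <= 1 / 1000.
  by move=> lt; apply: ltW; apply: near.
have := (nr 0 isT, nr 1 isT, nr 2 isT, (nr 3 isT, nr 5 isT, nr 7 isT)).
have := (K 0 isT, K 1 isT, K 2 isT).
rewrite !nf_inord //= /base52 !inordK //= h4 !mul1r !mulr0 !subr0 !addr0 opprK.
move=> [[k0 k1] k2] [[[n0 n1] n2] [[n3 n5] n7]].
have [e0 e1 e2 e3] := alt_explicit h; have [e4 _] := alt_quintic sh.
have h6 : h`_6 = 0 by rewrite nth_default.
have p1 := pos 1; have p2 := pos 2; have p3 := pos 3.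
have c03 := lc 0 3 isT; have c13 := lc 1 3 isT; have c23 := lc 2 3 isT.
rewrite e0 e1 e3 e4 h4 h6 mulr0 subr0 expr1n !mulr1 in c03.
rewrite e1 e2 e3 e4 h4 h6 mulr0 subr0 expr1n !mulr1 in c13.
rewrite e2 e3 e4 h4 h6 mulr0 subr0 expr1n !mulr1 in c23.
rewrite e1 in p1; rewrite e2 h4 mulr1 in p2; rewrite e3 h4 h6 mulr0 subr0 mulr1 in p3.
have s0 := small 0%N isT isT; have s1 := small 1%N isT isT; have s2 := small 2%N isT isT.
have s3 := small 3%N isT isT; have s5 := small 5%N isT isT.
apply: (@local52 (A n (inord 0)) (A n (inord 1)) (A n (inord 2)) (A n (inord 3)) (A n (inord 7))
  (- A n (inord 5)) h`_0 h`_1 h`_2 h`_3 h`_5) => //; rewrite ?div1r //.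
- by rewrite oppr_gt0 d0 /= lerNl; move: n5; rewrite ler_norml => /andP[].
- by rewrite mulrN opprK.
- by rewrite opprK.
by rewrite mulrN opprK.
Qed.

Lemma good52 : good nf52 5 6.
Proof.
apply: (@good_interior _ _ _ base52).
have n4 := interior_not_closed (@RR_forms_closed 4) base52_not4.
have base52_rigid : ~ killed_by 2 (nf nf52 base52).
  move=> [q [q0 sq /killsE K]]; case/eqP: q0.
  have E k : (k < 6)%N -> q`_0 * nf nf52 base52 (inord k) + q`_1 * nf nf52 base52 (inord k.+1) +
      q`_2 * nf nf52 base52 (inord k.+2) = 0.
    move=> lt; rewrite -[RHS](K k lt) (Lf_shift _ sq); last by lia.
    by rewrite !big_ord_recr big_ord0 /= add0r.
  have := (E 2 isT, E 3 isT, E 5 isT); rewrite !nf_inord //= /base52 !inordK //= => -[[e0 e1] e2].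
  by apply/polyP => -[|[|[|k]]]; rewrite coef0; [lra|lra|lra|rewrite nth_default // (leq_trans sq)].
have nk := interior_not_closed (@killed_by_closed 2) base52_rigid.
have i3 : interior (fun y => 0 < y (inord 3)) base52.
  by apply: interior_pos; [exact: polyfun_var|rewrite /base52 inordK].
have i7 : interior (fun y => 0 < - y (inord 7)) base52.
  apply: (interior_pos (G := fun y => - y (inord 7))).
    by apply: polyfun_opp; apply: polyfun_var.
  by rewrite /base52 inordK //= opprK.
have [e e0 He] := interior_box dented52_not5.
have near : interior (fun y => forall i, `|y i - base52 i| < e) base52.
  apply: interior_seq => A cA.
  have [N HN] := eventually_all (fun i => cA i e e0); by exists N; apply: HN.
apply: interior_imp (interiorI near (interiorI (interiorI i3 i7) (interiorI n4 nk))).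
move=> y [hy [[y3 y7] [m4 mk]]].
have y7' : y (inord 7) != 0 by rewrite -oppr_eq0 gt_eqF.
have facts := (@two_roots_forms (nf nf52 y) 4, @two_roots_rank6 (nf nf52 y) 4,
  @two_roots_not_killed (nf nf52 y) 4).
rewrite !nf_inord //= (gt_eqF y3) y7' in facts.
case: facts => [[F R6] nk1]; split.
  by apply: closure_Rint => //; apply: F.
pose A (i : 'I_8) : {poly RR} := if i == 5 :> nat then - 'X else (nf nf52 y i)%:P.
have A0 : (fun i => (A i).[0]) = nf nf52 y.
  apply: functional_extensionality => i; rewrite /A; case: eqP => [i4|_]; last exact: hornerC.
  by rewrite hornerN hornerX oppr0 /nf i4.
rewrite -A0; apply: closure_Rint6_path; rewrite ?A0; [exact: R6|exact: nk1|].
exists e => // x /andP[x0 xe].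
pose w (i : 'I_8) : RR := if i == 5 :> nat then - x else y i.
have -> : (fun i => (A i).[x]) = nf nfd52 w.
  apply: functional_extensionality => -[i lt]; rewrite /A /nf /w /=.
  by case: i lt => [|[|[|[|[|[|[|[|//]]]]]]]] lt //=;
    rewrite ?hornerN ?hornerX ?hornerC ?inordK.
apply: He; last by rewrite /w inordK //= oppr_lt0.
move=> i; rewrite /w; case: eqP => [i4|_]; last exact: hy.
by rewrite /base52 i4 /= subr0 normrN gtr0_norm.
Qed.

End Good52.

Lemma dense43 r r' (G : ('I_8 -> CC) -> CC) : r != r' -> good nf43 r r' -> polyfun G ->
  (forall a, topbd (Rint r) a -> G (complexify a) = 0) ->
  forall z, dual_CRL [:: 4; 3]%N z -> G z = 0.
Proof.
move=> ne g pG GT z /(@dual2P z 3 2 isT)[l [m [l0 m0 K]]].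
apply: (dense_two (s := nf43) (p := 2) (q := 3) pG (good_vanish ne g pG GT) _ _ _ l0 m0) => //.
  by case=> [|[|[|[|[|[|[|[|]]]]]]]].
by rewrite mulrC.
Qed.

Lemma dense52 r r' (G : ('I_8 -> CC) -> CC) : r != r' -> good nf52 r r' -> polyfun G ->
  (forall a, topbd (Rint r) a -> G (complexify a) = 0) ->
  forall z, dual_CRL [:: 5; 2]%N z -> G z = 0.
Proof.
move=> ne g pG GT z /(@dual2P z 4 1 isT)[l [m [l0 m0 K]]].
apply: (dense_two (s := nf52) (p := 1) (q := 4) pG (good_vanish ne g pG GT) _ _ _ l0 m0) => //.
  by case=> [|[|[|[|[|[|[|[|]]]]]]]].
by rewrite mulrC.
Qed.

Lemma dense7 r r' (G : ('I_8 -> CC) -> CC) : r != r' -> good nf7 r r' -> polyfun G ->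
  (forall a, topbd (Rint r) a -> G (complexify a) = 0) ->
  forall z, dual_CRL [:: 7]%N z -> G z = 0.
Proof.
move=> ne g pG GT z /dual7P[l l0 K].
apply: (dense_two (s := nf7) (p := 0) (q := 6) pG (good_vanish ne g pG GT) _ _ _ l0 l0) => //.
  by case=> [|[|[|[|[|[|[|[|]]]]]]]].
by rewrite expr0 mul1r.
Qed.

Lemma dense322 r r' (G : ('I_8 -> CC) -> CC) : r != r' -> good nf322 r r' -> polyfun G ->
  (forall a, topbd (Rint r) a -> G (complexify a) = 0) ->
  forall z, dual_CRL [:: 3; 2; 2]%N z -> G z = 0.
Proof.
move=> ne g pG GT z /dual322P[l [m [n [l0 m0 n0 K]]]].
exact: (dense_322 pG (good_vanish ne g pG GT) _ l0 m0 n0 K).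
Qed.

Local Close Scope ring_scope.

Theorem theorem4p1 :
  (forall z, real_rank_boundary 4 z <-> dual_CRL [:: 3; 2; 2]%N z) /\
  (forall z, real_rank_boundary 5 z <->
     dual_CRL [:: 3; 2; 2]%N z \/ dual_CRL [:: 4; 3]%N z \/ dual_CRL [:: 5; 2]%N z) /\
  (forall z, real_rank_boundary 6 z <->
     dual_CRL [:: 4; 3]%N z \/ dual_CRL [:: 5; 2]%N z \/ dual_CRL [:: 7]%N z) /\
  (forall z, real_rank_boundary 7 z <-> dual_CRL [:: 7]%N z).
Proof.
split; [|split; [|split]]; apply: boundary_eq.
- exact: dual322_closed.
- exact: topbd_dual4.
- by move=> G pG GT; apply: (dense322 (r := 4) (r' := 5) isT good322 pG GT).
- exact: closed_funU dual322_closed (closed_funU dual43_closed dual52_closed).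
- by move=> a /topbd_dual5[]; tauto.
- move=> G pG GT z [|[]].
  + exact: (dense322 (r := 5) (r' := 4) isT (good_sym good322) pG GT).
  + exact: (dense43 (r := 5) (r' := 6) isT good43 pG GT).
  exact: (dense52 (r := 5) (r' := 6) isT good52 pG GT).
- exact: closed_funU dual43_closed (closed_funU dual52_closed dual7_closed).
- by move=> a /topbd_dual6[]; tauto.
- move=> G pG GT z [|[]].
  + exact: (dense43 (r := 6) (r' := 5) isT (good_sym good43) pG GT).
  + exact: (dense52 (r := 6) (r' := 5) isT (good_sym good52) pG GT).
  exact: (dense7 (r := 6) (r' := 7) isT good7 pG GT).
- exact: dual7_closed.
- exact: topbd_dual7.
by move=> G pG GT z; apply: (dense7 (r := 7) (r' := 6) isT (good_sym good7) pG GT).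
Qed.
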